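(* Let $\alpha>0$ and $\varphi(z)=\alpha(\log^+|z|)^2$. For a sequence $\Lambda\subset\mathbb{C}$ the following are equivalent: (1) $\Lambda$ is a complete interpolating sequence for $\mathcal{F}^\infty_\varphi$; (2) for some $\lambda\in\Lambda$ the sequence $\Lambda\setminus\{\lambda\}$ is a complete interpolating sequence for $\mathcal{F}^2_\varphi$; (3) $\Lambda\neq\emptyset$ and for every $\lambda\in\Lambda$ the sequence $\Lambda\setminus\{\lambda\}$ is a complete interpolating sequence for $\mathcal{F}^2_\varphi$.
   Context: Here $\log^+ t=\max(\log t,0)$ and $m$ is planar Lebesgue measure. Sequences $\Lambda\subset\mathbb{C}$ are (countable) sets of distinct points. $\mathcal{F}^2_\varphi$ is the Hilbert space of entire functions $f$ with $\|f\|_{\varphi,2}^2=\int_{\mathbb{C}}|f|^2e^{-2\varphi}\,dm<\infty$; $\mathbf{k}_z$ is its reproducing kernel at $z$. For $v=(v_\lambda)_{\lambda\in\Lambda}$ put $\|v\|_{\varphi,2,\Lambda}^2=\sum_{\lambda\in\Lambda}|v_\lambda|^2/\mathbf{k}_\lambda(\lambda)$. $\Lambda$ is sampling for $\mathcal{F}^2_\varphi$ if there is $C>0$ with $C^{-1}\|f\|_{\varphi,2}\le\|f|_\Lambda\|_{\varphi,2,\Lambda}\le C\|f\|_{\varphi,2}$ for all $f\in\mathcal{F}^2_\varphi$; it is interpolating for $\mathcal{F}^2_\varphi$ if for every $v$ with $\|v\|_{\varphi,2,\Lambda}<\infty$ there is $f\in\mathcal{F}^2_\varphi$ with $f|_\Lambda=v$.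 $\mathcal{F}^\infty_\varphi$ is the space of entire functions $f$ with $\|f\|_{\varphi,\infty}=\sup_{z\in\mathbb{C}}|f(z)|e^{-\varphi(z)}<\infty$. For $v=(v_\lambda)_{\lambda\in\Lambda}$ put $\|v\|_{\varphi,\infty,\Lambda}=\sup_{\lambda\in\Lambda}|v_\lambda|e^{-\varphi(\lambda)}$. $\Lambda$ is sampling for $\mathcal{F}^\infty_\varphi$ if there is $L>0$ with $\|f\|_{\varphi,\infty}\le L\|f|_\Lambda\|_{\varphi,\infty,\Lambda}$ for all $f\in\mathcal{F}^\infty_\varphi$; it is interpolating for $\mathcal{F}^\infty_\varphi$ if for every $v$ with $\|v\|_{\varphi,\infty,\Lambda}<\infty$ there is $f\in\mathcal{F}^\infty_\varphi$ with $f|_\Lambda=v$. In each space, a complete interpolating sequence is one that is both sampling and interpolating. *)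

(* Defs.v *)
From HB Require Import structures.
From mathcomp Require Import all_boot all_order all_algebra.
From mathcomp Require Import complex.
From mathcomp Require Import all_classical all_reals all_analysis.

Set Implicit Arguments.
Unset Strict Implicit.
Unset Printing Implicit Defensive.

Import Order.TTheory GRing.Theory Num.Theory.
Import numFieldNormedType.Exports.

Local Open Scope classical_set_scope.
Local Open Scope ring_scope.
Local Open Scope complex_scope.

(* The norm of the ring R[i] takes its values in R[i]; [cmod] is its real form. *)
Definition cmod (R : realType) (z : R[i]) : R := ComplexField.Normc.normc z.

(* R[i]^o is the normed module of R[i] over the field R[i], so the increments
   are complex and this is differentiability in the complex sense. *)
Definition entire (R : realType) (f : R[i] -> R[i]) : Prop :=
  forall z : R[i], derivable (f : R[i]^o -> R[i]^o) z 1.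

Definition planar_lebesgue (R : realType) :
    {measure set (measurableTypeR R * measurableTypeR R)%type -> \bar R} :=
  (lebesgue_measure \x lebesgue_measure)%E.

Definition to_complex (R : realType) (p : R * R) : R[i] := p.1 +i* p.2.

Definition planar_integral (R : realType) (F : R[i] -> R[i]) : R[i] :=
  (\int[planar_lebesgue R]_p complex.Re (F (to_complex p))) +i*
  (\int[planar_lebesgue R]_p complex.Im (F (to_complex p))).

(* ln vanishes on nonpositive arguments, hence logplus 0 = 0. *)
Definition logplus (R : realType) (t : R) : R := Num.max (ln t) 0.

Definition logsq_weight (R : realType) (alpha : R) (z : R[i]) : R :=
  alpha * logplus (cmod z) ^+ 2.

Definition norm2 (R : realType) (phi : R[i] -> R) (f : R[i] -> R[i]) : \bar R :=
  sqrte (\int[planar_lebesgue R]_p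
    (cmod (f (to_complex p)) ^+ 2 * expR (- (2 * phi (to_complex p))))%:E)%E.

Definition fock2 (R : realType) (phi : R[i] -> R) : set (R[i] -> R[i]) :=
  [set f | entire f /\ (norm2 phi f < +oo)%E].

Definition inner2 (R : realType) (phi : R[i] -> R) (f g : R[i] -> R[i]) : R[i] :=
  planar_integral (fun z => f z * (g z)^* * (expR (- (2 * phi z)))%:C).

Definition repr_kernel (R : realType) (phi : R[i] -> R) (z : R[i]) :
    R[i] -> R[i] :=
  xget (fun=> 0)
    [set k | fock2 phi k /\ forall f, fock2 phi f -> f z = inner2 phi f k].

(* k_z(z) is real, being the square of the norm of k_z. *)
Definition seq_norm2 (R : realType) (phi : R[i] -> R) (Lambda : set R[i])
    (v : R[i] -> R[i]) : \bar R :=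
  sqrte (\esum_(l in Lambda)
    (cmod (v l) ^+ 2 / complex.Re (repr_kernel phi l l))%:E)%E.

Definition sampling2 (R : realType) (phi : R[i] -> R) (Lambda : set R[i]) :
    Prop :=
  exists2 c : R, 0 < c & forall f, fock2 phi f ->
    (c^-1%:E * norm2 phi f <= seq_norm2 phi Lambda f)%E /\
    (seq_norm2 phi Lambda f <= c%:E * norm2 phi f)%E.

(* Families indexed by Lambda are given as functions on R[i], whose values
   off Lambda play no role. *)
Definition interpolating2 (R : realType) (phi : R[i] -> R)
    (Lambda : set R[i]) : Prop :=
  forall v : R[i] -> R[i], (seq_norm2 phi Lambda v < +oo)%E ->
    exists2 f, fock2 phi f & forall l, Lambda l -> f l = v l.

Definition complete_interpolating2 (R : realType) (phi : R[i] -> R)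
    (Lambda : set R[i]) : Prop :=
  sampling2 phi Lambda /\ interpolating2 phi Lambda.

(* The supremum is taken in [0, +oo], so it is 0 when Lambda is empty. *)
Definition seq_norm_infty (R : realType) (phi : R[i] -> R)
    (Lambda : set R[i]) (v : R[i] -> R[i]) : \bar R :=
  maxe 0%E (ereal_sup [set (cmod (v l) * expR (- phi l))%:E | l in Lambda]).

Definition norm_infty (R : realType) (phi : R[i] -> R) (f : R[i] -> R[i]) :
    \bar R :=
  ereal_sup [set (cmod (f z) * expR (- phi z))%:E | z in [set: R[i]]].

Definition fock_infty (R : realType) (phi : R[i] -> R) : set (R[i] -> R[i]) :=
  [set f | entire f /\ (norm_infty phi f < +oo)%E].

Definition sampling_infty (R : realType) (phi : R[i] -> R)
    (Lambda : set R[i]) : Prop :=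
  exists2 L : R, 0 < L & forall f, fock_infty phi f ->
    (norm_infty phi f <= L%:E * seq_norm_infty phi Lambda f)%E.

Definition interpolating_infty (R : realType) (phi : R[i] -> R)
    (Lambda : set R[i]) : Prop :=
  forall v : R[i] -> R[i], (seq_norm_infty phi Lambda v < +oo)%E ->
    exists2 f, fock_infty phi f & forall l, Lambda l -> f l = v l.

Definition complete_interpolating_infty (R : realType) (phi : R[i] -> R)
    (Lambda : set R[i]) : Prop :=
  sampling_infty phi Lambda /\ interpolating_infty phi Lambda.

(* Main.v *)
(* Put q = e^(-1/(4 alpha)). The weight is radial, so monomials are orthogonal and
   their norms are Gaussian integrals: an entire function sum a_n z^n belongs to
   F^infty iff |a_n| <= C q^(n^2), and to F^2 iff (a_n q^(-(n+1)^2)) is square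
   summable. With a_n = c_n q^(n^2), the values at the points z of Lambda times
   e^(-phi(z)) are obtained from (c_n) by a matrix whose entries satisfy
   |A(z,n)| <= exp(-(n - x)^2/(4 alpha)), where x = 2 alpha log^+|z|, almost with
   equality for n near x. For such a localized matrix, being bounded below and onto
   on bounded sequences is the same as being so on square summable ones: conjugating
   by r^|n-k| with r < 1 close to 1 changes the matrix little (Combes-Thomas).
   The square summable c_n form a Hilbert space H of entire functions, and dividing
   by z - lambda maps the functions of H vanishing at lambda isomorphically onto
   F^2; since k_z(z) is comparable to e^(2 phi(z)) / max(1,|z|)^2, the norms on
   Lambda and on Lambda minus {lambda} correspond too. *)

Require Import Defs.
From mathcomp Require Import all_boot all_order all_algebra.
From mathcomp Require Import complex.
From mathcomp Require Import all_classical all_reals all_analysis.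
From mathcomp Require Import measurable_realfun ring lra zify.

Set Implicit Arguments.
Unset Strict Implicit.
Unset Printing Implicit Defensive.

Import Order.TTheory GRing.Theory Num.Theory.
Import numFieldNormedType.Exports.

Local Open Scope classical_set_scope.
Local Open Scope ring_scope.
Local Open Scope complex_scope.

(** Up to constants, z^n has in F^2 the norm that z^(n+1) has in H: [peak n] is [gauss n.+1].
    Multiplication by z - lambda thus acts on norms like the shift z^n -> z^(n+1), which is why
    exactly one point separates the two problems. In the matrix problem the points enter only
    through the decay of the rows and the lower bound at the entry [kap t]. On bounded sequences the
    decay alone bounds the operator; on square summable ones this also takes a bound on the columns,
    that is, on the number of points per level. Towards l2 it comes by duality from the solvability
    of the interpolation problem; backwards it comes from the l2 upper bound at unit vectors and the
    lower bound on the diagonal. The Gaussian decay is weakened to 8^-d: commuting with the slowly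
    varying weights costs 4^d, and 2^-d is still summable. Plane integrals avoid polar coordinates:
    z^n and z^m are orthogonal because the weight is invariant under one rotation of infinite order,
    and the norms of monomials are estimated with rectangles and discs. *)

(** * The modulus as a real number *)

Lemma cmod_normr (R : realType) (z : R[i]) : `|z| = (cmod z)%:C.
Proof. by rewrite normc_def /cmod; case: z. Qed.

Lemma cmodE (R : realType) (z : R[i]) :
  cmod z = Num.sqrt (complex.Re z ^+ 2 + complex.Im z ^+ 2).
Proof. by case: z. Qed.

Lemma cmod_ge0 (R : realType) (z : R[i]) : 0 <= cmod z.
Proof. by rewrite cmodE sqrtr_ge0. Qed.

Lemma cmod0 (R : realType) : cmod (0 : R[i]) = 0.
Proof. exact: ComplexField.Normc.normc0. Qed.

Lemma cmod1 (R : realType) : cmod (1 : R[i]) = 1.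
Proof. exact: ComplexField.Normc.normc1. Qed.

Lemma cmodM (R : realType) (z w : R[i]) : cmod (z * w) = cmod z * cmod w.
Proof. exact: ComplexField.Normc.normcM. Qed.

Lemma cmodV (R : realType) (z : R[i]) : cmod z^-1 = (cmod z)^-1.
Proof. exact: ComplexField.Normc.normcV. Qed.

Lemma cmodX (R : realType) (z : R[i]) n : cmod (z ^+ n) = cmod z ^+ n.
Proof. by elim: n => [|n IH]; rewrite ?expr0 ?cmod1// !exprS cmodM IH. Qed.

Lemma cmodN (R : realType) (z : R[i]) : cmod (- z) = cmod z.
Proof. exact: normcN. Qed.

Lemma cmodD_le (R : realType) (z w : R[i]) : cmod (z + w) <= cmod z + cmod w.
Proof. exact: le_normcD. Qed.

Lemma cmodB_le (R : realType) (z w : R[i]) : cmod (z - w) <= cmod z + cmod w.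
Proof. by rewrite -[cmod w]cmodN cmodD_le. Qed.

Lemma cmodC (R : realType) (z w : R[i]) : cmod (z - w) = cmod (w - z).
Proof. by rewrite -cmodN opprB. Qed.

Lemma cmodB_ge (R : realType) (z w : R[i]) : cmod z - cmod w <= cmod (z - w).
Proof. by rewrite lerBlDr (le_trans _ (cmodD_le _ _))// subrK. Qed.

Lemma cmod_eq0 (R : realType) (z : R[i]) : (cmod z == 0) = (z == 0).
Proof.
apply/eqP/eqP => [/ComplexField.Normc.eq0_normc//|->]; exact: cmod0.
Qed.

Lemma cmod_gt0 (R : realType) (z : R[i]) : (0 < cmod z) = (z != 0).
Proof. by rewrite lt0r cmod_ge0 andbT cmod_eq0. Qed.

Lemma cmod_real (R : realType) (x : R) : cmod x%:C = `|x|.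
Proof. by rewrite cmodE /= expr0n addr0 sqrtr_sqr. Qed.

Lemma cmod_i (R : realType) : cmod ('i : R[i]) = 1.
Proof. by rewrite cmodE /= expr0n add0r expr1n sqrtr1. Qed.

Lemma cmod_sqr (R : realType) (z : R[i]) :
  cmod z ^+ 2 = complex.Re z ^+ 2 + complex.Im z ^+ 2.
Proof. by rewrite cmodE sqr_sqrtr// addr_ge0 ?sqr_ge0. Qed.

Lemma cmod_conj (R : realType) (z : R[i]) : cmod z^* = cmod z.
Proof. by case: z => a b; rewrite !cmodE /= sqrrN. Qed.

Lemma mulc_conj (R : realType) (z : R[i]) : z * z^* = (cmod z ^+ 2)%:C.
Proof. by rewrite cmod_sqr; case: z => a b; simpc; congr (_ +i* _); ring. Qed.

Lemma normRe_le_cmod (R : realType) (z : R[i]) : `|complex.Re z| <= cmod z.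
Proof. by rewrite -sqrtr_sqr cmodE ler_wsqrtr// lerDl sqr_ge0. Qed.

Lemma normIm_le_cmod (R : realType) (z : R[i]) : `|complex.Im z| <= cmod z.
Proof. by rewrite -sqrtr_sqr cmodE ler_wsqrtr// lerDr sqr_ge0. Qed.

Lemma cmod_le_ReIm (R : realType) (z : R[i]) :
  cmod z <= `|complex.Re z| + `|complex.Im z|.
Proof.
rewrite cmodE -(@ler_pXn2r _ 2)// ?nnegrE ?sqrtr_ge0 ?addr_ge0//.
rewrite sqr_sqrtr ?addr_ge0 ?sqr_ge0// sqrrD !real_normK ?num_real// lerD2r.
by rewrite lerDl mulrn_wge0 ?mulr_ge0.
Qed.

Lemma Re_addc (R : realType) (z w : R[i]) :
  complex.Re (z + w) = complex.Re z + complex.Re w.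
Proof. by case: z w => a b []. Qed.

Lemma Im_addc (R : realType) (z w : R[i]) :
  complex.Im (z + w) = complex.Im z + complex.Im w.
Proof. by case: z w => a b []. Qed.

Lemma Re_mulc (R : realType) (z w : R[i]) :
  complex.Re (z * w) = complex.Re z * complex.Re w - complex.Im z * complex.Im w.
Proof. by case: z w => a b []. Qed.

Lemma Im_mulc (R : realType) (z w : R[i]) :
  complex.Im (z * w) = complex.Re z * complex.Im w + complex.Im z * complex.Re w.
Proof. by case: z w => a b []. Qed.

Lemma cmod_sqD (R : realType) (z w : R[i]) :
  cmod (z + w) ^+ 2 = cmod z ^+ 2 + cmod w ^+ 2 + 2 * complex.Re (z * w^*).
Proof. by case: z w => [a b] [c d]; rewrite !cmod_sqr /=; ring. Qed.

Lemma cmod_sqD_le (R : realType) (z w : R[i]) :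
  cmod (z + w) ^+ 2 <= 2 * cmod z ^+ 2 + 2 * cmod w ^+ 2.
Proof.
case: z w => [a b] [c d]; rewrite !cmod_sqr /=.
have := sqr_ge0 (a - c); have := sqr_ge0 (b - d); lra.
Qed.

Lemma Re_oppc (R : realType) (z : R[i]) : complex.Re (- z) = - complex.Re z.
Proof. by case: z. Qed.

Lemma Im_oppc (R : realType) (z : R[i]) : complex.Im (- z) = - complex.Im z.
Proof. by case: z. Qed.

(** * Complex differentiability with real epsilons *)

(** The difference quotient is multiplied out, so that h = 0 is no exception, and the epsilons are
    real although the norm of R[i] takes its values in R[i]. *)
Definition cdiff (R : realType) (f : R[i] -> R[i]) (z d : R[i]) : Prop :=
  forall e : R, 0 < e -> exists2 r : R, 0 < r & forall h, cmod h < r ->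
    cmod (f (z + h) - f z - d * h) <= e * cmod h.

Lemma diffquot_cvgP (K : numFieldType) (f : K^o -> K^o) (z d : K) :
  (h^-1 *: ((f \o shift z) (h *: (1 : K^o)) - f z : K^o)
      @[h --> (0 : K)^'] --> (d : K^o)) <-> forall e : K, 0 < e ->
    exists2 r : K, 0 < r & forall h, `|h| < r ->
      `|f (z + h) - f z - d * h| <= e * `|h|.
Proof.
have E (h : K) : h != 0 -> f (z + h) - f z - d * h =
   - h * (d - h^-1 * (f (h + z) - f z)).
  by move=> hn0; rewrite (addrC z h); field.
split.
  move=> /cvgrPdist_le H e e0.
  have /nbhs_ballP[r /= r0 Hr] := H _ e0.
  exists r => // h hr; have [->|hn0] := eqVneq h 0.
    by rewrite addr0 mulr0 subrr subr0 normr0 mulr0.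
  have := Hr h; rewrite /ball /= sub0r normrN => /(_ hr hn0).
  rewrite -[_ *: 1]/(h * 1) mulr1 => Hh.
  by rewrite E// normrM normrN mulrC ler_wpM2r.
move=> H; apply/cvgrPdist_le => e e0.
have [r r0 Hr] := H _ e0.
apply/nbhs_ballP; exists r => //.
move=> h; rewrite /ball /= sub0r normrN => hr hn0.
rewrite -[_ *: 1]/(h * 1) mulr1.
have hp : 0 < `|h| by rewrite normr_gt0.
rewrite -(ler_pM2l hp) [leRHS]mulrC -(normrN h) -normrM normrN.
by rewrite -E//; exact: Hr.
Qed.

(** Stated over any [numFieldType] because it serves twice: over R[i] for [cdiff], and over R for
    the derivative along a segment in [seg_ftc]. *)
Lemma is_derive_numP (K : numFieldType) (f : K^o -> K^o) (z d : K) :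
  is_derive (z : K^o) 1 f d <-> forall e : K, 0 < e ->
    exists2 r : K, 0 < r & forall h, `|h| < r ->
      `|f (z + h) - f z - d * h| <= e * `|h|.
Proof.
split.
  by move=> [df E]; apply/diffquot_cvgP; rewrite -E; exact: df.
move=> /diffquot_cvgP H; split; first by apply/cvg_ex; exists d.
by apply: cvg_lim => //; exact: norm_hausdorff.
Qed.

Lemma is_derive_cdiff (R : realType) (f : R[i] -> R[i]) (z d : R[i]) :
  is_derive (z : R[i]^o) 1 (f : R[i]^o -> R[i]^o) d <-> cdiff f z d.
Proof.
have pos (e : R[i]) : 0 < e -> exists2 e1 : R, 0 < e1 & e = e1%:C.
  by case: e => a b; rewrite ltcE /= => /andP[/eqP -> a0]; exists a.
split.
  move=> /is_derive_numP H e e0.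
  have [|r /pos[r1 r10 ->] Hr] := H e%:C; first by rewrite ltcR.
  exists r1 => // h hr; have := Hr h.
  by rewrite !cmod_normr ltcR -rmorphM lecR; exact.
move=> H; apply/is_derive_numP => _ /pos[e e0 ->].
have [r r0 Hr] := H e e0.
exists r%:C; first by rewrite ltcR.
by move=> h; rewrite !cmod_normr ltcR -rmorphM lecR; exact: Hr.
Qed.

Lemma derivable_cdiff (R : realType) (f : R[i] -> R[i]) (z : R[i]) :
  derivable (f : R[i]^o -> R[i]^o) z 1 <-> exists d, cdiff f z d.
Proof.
split.
  by move=> /derivableP H; exists ('D_1 (f : R[i]^o -> R[i]^o) z); apply/is_derive_cdiff.
by move=> [d /is_derive_cdiff[]].
Qed.

Definition ccont (R : realType) (f : R[i] -> R[i]) (z : R[i]) : Prop :=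
  forall e : R, 0 < e -> exists2 r : R, 0 < r & forall h, cmod h < r ->
    cmod (f (z + h) - f z) <= e.

Lemma cdiff_ccont (R : realType) (f : R[i] -> R[i]) (z d : R[i]) :
  cdiff f z d -> ccont f z.
Proof.
move=> /(_ _ ltr01)[r r0 H] e e0.
have D0 : 0 < 1 + cmod d by rewrite ltr_pwDl// cmod_ge0.
exists (Num.min r (e / (1 + cmod d))); first by rewrite lt_min r0 divr_gt0.
move=> h; rewrite lt_min ltr_pdivlMr// => /andP[/H h1 h2].
have -> : f (z + h) - f z = (f (z + h) - f z - d * h) + d * h by ring.
rewrite (le_trans (cmodD_le _ _))// cmodM; move: h1 h2; lra.
Qed.

(** * Complex-valued integrals and series *)

Section complex_integral.
Context d (T : measurableType d) (R : realType).
Variable mu : {measure set T -> \bar R}.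
Implicit Types (D : set T) (F G : T -> R[i]).

Definition cmeasurable D F : Prop :=
  measurable_fun D (fun x => complex.Re (F x)) /\
  measurable_fun D (fun x => complex.Im (F x)).

Definition cintegrable D F : Prop :=
  mu.-integrable D (fun x => (complex.Re (F x))%:E) /\
  mu.-integrable D (fun x => (complex.Im (F x))%:E).

Definition cint D F : R[i] :=
  (\int[mu]_(x in D) complex.Re (F x)) +i* (\int[mu]_(x in D) complex.Im (F x)).

Lemma cmeasurable_cst D c : cmeasurable D (fun=> c).
Proof. by split; exact: measurable_cst. Qed.

Lemma cmeasurableD D F G : cmeasurable D F -> cmeasurable D G ->
  cmeasurable D (fun x => F x + G x).
Proof.
move=> [F1 F2] [G1 G2]; split.
  by under eq_fun do rewrite Re_addc; exact: measurable_funD.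
by under eq_fun do rewrite Im_addc; exact: measurable_funD.
Qed.

Lemma cmeasurableM D F G : cmeasurable D F -> cmeasurable D G ->
  cmeasurable D (fun x => F x * G x).
Proof.
move=> [F1 F2] [G1 G2]; split.
  by under eq_fun do rewrite Re_mulc; apply: measurable_funB; exact: measurable_funM.
by under eq_fun do rewrite Im_mulc; apply: measurable_funD; exact: measurable_funM.
Qed.

Lemma cmeasurableX D F n : cmeasurable D F -> cmeasurable D (fun x => F x ^+ n).
Proof.
move=> mF; elim: n => [|n IH]; first exact: cmeasurable_cst.
by under [X in cmeasurable _ X]eq_fun do rewrite exprS; exact: cmeasurableM.
Qed.

Lemma cmeasurable_sum D (F : nat -> T -> R[i]) n :
  (forall i, cmeasurable D (F i)) ->
  cmeasurable D (fun x => \sum_(i < n) F i x).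
Proof.
move=> mF; elim: n => [|n IH].
  by under [X in cmeasurable _ X]eq_fun do rewrite big_ord0; exact: cmeasurable_cst.
under [X in cmeasurable _ X]eq_fun do rewrite big_ord_recr/=.
exact: cmeasurableD.
Qed.

Lemma cmeasurable_conj D F : cmeasurable D F -> cmeasurable D (fun x => (F x)^*).
Proof.
move=> [F1 F2]; split.
  by rewrite (_ : (fun x => _) = fun x => complex.Re (F x))//; apply/funext => x;
    case: (F x).
rewrite (_ : (fun x => _) = fun x => - complex.Im (F x)); last first.
  by apply/funext => x; case: (F x).
exact: measurable_funN.
Qed.

Lemma cmeasurable_real D (f : T -> R) :
  measurable_fun D f -> cmeasurable D (fun x => (f x)%:C).
Proof. by move=> mf; split => //=; exact: measurable_cst. Qed.

Lemma measurable_cmod D F : measurable D -> cmeasurable D F ->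
  measurable_fun D (fun x => cmod (F x)).
Proof.
move=> mD [F1 F2]; under eq_fun do rewrite cmodE.
apply: (@measurableT_comp _ _ _ _ _ _ (@Num.sqrt R)).
  by apply: continuous_measurable_fun; exact: sqrt_continuous.
by apply: measurable_funD; exact: measurable_funX.
Qed.

Lemma cintegrable_cmeasurable D F : measurable D ->
  cintegrable D F -> cmeasurable D F.
Proof.
by move=> mD [F1 F2]; split; apply/measurable_EFinP; [apply: measurable_int F1|
  apply: measurable_int F2].
Qed.

Lemma cintegrableP D F : measurable D -> cmeasurable D F ->
  (\int[mu]_(x in D) (cmod (F x))%:E < +oo)%E -> cintegrable D F.
Proof.
move=> mD mF iF; have mc := measurable_cmod mD mF.
have ic : mu.-integrable D (fun x => (cmod (F x))%:E).
  apply/integrableP; split; first exact/measurable_EFinP.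
  by under eq_integral do rewrite /= ger0_norm ?cmod_ge0//.
case: mF => F1 F2; split; apply: (le_integrable mD _ _ ic).
- exact/measurable_EFinP.
- by move=> x _; rewrite /= lee_fin (ger0_norm (cmod_ge0 _)) normRe_le_cmod.
- exact/measurable_EFinP.
- by move=> x _; rewrite /= lee_fin (ger0_norm (cmod_ge0 _)) normIm_le_cmod.
Qed.

Lemma integrable_cmod D F : measurable D -> cintegrable D F ->
  mu.-integrable D (fun x => (cmod (F x))%:E).
Proof.
move=> mD iF; have mF := cintegrable_cmeasurable mD iF.
case: iF => F1 F2.
have := integrableD mD (integrable_abse F1) (integrable_abse F2).
apply: le_integrable => //; first exact/measurable_EFinP/measurable_cmod.
move=> x _; rewrite /= lee_fin (ger0_norm (cmod_ge0 _)).
by rewrite ger0_norm ?addr_ge0// cmod_le_ReIm.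
Qed.

Lemma cintegrableD D F G : measurable D -> cintegrable D F -> cintegrable D G ->
  cintegrable D (fun x => F x + G x).
Proof.
move=> mD [F1 F2] [G1 G2]; split.
  by under eq_fun do rewrite Re_addc EFinD; exact: integrableD.
by under eq_fun do rewrite Im_addc EFinD; exact: integrableD.
Qed.

Lemma cintegrableZ D c F : measurable D -> cintegrable D F ->
  cintegrable D (fun x => c * F x).
Proof.
move=> mD [F1 F2]; split.
  under eq_fun do rewrite Re_mulc EFinB !EFinM.
  by apply: integrableB => //; exact: integrableZl.
under eq_fun do rewrite Im_mulc EFinD !EFinM.
by apply: integrableD => //; exact: integrableZl.
Qed.

Lemma cintegrable_sum D (F : nat -> T -> R[i]) n : measurable D ->
  (forall i, cintegrable D (F i)) ->
  cintegrable D (fun x => \sum_(i < n) F i x).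
Proof.
move=> mD mF; elim: n => [|n IH].
  under [X in cintegrable _ X]eq_fun do rewrite big_ord0.
  by split; exact: integrable0.
under [X in cintegrable _ X]eq_fun do rewrite big_ord_recr/=.
exact: cintegrableD.
Qed.

Lemma eq_cint D F G : {in D, F =1 G} -> cint D F = cint D G.
Proof.
by move=> FG; rewrite /cint; congr (_ +i* _); apply: eq_Rintegral => x xD; rewrite FG.
Qed.

Lemma cintD D F G : measurable D -> cintegrable D F -> cintegrable D G ->
  cint D (fun x => F x + G x) = cint D F + cint D G.
Proof.
move=> mD [F1 F2] [G1 G2]; rewrite /cint.
under eq_Rintegral do rewrite Re_addc.
under [X in _ +i* X]eq_Rintegral do rewrite Im_addc.
by rewrite !RintegralD//; simpc.
Qed.

Lemma cintZ D c F : measurable D -> cintegrable D F ->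
  cint D (fun x => c * F x) = c * cint D F.
Proof.
move=> mD [F1 F2]; rewrite /cint.
under eq_Rintegral do rewrite Re_mulc.
under [X in _ +i* X]eq_Rintegral do rewrite Im_mulc.
have Z r f : mu.-integrable D (EFin \o f) ->
    mu.-integrable D (EFin \o (fun x => r * f x)).
  by move=> ?; rewrite /comp; under eq_fun do rewrite EFinM; exact: integrableZl.
rewrite RintegralB ?RintegralD//; try exact: Z.
by rewrite !RintegralZl//; case: c => a b; simpc.
Qed.

Lemma cint0 D : cint D (fun=> 0) = 0.
Proof. by rewrite /cint /Rintegral !integral0. Qed.

Lemma cintN D F : measurable D -> cintegrable D F ->
  cint D (fun x => - F x) = - cint D F.
Proof.
move=> mD iF; rewrite -mulN1r -cintZ//; apply: eq_cint => x _.
by rewrite mulN1r.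
Qed.

Lemma cintegrableN D F : measurable D -> cintegrable D F ->
  cintegrable D (fun x => - F x).
Proof.
move=> mD iF; have := cintegrableZ (-1) mD iF.
by under eq_fun do rewrite mulN1r.
Qed.

Lemma cintB D F G : measurable D -> cintegrable D F -> cintegrable D G ->
  cint D (fun x => F x - G x) = cint D F - cint D G.
Proof.
by move=> mD iF iG; rewrite cintD// ?cintN//; exact: cintegrableN.
Qed.

Lemma cint_sum D (F : nat -> T -> R[i]) n : measurable D ->
  (forall i, cintegrable D (F i)) ->
  cint D (fun x => \sum_(i < n) F i x) = \sum_(i < n) cint D (F i).
Proof.
move=> mD mF; elim: n => [|n IH].
  rewrite big_ord0; transitivity (cint D (fun=> 0)); last exact: cint0.
  by apply: eq_cint => x _; rewrite big_ord0.
rewrite big_ord_recr/= -IH -cintD//; last exact: cintegrable_sum.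
by apply: eq_cint => x _; rewrite big_ord_recr.
Qed.

(** A unimodular factor u turns the integral I into the positive number |I|, which is then the
    integral of Re (u F), and Re (u F) <= |F|. *)
Lemma le_cmod_cint D F : measurable D -> cintegrable D F ->
  cmod (cint D F) <= \int[mu]_(x in D) cmod (F x).
Proof.
move=> mD iF; set I := cint D F.
have ic := integrable_cmod mD iF.
have [I0|I0] := eqVneq I 0.
  by rewrite I0 cmod0; apply: Rintegral_ge0 => x _; exact: cmod_ge0.
have mp : 0 < cmod I by rewrite cmod_gt0.
pose u := I^* / (cmod I)%:C.
have E : cint D (fun x => u * F x) = (cmod I)%:C.
  rewrite cintZ// -/I /u mulrAC [I^* * I]mulrC mulc_conj expr2 rmorphM/=.
  by rewrite mulfK//; apply/eqP => -[/eqP]; rewrite gt_eqF.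
have u1 : cmod u = 1.
  by rewrite cmodM cmodV cmod_conj cmod_real ger0_norm ?cmod_ge0// divff// gt_eqF.
have -> : cmod I = \int[mu]_(x in D) complex.Re (u * F x).
  by move: E; rewrite /cint => -[].
apply: le_Rintegral => //; first by case: (cintegrableZ u mD iF).
move=> x _; apply: (le_trans (ler_norm _)).
by rewrite (le_trans (normRe_le_cmod _))// cmodM u1 mul1r.
Qed.

End complex_integral.

Section complex_series.
Context {R : realType}.
Implicit Types (a b : nat -> R[i]).

Definition csummable a : Prop := (\sum_(0 <= n <oo) (cmod (a n))%:E < +oo)%E.

(** Integration against the counting measure, so that linearity and the triangle inequality are
    those of [cint]. For summable families it is the limit of the partial sums, by [csum_approx]. *)
Definition csum a : R[i] := cint (@counting nat R) setT a.

Lemma csummable_cintegrable a :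
  csummable a -> cintegrable (@counting nat R) setT a.
Proof.
move=> sa; apply: cintegrableP => //.
by rewrite ge0_integral_count// => k; rewrite lee_fin cmod_ge0.
Qed.

Lemma csummable_bound a (b : nat -> R) :
  (forall n, cmod (a n) <= b n) -> (\sum_(0 <= n <oo) (b n)%:E < +oo)%E ->
  csummable a.
Proof.
move=> ab; apply: le_lt_trans; apply: lee_nneseries => [n _ _|n _];
  by rewrite lee_fin// cmod_ge0.
Qed.

Lemma eq_csum a b : a =1 b -> csum a = csum b.
Proof. by move=> ab; congr csum; apply/funext. Qed.

Lemma le_csum a : csummable a ->
  ((cmod (csum a))%:E <= \sum_(0 <= n <oo) (cmod (a n))%:E)%E.
Proof.
move=> sa; have ia := csummable_cintegrable sa.
have c0 k : (0 <= (cmod (a k))%:E)%E by rewrite lee_fin cmod_ge0.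
rewrite -(ge0_integral_count c0) -[leRHS]fineK.
  by rewrite lee_fin; exact: le_cmod_cint.
by apply: integrable_fin_num => //; exact: integrable_cmod.
Qed.

Lemma csummableD a b : csummable a -> csummable b ->
  csummable (fun n => a n + b n).
Proof.
move=> sa sb; apply: (@csummable_bound _ (fun n => cmod (a n) + cmod (b n))).
  by move=> n; exact: cmodD_le.
under eq_eseriesr do rewrite EFinD.
rewrite nneseriesD; first exact: lte_add_pinfty.
  by move=> n _ _; rewrite lee_fin cmod_ge0.
by move=> n _ _; rewrite lee_fin cmod_ge0.
Qed.

Lemma csummableZ c a : csummable a -> csummable (fun n => c * a n).
Proof.
move=> sa; apply: (@csummable_bound _ (fun n => cmod c * cmod (a n))).
  by move=> n; rewrite cmodM.
under eq_eseriesr do rewrite EFinM.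
rewrite nneseriesZl; last by move=> n _; rewrite lee_fin cmod_ge0.
by rewrite lte_mul_pinfty// lee_fin cmod_ge0.
Qed.

Lemma csummableN a : csummable a -> csummable (fun n => - a n).
Proof.
by rewrite /csummable; under [X in (_ -> X < _)%E]eq_eseriesr do rewrite cmodN.
Qed.

Lemma csummableB a b : csummable a -> csummable b ->
  csummable (fun n => a n - b n).
Proof. by move=> sa sb; apply: csummableD => //; exact: csummableN. Qed.

Lemma csumD a b : csummable a -> csummable b ->
  csum (fun n => a n + b n) = csum a + csum b.
Proof. by move=> sa sb; apply: cintD => //; exact: csummable_cintegrable. Qed.

Lemma csumB a b : csummable a -> csummable b ->
  csum (fun n => a n - b n) = csum a - csum b.
Proof. by move=> sa sb; apply: cintB => //; exact: csummable_cintegrable. Qed.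

Lemma csumZ c a : csummable a -> csum (fun n => c * a n) = c * csum a.
Proof. by move=> sa; apply: cintZ => //; exact: csummable_cintegrable. Qed.

Lemma csum0 : csum (fun=> 0) = 0.
Proof. exact: cint0. Qed.

Lemma nneseries_delta (k : nat) (x : R) : 0 <= x ->
  (\sum_(0 <= n <oo) (if n == k then x else 0)%:E = x%:E)%E.
Proof.
move=> x0; rewrite (@nneseriesD1 _ _ k)//; last first.
  by move=> n _; case: ifP.
rewrite eqxx eseries0 ?adde0// => n _ /=.
by case: ifP.
Qed.

Lemma nneseries_ge_eterm (f : nat -> \bar R) k :
  (forall n, 0 <= f n)%E -> (f k <= \sum_(0 <= n <oo) f n)%E.
Proof.
move=> f0; apply: (@le_trans _ _ (\sum_(0 <= n < k.+1) f n)%E).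
  by rewrite big_nat_recr//= leeDr// sume_ge0.
by apply: nneseries_lim_ge => n _ _.
Qed.

Lemma nneseries_ge_term (f : nat -> R) k : (forall n, 0 <= f n) ->
  ((f k)%:E <= \sum_(0 <= n <oo) (f n)%:E)%E.
Proof.
by move=> f0; apply: (nneseries_ge_eterm (f := fun n => (f n)%:E)) => n; rewrite lee_fin.
Qed.

Lemma csummable_delta k (x : R[i]) : csummable (fun n => if n == k then x else 0).
Proof.
apply: (@csummable_bound _ (fun n => if n == k then cmod x else 0)).
  by move=> n; case: ifP => // _; rewrite cmod0.
by rewrite nneseries_delta ?ltry// cmod_ge0.
Qed.

Lemma csum_delta k (x : R[i]) : csum (fun n => if n == k then x else 0) = x.
Proof.
transitivity (csum (fun n => x * (if n == k then 1 else 0))).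
  by apply: eq_csum => n; case: ifP; rewrite ?mulr1 ?mulr0.
rewrite csumZ; last exact: csummable_delta.
rewrite -[RHS]mulr1; congr (_ * _).
rewrite /csum /cint; congr (_ +i* _).
  rewrite /Rintegral (_ : (fun _ => _) =
      fun n => (if n == k then 1 else 0)%:E); last by apply/funext => n; case: ifP.
  by rewrite ge0_integral_count ?nneseries_delta// => n; case: ifP.
rewrite /Rintegral (_ : (fun _ => _) = fun n => 0%E); first by rewrite integral0.
by apply/funext => n; case: ifP.
Qed.

Lemma csummable_head a N : csummable (fun n => if (n < N)%N then a n else 0).
Proof.
elim: N => [|N IH].
  apply: (@csummable_bound _ (fun=> 0)) => [n|]; first by rewrite cmod0.
  by rewrite eseries0.
have := csummableD IH (csummable_delta N (a N)).
congr csummable; apply/funext => n; rewrite ltnS.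
by case: ltngtP => [nN|nN|->]; rewrite ?addr0 ?add0r.
Qed.

Lemma csum_head a N :
  csum (fun n => if (n < N)%N then a n else 0) = \sum_(i < N) a i.
Proof.
elim: N => [|N IH]; first by rewrite big_ord0 -[RHS]csum0.
rewrite big_ord_recr/= -IH -[X in _ + X](csum_delta N) -csumD.
- apply: eq_csum => n; rewrite ltnS.
  by case: ltngtP => [nN|nN|->]; rewrite ?addr0 ?add0r.
- exact: csummable_head.
- exact: csummable_delta.
Qed.

Lemma csum_partial a N : csummable a ->
  ((cmod (csum a - \sum_(i < N) a i))%:E <=
   \sum_(N <= n <oo) (cmod (a n))%:E)%E.
Proof.
move=> sa; rewrite -csum_head -csumB//; last exact: csummable_head.
have E : (\sum_(0 <= n <oo)
    (cmod (a n - (if (n < N)%N then a n else 0)))%:E =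
    \sum_(N <= n <oo) (cmod (a n))%:E)%E.
  rewrite [RHS]eseries_cond [RHS]eseries_mkcond; apply: eq_eseriesr => n _.
  by rewrite ltnNge andTb; case: leqP => nN /=; rewrite ?subr0// subrr cmod0.
rewrite -E; apply: le_csum.
by apply: csummableB => //; exact: csummable_head.
Qed.

Lemma nneseries_tail_small (f : nat -> \bar R) (e : R) :
  (forall n, 0 <= f n)%E -> (\sum_(0 <= n <oo) f n < +oo)%E -> 0 < e ->
  exists N, forall m, (N <= m)%N -> (\sum_(m <= n <oo) f n <= e%:E)%E.
Proof.
move=> f0 sf e0.
have := nneseries_tail_cvg sf (fun k _ => f0 k).
move=> /fine_cvgP[[N1 _ H1] /cvgrPdist_le/(_ _ e0)[N2 _ H2]].
exists (maxn N1 N2) => m; rewrite geq_max => /andP[/H1 /= H1m /H2 /=].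
rewrite sub0r normrN => Hm; rewrite -(fineK H1m) lee_fin.
exact: le_trans (ler_norm _) Hm.
Qed.

Lemma csum_approx a (e : R) : csummable a -> 0 < e ->
  exists N, forall m, (N <= m)%N -> cmod (csum a - \sum_(i < m) a i) <= e.
Proof.
move=> sa e0.
have [|N HN] := @nneseries_tail_small (fun n => (cmod (a n))%:E) e _ sa e0.
  by move=> n; rewrite lee_fin cmod_ge0.
exists N => m /HN; rewrite -lee_fin; apply: le_trans; exact: csum_partial.
Qed.

Lemma cmod_small_eq0 (z : R[i]) : (forall e, 0 < e -> cmod z <= e) -> z = 0.
Proof.
move=> H; apply/eqP; apply: contraT; rewrite -cmod_gt0 => z0.
have := H (cmod z / 2); rewrite divr_gt0// => /(_ isT); lra.
Qed.

Lemma csum_unique a (s : R[i]) : csummable a ->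
  (forall e, 0 < e -> exists N, forall m, (N <= m)%N ->
     cmod (s - \sum_(i < m) a i) <= e) -> csum a = s.
Proof.
move=> sa H; apply/eqP; rewrite -subr_eq0; apply/eqP/cmod_small_eq0 => e e0.
have e20 : 0 < e / 2 by rewrite divr_gt0.
have [N1 H1] := csum_approx sa e20; have [N2 H2] := H _ e20.
have := H1 _ (leq_maxl N1 N2); have := H2 _ (leq_maxr N1 N2).
set t := \sum_(i < _) _ => h2 h1.
have -> : csum a - s = (csum a - t) - (s - t) by ring.
by rewrite (le_trans (cmodB_le _ _))//; lra.
Qed.

Lemma csummable_sum (F : nat -> nat -> R[i]) m :
  (forall i, csummable (F i)) -> csummable (fun n => \sum_(i < m) F i n).
Proof.
move=> sF; elim: m => [|m IH].
  by have := csummable_head (fun=> 0) 0; under [X in _ -> csummable X]eq_fun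
    do rewrite big_ord0.
under [X in csummable X]eq_fun do rewrite big_ord_recr/=.
exact: csummableD.
Qed.

Lemma csum_sum (F : nat -> nat -> R[i]) m :
  (forall i, csummable (F i)) ->
  csum (fun n => \sum_(i < m) F i n) = \sum_(i < m) csum (F i).
Proof.
by move=> sF; apply: cint_sum => // i; exact: csummable_cintegrable.
Qed.

(** A finite sum over k < m commutes with the sum over n, and what is left out is at most the tail
    from m of the absolute column sums, which tends to 0 by Tonelli. *)
Lemma csum_exchange (a : nat -> nat -> R[i]) :
  (\sum_(0 <= n <oo) \sum_(0 <= k <oo) (cmod (a n k))%:E < +oo)%E ->
  csum (fun n => csum (fun k => a n k)) = csum (fun k => csum (fun n => a n k)).
Proof.
move=> H; have p0 n k : (0 <= (cmod (a n k))%:E)%E by rewrite lee_fin cmod_ge0.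
have H' : (\sum_(0 <= k <oo) \sum_(0 <= n <oo) (cmod (a n k))%:E < +oo)%E.
  by rewrite nneseries_interchange// => i j.
have row n : csummable (a n).
  apply: le_lt_trans H; apply: (nneseries_ge_eterm (f := fun n => _)) => k.
  exact: nneseries_ge0.
have col k : csummable (fun n => a n k).
  apply: le_lt_trans H'; apply: (nneseries_ge_eterm (f := fun k => _)) => n.
  exact: nneseries_ge0.
have srow : csummable (fun n => csum (a n)).
  apply: le_lt_trans H; apply: lee_nneseries => [n _ _|n _].
    by rewrite lee_fin cmod_ge0.
  exact: le_csum.
have scol : csummable (fun k => csum (fun n => a n k)).
  apply: le_lt_trans H'; apply: lee_nneseries => [n _ _|n _].
    by rewrite lee_fin cmod_ge0.
  exact: le_csum.
apply/esym/csum_unique => // e e0.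
have [|N HN] := nneseries_tail_small _ H' e0.
  by move=> n; rewrite nneseries_ge0.
exists N => m /HN Hm; rewrite -lee_fin; apply: le_trans Hm.
have sm := @csummable_sum (fun i n => a n i) m col.
rewrite -(@csum_sum (fun i n => a n i) m col) -(csumB srow sm).
apply: (@le_trans _ _
    (\sum_(0 <= n <oo) \sum_(m <= k <oo) (cmod (a n k))%:E)%E).
  apply: (le_trans (le_csum _)).
    exact: csummableB srow sm.
  apply: lee_nneseries => [n _ _|n _]; first by rewrite lee_fin cmod_ge0.
  exact: csum_partial.
under eq_eseriesr do rewrite eseries_cond.
by rewrite nneseries_interchange// [leRHS]eseries_cond.
Qed.

Lemma nneseries_recl_shift (f : nat -> R) : (forall n, 0 <= f n) ->
  (\sum_(0 <= n <oo) (f n)%:E = (f 0%N)%:E + \sum_(0 <= n <oo) (f n.+1)%:E)%E.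
Proof.
move=> f0; rewrite nneseries_recl//; last by move=> n _; rewrite lee_fin.
congr (_ + _)%E.
rewrite -(nneseries_addn 1); last by move=> n; rewrite lee_fin.
by apply: eq_eseriesr => n _; rewrite addn1.
Qed.

Lemma csummable_behead a : csummable a -> csummable (fun n => a n.+1).
Proof.
rewrite /csummable (nneseries_recl_shift (fun n => cmod_ge0 (a n))).
by apply: le_lt_trans; rewrite leeDr// lee_fin cmod_ge0.
Qed.

Lemma csum_recl a : csummable a -> csum a = a 0%N + csum (fun n => a n.+1).
Proof.
move=> sa; apply: csum_unique => // e e0.
have [N HN] := csum_approx (csummable_behead sa) e0.
exists N.+1 => -[//|m] Nm; rewrite big_ord_recl/= opprD addrACA subrr add0r.
exact: (HN m Nm).
Qed.

Lemma csum_le_bound a (b : nat -> R) (M : R) :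
  (forall n, cmod (a n) <= b n) -> (\sum_(0 <= n <oo) (b n)%:E <= M%:E)%E ->
  csummable a /\ cmod (csum a) <= M.
Proof.
move=> ab bM; have sa : csummable a.
  by apply: (csummable_bound ab); apply: le_lt_trans bM _; exact: ltry.
split => //; rewrite -lee_fin (le_trans (le_csum sa))//.
apply: le_trans bM; apply: lee_nneseries => [n _ _|n _]; rewrite lee_fin//.
exact: cmod_ge0.
Qed.

Lemma nneseries_geometric (r : R) : 0 <= r < 1 ->
  (\sum_(0 <= n <oo) (r ^+ n)%:E = ((1 - r)^-1)%:E)%E.
Proof.
move=> /andP[r0 r1]; apply/cvg_lim => //.
have -> : (fun n => \sum_(0 <= k < n) (r ^+ k)%:E)%E =
    EFin \o series (geometric 1 r).
  apply/funext => n; rewrite /= /series/= -sumEFin; apply: eq_bigr => i _.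
  by rewrite mul1r.
apply: cvg_EFin; first exact: nearW.
rewrite /comp/= -[X in _ --> X]div1r; apply: cvg_geometric_series.
by rewrite ger0_norm.
Qed.

Lemma nneseries_geometricZ (K r : R) : 0 <= r < 1 ->
  (\sum_(0 <= n <oo) (K * r ^+ n)%:E = (K / (1 - r))%:E)%E.
Proof.
move=> r01; have /andP[r0 _] := r01; under eq_eseriesr do rewrite EFinM.
by rewrite nneseriesZl ?nneseries_geometric// => n _; rewrite lee_fin exprn_ge0.
Qed.

Lemma nneseries_halves (K : R) :
  (\sum_(0 <= n <oo) (K * 2^-1 ^+ n)%:E = (K * 2)%:E)%E.
Proof.
by rewrite nneseries_geometricZ; [congr (_%:E); field|apply/andP; split; lra].
Qed.

End complex_series.

(** * Geometric sums in the distance |m - n|, and sums over arbitrary index sets *)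

Definition distn (m n : nat) : nat := ((m - n) + (n - m))%N.

Lemma distnC m n : distn m n = distn n m.
Proof. by rewrite /distn addnC. Qed.

(** Each side of k contributes at most one full geometric series. *)
Lemma sum_distn (R : realType) (r : R) (k : nat) : 0 <= r < 1 ->
  (\sum_(0 <= n <oo) (r ^+ distn n k)%:E <= (2 / (1 - r))%:E)%E.
Proof.
move=> /andP[r0 r1]; rewrite (nneseries_split _ k); last first.
  by move=> n _; rewrite lee_fin exprn_ge0.
have G := nneseries_geometric (introT andP (conj r0 r1)).
have -> : 2 / (1 - r) = (1 - r)^-1 + (1 - r)^-1 by ring.
rewrite EFinD add0n; apply: leeD.
  rewrite -G.
  apply: (@le_trans _ _ (\sum_(0 <= n < k.+1) (r ^+ n)%:E)%E); last first.
    by apply: nneseries_lim_ge => n _ _; rewrite lee_fin exprn_ge0.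
  rewrite big_nat_recl// big_nat_rev /= add0n.
  apply: lee_paddl; first by rewrite lee_fin exprn_ge0.
  rewrite !big_nat; apply: lee_sum => i /andP[_ ik].
  by rewrite /distn (_ : _ + _ = i.+1)%N//; lia.
rewrite -nneseries_addn; last by move=> n; rewrite lee_fin exprn_ge0.
rewrite -G; apply: lee_nneseries => [n _ _|n _]; rewrite lee_fin ?exprn_ge0//.
by rewrite /distn (_ : _ + _ = n)%N//; lia.
Qed.

Lemma half_lt1 (R : realType) : 0 <= (2^-1 : R) < 1.
Proof. by apply/andP; split; lra. Qed.

Lemma sum_half (R : realType) (k : nat) :
  (\sum_(0 <= n <oo) (2^-1 ^+ distn n k : R)%:E <= 4%:E)%E.
Proof.
apply: le_trans (sum_distn _ (half_lt1 R)) _.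
by rewrite lee_fin ler_pdivrMr; lra.
Qed.

Lemma sum_eighth (R : realType) (k : nat) :
  (\sum_(0 <= n <oo) (8^-1 ^+ distn n k : R)%:E <= 4%:E)%E.
Proof.
apply: le_trans (sum_distn _ _) _; first by apply/andP; split; lra.
by rewrite lee_fin ler_pdivrMr; lra.
Qed.

Lemma le_nneseriesZl (R : realType) (f g : nat -> R) (a b : R) : 0 <= a -> (forall n, 0 <= f n) ->
  (forall n, 0 <= g n) -> (forall n, f n <= a * g n) ->
  (\sum_(0 <= n <oo) (g n)%:E <= b%:E)%E ->
  (\sum_(0 <= n <oo) (f n)%:E <= (a * b)%:E)%E.
Proof.
move=> a0 f0 g0 fg gb.
apply: (@le_trans _ _ (\sum_(0 <= n <oo) (a%:E * (g n)%:E))%E).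
  by apply: lee_nneseries => [n _ _|n _]; rewrite -?EFinM lee_fin.
rewrite nneseriesZl; last by move=> n _; rewrite lee_fin.
by rewrite EFinM lee_wpmul2l.
Qed.

Section esum_lemmas.
Context {R : realType} {T : choiceType}.
Implicit Types (L : set T).
Local Open Scope ereal_scope.

Lemma esum_ge_term L (a : T -> \bar R) t :
  (forall t, L t -> 0 <= a t) -> L t -> a t <= \esum_(s in L) a s.
Proof.
move=> a0 Lt; apply: esum_ge; exists [set t]; last by rewrite fsbig_set1.
by split => // s ->.
Qed.

Lemma esum_le_seq L (a : T -> \bar R) (M : \bar R) :
  (forall s : seq T, uniq s -> (forall t, t \in s -> L t) ->
    \sum_(t <- s) a t <= M) ->
  \esum_(t in L) a t <= M.
Proof.
move=> H; apply: ge_ereal_sup => _ [X [finX XL] <-].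
rewrite fsbig_finite//; apply: H => // t.
by rewrite in_fset_set// inE => /XL.
Qed.

Lemma esum_ge_seq L (a : T -> \bar R) (s : seq T) :
  uniq s -> (forall t, t \in s -> L t) ->
  \sum_(t <- s) a t <= \esum_(t in L) a t.
Proof.
move=> us sL; apply: esum_ge; exists [set` s]; last by rewrite fsbig_seq.
by split => //=; exact: finite_seq.
Qed.

Lemma esumZl_le L (a : T -> \bar R) (c : R) :
  (0 <= c)%R -> (forall t, L t -> 0 <= a t) ->
  \esum_(t in L) (c%:E * a t) <= c%:E * \esum_(t in L) a t.
Proof.
move=> c0 a0; apply: esum_le_seq => s us sL.
rewrite big_seq -ge0_sume_distrr; last by move=> t /sL /a0.
by rewrite -big_seq lee_wpmul2l// ?lee_fin// esum_ge_seq.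
Qed.

(** A finite family from L commutes with the series; the supremum over families is taken last. *)
Lemma nneseries_esum_le L (a : T -> nat -> \bar R) :
  (forall t n, 0 <= a t n) ->
  \esum_(t in L) \sum_(0 <= n <oo) a t n <=
  \sum_(0 <= n <oo) \esum_(t in L) a t n.
Proof.
move=> a0; apply: esum_le_seq => s us sL.
rewrite -nneseries_sum; last by move=> *; exact: a0.
apply: lee_nneseries => [n _ _|n _]; first by apply: sume_ge0.
exact: esum_ge_seq.
Qed.

Lemma nneseries_esum_ge L (a : T -> nat -> \bar R) :
  (forall t n, 0 <= a t n) ->
  \sum_(0 <= n <oo) \esum_(t in L) a t n <=
  \esum_(t in L) \sum_(0 <= n <oo) a t n.
Proof.
move=> a0; apply: lime_le.
  by apply: is_cvg_nneseries => *; exact: esum_ge0.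
apply: nearW => N.
rewrite big_mkord -esum_sum//.
apply: le_esum => t Lt; rewrite -(big_mkord xpredT (a t)).
exact: nneseries_lim_ge.
Qed.

(** Cauchy-Schwarz from w x <= (l / 2) w + w x^2 / (2 l) with l = y / P: the first sum is then at
    most y / 2 and is absorbed. The case of an infinite right-hand side is split off, and no square
    root of an extended real appears. *)
Lemma weighted_cauchy_schwarz (w x : nat -> R) (P y : R) :
  (forall n, 0 <= w n)%R -> (forall n, 0 <= x n)%R -> (0 < P)%R -> (0 <= y)%R ->
  \sum_(0 <= n <oo) (w n)%:E <= P%:E ->
  y%:E <= \sum_(0 <= n <oo) (w n * x n)%:E ->
  (y ^+ 2)%:E <= P%:E * \sum_(0 <= n <oo) (w n * x n ^+ 2)%:E.
Proof.
move=> w0 x0 P0; rewrite le_eqVlt => /orP[/eqP <- _ _|y0 wP yx].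
  rewrite expr0n/= mule_ge0 ?lee_fin ?(ltW P0)//.
  by apply: nneseries_ge0 => n _ _; rewrite lee_fin mulr_ge0// exprn_ge0.
set Q := \sum_(0 <= n <oo) (w n * x n ^+ 2)%:E.
have Q0 : 0 <= Q.
  by apply: nneseries_ge0 => n _ _; rewrite lee_fin mulr_ge0// exprn_ge0.
pose l := (y / P)%R; have l0 : (0 < l)%R by rewrite divr_gt0.
have B : y%:E <= (l / 2)%:E * P%:E + ((2 * l)^-1)%:E * Q.
  apply: (le_trans yx).
  apply: (@le_trans _ _ (\sum_(0 <= n <oo) ((l / 2)%:E * (w n)%:E +
     ((2 * l)^-1)%:E * (w n * x n ^+ 2)%:E))).
    apply: lee_nneseries => [n _ _|n _]; first by rewrite lee_fin mulr_ge0.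
    rewrite -!EFinM -EFinD lee_fin -subr_ge0.
    have -> : (l / 2 * w n + (2 * l)^-1 * (w n * x n ^+ 2) - w n * x n =
        w n * ((2 * l)^-1 * (x n - l) ^+ 2))%R by field; rewrite gt_eqF.
    by rewrite mulr_ge0// mulr_ge0 ?sqr_ge0// invr_ge0 mulr_ge0// ltW.
  rewrite nneseriesD; last 2 first.
  - by move=> n _ _; rewrite -EFinM lee_fin mulr_ge0// divr_ge0// ltW.
  - move=> n _ _; rewrite -EFinM lee_fin mulr_ge0//.
      by rewrite invr_ge0 mulr_ge0// ltW.
    by rewrite mulr_ge0// exprn_ge0.
  rewrite !nneseriesZl; last 2 first.
  - by move=> n _; rewrite lee_fin mulr_ge0// exprn_ge0.
  - by move=> n _; rewrite lee_fin.
  by rewrite leeD2r// lee_wpmul2l// lee_fin divr_ge0// ltW.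
have [Qoo|] := eqVneq Q +oo.
  by rewrite Qoo gt0_muley ?lte_fin// leey.
rewrite -ltey => Qfin.
have : Q \is a fin_num by rewrite ge0_fin_numE.
move=> /fineK Qe; rewrite -Qe -!EFinM -EFinD lee_fin in B.
rewrite -Qe -EFinM lee_fin; move: B; set q := fine Q.
have -> : (l / 2 * P + (2 * l)^-1 * q = y / 2 + P * q / (2 * y))%R.
  by rewrite /l; field; rewrite !gt_eqF.
rewrite -lerBlDl; have -> : (y - y / 2 = y / 2)%R by field.
rewrite ler_pdivlMr ?mulr_gt0//.
by have -> : (y / 2 * (2 * y) = y ^+ 2)%R by field.
Qed.

End esum_lemmas.

(** * Localized matrices on bounded and on square summable sequences *)

(** For |x - y| <= d the ratio of the two powers lies between b^-d and b^d with b = 1 + s, and b^d -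
    1 <= s 4^d by induction on d. The factor s makes the commutator below small. *)
Lemma weight_ratio (R : realType) (s : R) (x y d : nat) : 0 < s <= 1 ->
  (x <= y + d)%N -> (y <= x + d)%N ->
  `|(1 + s)^-1 ^+ x - (1 + s)^-1 ^+ y| <= (1 + s)^-1 ^+ y * (s * 4 ^+ d).
Proof.
move=> /andP[s0 s1] xy yx.
set r := (1 + s)^-1; set b := (1 + s).
have b0 : 0 < b by rewrite /b; lra.
have rb : r * b = 1 by rewrite /r mulVf// gt_eqF.
have r0 : 0 < r by rewrite invr_gt0.
have r1 : r <= 1 by rewrite invf_le1// /b; lra.
have rbn n : r ^+ n * b ^+ n = 1 by rewrite -exprMn rb expr1n.
have b1 n : 1 <= b ^+ n by rewrite exprn_ege1// /b; lra.
have key (n : nat) : b ^+ n - 1 <= s * 4 ^+ n.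
  elim: n => [|n IH]; first by rewrite !expr0 subrr mulr1 ltW.
  rewrite !exprS; have : s * 4 ^+ n * s <= s * 4 ^+ n * 1.
    by rewrite ler_wpM2l// mulr_ge0 ?exprn_ge0// ltW.
  have : s * 1 <= s * 4 ^+ n by rewrite ler_pM2l// exprn_ege1// ler1n.
  have : s * (b ^+ n - 1) <= s * (s * 4 ^+ n) by rewrite ler_wpM2l// ltW.
  by rewrite {2 3}/b; set B := b ^+ n in IH *; set F := 4 ^+ n in IH *; nra.
have step m n : (m <= n + d)%N -> r ^+ n <= r ^+ m * b ^+ d.
  move=> mn; rewrite -[leLHS]mulr1 -(rbn d) mulrA ler_wpM2r ?exprn_ge0 ?(ltW b0)//.
  by rewrite -exprD ler_wiXn2l// ltW.
have h1 := step _ _ xy; have h2 := step _ _ yx.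
have kd := key d; have bd := b1 d.
have rx : 0 < r ^+ x by rewrite exprn_gt0.
have ry : 0 < r ^+ y by rewrite exprn_gt0.
rewrite ler_norml; apply/andP; split.
  (* The inequality 1 / B >= 2 - B turns the upper bound for b^d - 1 into a lower bound for b^-d -
     1. *)
  have : r ^+ y * (2 - b ^+ d) <= r ^+ x.
    have h3 : r ^+ y * (b ^+ d)^-1 <= r ^+ x.
      by rewrite ler_pdivrMr// exprn_gt0.
    apply: le_trans h3; rewrite ler_wpM2l ?(ltW ry)//.
    have B0 : 0 < b ^+ d by rewrite exprn_gt0.
    rewrite -div1r ler_pdivlMr//; nra.
  nra.
nra.
Qed.

Section localized_matrix.
Context {R : realType} {T : choiceType}.
(** Row t of A is concentrated near column [kap t]. The rate 1/8 is chosen against the factor 4^d of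
    [weight_ratio]. *)
Variables (L : set T) (kap : T -> nat) (A : T -> nat -> R[i]) (C c0 : R).
Hypothesis C_gt0 : 0 < C.
Hypothesis c0_gt0 : 0 < c0.
Hypothesis A_decay : forall t n, cmod (A t n) <= C * 8^-1 ^+ distn n (kap t).
Hypothesis A_diag : forall t, L t -> c0 <= cmod (A t (kap t)).
Implicit Types (c : nat -> R[i]) (v : T -> R[i]).

Definition row_apply c t : R[i] := csum (fun n => A t n * c n).

Definition bounded_seq c : Prop := exists B : R, forall n, cmod (c n) <= B.

Definition l2sq c : \bar R := (\sum_(0 <= n <oo) (cmod (c n) ^+ 2)%:E)%E.

Definition l2sq_on v : \bar R := (\esum_(t in L) (cmod (v t) ^+ 2)%:E)%E.

(** On bounded sequences the upper estimate is [row_bound], a consequence of the decay. On square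
    summable ones it depends on how many points L has per level, and is therefore a clause of
    [cis_l2]. *)
Definition cis_sup : Prop :=
  (exists2 K : R, 0 < K & forall c M, bounded_seq c -> 0 <= M ->
     (forall t, L t -> cmod (row_apply c t) <= M) ->
     forall n, cmod (c n) <= K * M) /\
  (forall v M, (forall t, L t -> cmod (v t) <= M) ->
     exists2 c, bounded_seq c & forall t, L t -> row_apply c t = v t).

Definition cis_l2 : Prop :=
  (exists2 K : R, 0 < K & forall c, (l2sq c < +oo)%E ->
     (l2sq c <= K%:E * l2sq_on (row_apply c))%E /\
     (l2sq_on (row_apply c) <= K%:E * l2sq c)%E) /\
  (forall v, (l2sq_on v < +oo)%E ->
     exists2 c, (l2sq c < +oo)%E & forall t, L t -> row_apply c t = v t).

Lemma l2_bounded c : (l2sq c < +oo)%E -> bounded_seq c.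
Proof.
(* From x^2 <= y follows x <= 1 + y, which replaces a square root. *)
move=> sc; exists (1 + fine (l2sq c)) => n.
have h : ((cmod (c n) ^+ 2)%:E <= l2sq c)%E.
  by apply: (nneseries_ge_term (f := fun n => cmod (c n) ^+ 2)) => k; exact: sqr_ge0.
have l0 : (0 <= l2sq c)%E by apply: le_trans h; rewrite lee_fin sqr_ge0.
move: h; rewrite -[X in (_ <= X)%E]fineK ?ge0_fin_numE// lee_fin.
have := cmod_ge0 (c n); set x := cmod _; set y := fine _; nra.
Qed.

Lemma row_bound c (B : R) t : (forall n, cmod (c n) <= B) ->
  csummable (fun n => A t n * c n) /\ cmod (row_apply c t) <= C * B * 4.
Proof.
move=> cB; have B0 : 0 <= B := le_trans (cmod_ge0 (c 0%N)) (cB 0%N).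
apply: (@csum_le_bound _ _ (fun n => C * B * 8^-1 ^+ distn n (kap t))).
  move=> n; rewrite cmodM mulrAC ler_pM ?cmod_ge0//.
apply: (@le_nneseriesZl _ _ (fun n => 8^-1 ^+ distn n (kap t))) => //.
- by rewrite mulr_ge0// ltW.
- by move=> n; rewrite !mulr_ge0 ?exprn_ge0// ltW.
- exact: sum_eighth.
Qed.

Definition wgt (s : R) (k n : nat) : R := (1 + s)^-1 ^+ distn n k.

Lemma wgt_ge0 s k n : 0 < s -> 0 <= wgt s k n.
Proof. by move=> s0; rewrite exprn_ge0// invr_ge0; lra. Qed.

Lemma wgt_le1 s k n : 0 < s -> wgt s k n <= 1.
Proof. by move=> s0; rewrite exprn_ile1 ?invr_ge0 ?invf_le1//; lra. Qed.

Lemma wgtkk s k : wgt s k k = 1.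
Proof. by rewrite /wgt /distn !subnn. Qed.

Lemma wgt_bounded s k c : 0 < s -> bounded_seq c ->
  bounded_seq (fun n => (wgt s k n)%:C * c n).
Proof.
move=> s0 [B cB]; exists B => n; rewrite cmodM cmod_real ger0_norm ?wgt_ge0//.
by rewrite (le_trans _ (cB n))// ler_piMl ?cmod_ge0// wgt_le1.
Qed.

(* Multiplication by the slowly varying weight almost commutes with the
   matrix; this is the Combes-Thomas argument. *)
Lemma wgt_commutator s k c t : 0 < s <= 1 -> bounded_seq c ->
  ((cmod ((wgt s k (kap t))%:C * row_apply c t -
     row_apply (fun n => (wgt s k n)%:C * c n)%R t))%:E <=
  \sum_(0 <= n <oo) (s * C * 2^-1 ^+ distn n (kap t) *
     cmod ((wgt s k n)%:C * c n))%:E)%E.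
Proof.
move=> s01 bc; have /andP[s0 s1] := s01.
have [B cB] := bc; have [B' cB'] := wgt_bounded k s0 bc.
have [sc _] := row_bound t cB; have [sc' _] := row_bound t cB'.
rewrite /row_apply -csumZ// -csumB//; last exact: csummableZ.
apply: (le_trans (le_csum _)); first by apply: csummableB => //; exact: csummableZ.
apply: lee_nneseries => [n _ _|n _]; first by rewrite lee_fin cmod_ge0.
rewrite lee_fin.
have -> : (wgt s k (kap t))%:C * (A t n * c n) - A t n * ((wgt s k n)%:C * c n) =
    A t n * ((wgt s k (kap t) - wgt s k n)%:C * c n).
  by rewrite rmorphB/=; ring.
rewrite !cmodM !cmod_real (ger0_norm (wgt_ge0 k n s0)).
have W : `|wgt s k (kap t) - wgt s k n| <=
    wgt s k n * (s * 4 ^+ distn n (kap t)).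
  apply: weight_ratio => //; rewrite /distn; lia.
rewrite !mulrA ler_wpM2r ?cmod_ge0//.
apply: (@le_trans _ _ (C * 8^-1 ^+ distn n (kap t) *
    (wgt s k n * (s * 4 ^+ distn n (kap t))))).
  by rewrite ler_pM// cmod_ge0.
(* The decay 8^-d of the row times the growth 4^d of the weight leaves 2^-d. *)
have -> : 2^-1 = 8^-1 * 4 :> R by lra.
rewrite exprMn le_eqVlt; apply/orP; left; apply/eqP; ring.
Qed.

Lemma wgt_commutator_sup s k c t (B : R) : 0 < s <= 1 -> bounded_seq c ->
  (forall n, cmod ((wgt s k n)%:C * c n) <= B) ->
  cmod ((wgt s k (kap t))%:C * row_apply c t -
     row_apply (fun n => (wgt s k n)%:C * c n) t) <= s * C * 4 * B.
Proof.
move=> s01 bc wB; have /andP[s0 s1] := s01.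
have B0 : 0 <= B := le_trans (cmod_ge0 _) (wB 0%N).
rewrite -lee_fin (le_trans (wgt_commutator k t s01 bc))//.
apply: (@le_trans _ _
    (\sum_(0 <= n <oo) ((s * C * B)%:E * (2^-1 ^+ distn n (kap t))%:E))%E).
  apply: lee_nneseries => [n _ _|n _].
    by rewrite lee_fin mulr_ge0 ?cmod_ge0// !mulr_ge0 ?exprn_ge0// ltW.
  rewrite -EFinM lee_fin [leRHS]mulrAC ler_wpM2l//.
  by rewrite !mulr_ge0 ?exprn_ge0// ltW.
rewrite nneseriesZl; last by move=> n _; rewrite lee_fin exprn_ge0.
have -> : s * C * 4 * B = (s * C * B) * 4 by ring.
rewrite [leRHS]EFinM lee_wpmul2l//.
  by rewrite lee_fin !mulr_ge0// ltW.
exact: sum_half.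
Qed.

(** The lower bound is applied to the damped sequence d. The commutator adds at most half of S = sup
    |d|, which is finite because c is bounded, so it is absorbed at the price of the factor 2. The
    weight is 1 at k, so d k = c k. *)
Lemma localized_sup (K s : R) k c (M : R) : 0 < K -> 0 < s <= 1 ->
  K * (s * C * 4) <= 2^-1 ->
  (forall c M, bounded_seq c -> 0 <= M ->
     (forall t, L t -> cmod (row_apply c t) <= M) ->
     forall n, cmod (c n) <= K * M) ->
  bounded_seq c -> 0 <= M ->
  (forall t, L t -> wgt s k (kap t) * cmod (row_apply c t) <= M) ->
  cmod (c k) <= 2 * K * M.
Proof.
move=> K0 s01 Ks H bc M0 cM; have /andP[s0 s1] := s01.
set d := fun n => (wgt s k n)%:C * c n.
have [B dB] : bounded_seq d by exact: wgt_bounded.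
pose S := sup (range (fun n => cmod (d n))).
have dS n : cmod (d n) <= S.
  by apply: ub_le_sup; [exists B => _ [m _ <-]|exists n].
have S0 : 0 <= S := le_trans (cmod_ge0 _) (dS 0%N).
have rd t : L t -> cmod (row_apply d t) <= M + s * C * 4 * S.
  move=> Lt; have h := wgt_commutator_sup t s01 bc dS.
  have := cM t Lt; rewrite -[wgt s k _]ger0_norm ?wgt_ge0// -cmod_real -cmodM.
  move=> h2; rewrite -[row_apply d t](subKr ((wgt s k (kap t))%:C * row_apply c t)).
  by rewrite (le_trans (cmodB_le _ _))// lerD.
have SC0 : 0 <= s * C * 4 * S by rewrite !mulr_ge0// ltW.
have SK : S <= K * (M + s * C * 4 * S).
  apply: ge_sup; first by exists (cmod (d 0%N)), 0%N.
  move=> _ [n _ <-]; apply: H => //; last exact: addr_ge0.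
  by exists B.
have : K * (s * C * 4) * S <= 2^-1 * S by rewrite ler_wpM2r.
have := dS k; rewrite /d wgtkk mul1r; nra.
Qed.

(** By the localized bound, |c k|^2 is at most (2 K)^2 times the sum over t of r^(2 |k - kap t|)
    |row t|^2. Summing over k first leaves a geometric series for each t. *)
Lemma l2_lower_of_sup (K s : R) c : 0 < K -> 0 < s <= 1 ->
  K * (s * C * 4) <= 2^-1 ->
  (forall c M, bounded_seq c -> 0 <= M ->
     (forall t, L t -> cmod (row_apply c t) <= M) ->
     forall n, cmod (c n) <= K * M) ->
  bounded_seq c ->
  (l2sq c <= ((2 * K) ^+ 2 * (2 / (1 - (1 + s)^-1 ^+ 2)))%:E *
    l2sq_on (row_apply c))%E.
Proof.
move=> K0 s01 Ks H bc; have /andP[s0 s1] := s01.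
set r := (1 + s)^-1; have r01 : 0 <= r ^+ 2 < 1.
  rewrite exprn_ge0/= ?exprn_ilt1// ?invr_ge0 ?invf_lt1//; lra.
have K'0 : 0 < 2 / (1 - r ^+ 2) by rewrite divr_gt0//; lra.
have K2 : 0 < (2 * K) ^+ 2 by rewrite exprn_gt0//; lra.
have g0 t : (0 <= (cmod (row_apply c t) ^+ 2)%:E)%E by rewrite lee_fin sqr_ge0.
have [->|] := eqVneq (l2sq_on (row_apply c)) +oo%E.
  by rewrite gt0_muley ?leey// lte_fin mulr_gt0.
rewrite -ltey => fin.
pose F t k := ((r ^+ 2) ^+ distn k (kap t) * cmod (row_apply c t) ^+ 2)%:E.
have F0 t k : (0 <= F t k)%E.
  by rewrite lee_fin mulr_ge0 ?sqr_ge0// exprn_ge0//; case/andP: r01.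
have FE t k : F t k = ((wgt s k (kap t) * cmod (row_apply c t)) ^+ 2)%:E.
  by rewrite /F -exprM mulnC exprM -exprMn distnC.
have Fk k : ((cmod (c k) ^+ 2)%:E <=
    ((2 * K) ^+ 2)%:E * \esum_(t in L) F t k)%E.
  set E := (\esum_(t in L) F t k)%E.
  have E0 : (0 <= E)%E by apply: esum_ge0.
  have Ef : (E < +oo)%E.
    apply: le_lt_trans fin; apply: le_esum => t _; rewrite lee_fin.
    rewrite ler_piMl ?sqr_ge0// exprn_ile1//; case/andP: r01 => //.
    by move=> _ /ltW.
  rewrite -(fineK (_ : E \is a fin_num)) ?ge0_fin_numE// -EFinM lee_fin.
  have e0 : 0 <= fine E by rewrite fine_ge0.
  rewrite -[fine E]sqr_sqrtr// -exprMn ler_pXn2r ?nnegrE ?cmod_ge0//; last first.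
    by rewrite !mulr_ge0 ?sqrtr_ge0//; lra.
  (* Here M is the square root of E: each damped row value, squared, is one term of the sum E. *)
  apply: (@localized_sup K s) => //.
  move=> t Lt; rewrite -(@ler_pXn2r _ 2)// ?nnegrE ?sqrtr_ge0//; last first.
    by rewrite mulr_ge0 ?cmod_ge0// wgt_ge0.
  rewrite sqr_sqrtr// -lee_fin fineK ?ge0_fin_numE// -FE.
  by apply: (@esum_ge_term _ _ L (fun t => F t k)).
apply: (@le_trans _ _ (\sum_(0 <= k <oo) ((2 * K) ^+ 2)%:E * \esum_(t in L) F t k)%E).
  by apply: lee_nneseries => [n _ _|n _]; [rewrite lee_fin sqr_ge0|exact: Fk].
rewrite nneseriesZl; last by move=> k _; exact: esum_ge0.
rewrite [X in (_ <= X * _)%E]EFinM -muleA lee_wpmul2l ?lee_fin ?(ltW K2)//.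
apply: (le_trans (nneseries_esum_ge _ _)) => //.
apply: (@le_trans _ _ (\esum_(t in L)
    ((2 / (1 - r ^+ 2))%:E * (cmod (row_apply c t) ^+ 2)%:E))%E); last first.
  by apply: esumZl_le; rewrite ?(ltW K'0).
apply: le_esum => t Lt; rewrite /F.
under eq_eseriesr do rewrite mulrC EFinM.
rewrite nneseriesZl; last by move=> k _; rewrite lee_fin exprn_ge0//; case/andP: r01.
by rewrite muleC lee_wpmul2r// sum_distn.
Qed.

Lemma row_apply_sum (s : seq T) (u : T -> R[i]) (e : T -> nat -> R[i]) :
  (forall t, bounded_seq (e t)) ->
  bounded_seq (fun n => \sum_(t <- s) u t * e t n) /\
  (forall t', row_apply (fun n => \sum_(t <- s) u t * e t n) t' =
    \sum_(t <- s) u t * row_apply (e t) t').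
Proof.
move=> be; elim: s => [|t s [[B IHb] IHr]].
  split; first by exists 0 => n; rewrite big_nil cmod0.
  move=> t'; rewrite big_nil /row_apply -[RHS]csum0; apply: eq_csum => n.
  by rewrite big_nil mulr0.
have [B1 eB1] := be t.
split.
  exists (cmod (u t) * B1 + B) => n; rewrite big_cons.
  by rewrite (le_trans (cmodD_le _ _))// lerD// cmodM ler_wpM2l// cmod_ge0.
move=> t'; rewrite big_cons -IHr /row_apply.
have [s1 _] := row_bound t' eB1; have [s2 _] := row_bound t' IHb.
rewrite -csumZ// -csumD//; last exact: csummableZ.
by apply: eq_csum => n; rewrite big_cons mulrDr mulrCA.
Qed.

(* Testing the bound on unimodular combinations of the solutions [e t] of the
   interpolation problems [row_apply (e t) u = (u == t)] bounds sum_t |e t n|. *)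
Lemma column_sum_of_cis (K : R) m : 0 < K ->
  (forall c M, bounded_seq c -> 0 <= M ->
     (forall t, L t -> cmod (row_apply c t) <= M) ->
     forall n, cmod (c n) <= K * M) ->
  (forall v M, (forall t, L t -> cmod (v t) <= M) ->
     exists2 c, bounded_seq c & forall t, L t -> row_apply c t = v t) ->
  (\esum_(t in L) (cmod (A t m))%:E <= (C ^+ 2 * K * 4)%:E)%E.
Proof.
move=> K0 H1 H2.
have /choice[e He] : forall t, exists c, bounded_seq c /\
    forall u, L u -> row_apply c u = (if u == t then 1 else 0).
  move=> t; have [|c bc Hc] := H2 (fun u => if u == t then 1 else 0) 1.
    by move=> u _; case: ifP; rewrite ?cmod1 ?cmod0.
  by exists c.
have be t : bounded_seq (e t) by case: (He t).
apply: esum_le_seq => s us sL.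
have dual n : \sum_(t <- s) cmod (e t n) <= K.
  pose u t := (e t n)^* / (cmod (e t n))%:C.
  have u1 t : cmod (u t) <= 1.
    rewrite cmodM cmodV cmod_conj cmod_real ger0_norm ?cmod_ge0//.
    have [->|z0] := eqVneq (cmod (e t n)) 0; first by rewrite mul0r.
    by rewrite divff.
  have ue t : u t * e t n = (cmod (e t n))%:C.
    have [z0|z0] := eqVneq (e t n) 0; first by rewrite z0 mulr0 cmod0.
    rewrite /u mulrAC [_^* * _]mulrC mulc_conj expr2 rmorphM/= mulfK//.
    by apply/eqP => -[/eqP]; rewrite cmod_eq0 (negbTE z0).
  have [bs rs] := row_apply_sum s u be.
  have := H1 _ 1 bs ler01 _ n; rewrite mulr1.
  have -> : \sum_(t <- s) u t * e t n = (\sum_(t <- s) cmod (e t n))%:C.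
    by rewrite rmorph_sum/=; apply: eq_bigr => t _; exact: ue.
  rewrite cmod_real ger0_norm; last by apply: sumr_ge0 => *; exact: cmod_ge0.
  apply => t' Lt'; rewrite rs.
  under eq_bigr do rewrite (He _).2//.
  have [ts|ts] := boolP (t' \in s).
    rewrite (bigD1_seq t')//= eqxx mulr1 big1 ?addr0// => i it.
    by rewrite eq_sym (negbTE it) mulr0.
  rewrite big_seq big1 ?cmod0// => i si; case: eqVneq => [E|]; rewrite ?mulr0//.
  by rewrite -E (negbTE ts) in si.
(* Row t sends [e t] to 1 at t, so |A t m| is at most the sum over n of |A t m| |A t n| |e t n|. The
   two decays combine through [kap t] by the triangle inequality and leave 8^-|n - m|, which no
   longer depends on t. *)
have col t : t \in s -> ((cmod (A t m))%:E <=
    \sum_(0 <= n <oo) (C ^+ 2 * 8^-1 ^+ distn n m * cmod (e t n))%:E)%E.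
  move=> ts; have Lt := sL _ ts; have [B eB] := be t.
  have [sr _] := row_bound t eB.
  have := le_csum sr; rewrite -/(row_apply (e t) t) (He t).2// eqxx cmod1 => h.
  apply: (@le_trans _ _ ((cmod (A t m))%:E *
      \sum_(0 <= n <oo) (cmod (A t n * e t n))%:E)%E).
    by rewrite -[leLHS]mule1 lee_wpmul2l// lee_fin cmod_ge0.
  rewrite -nneseriesZl; last by move=> n _; rewrite lee_fin cmod_ge0.
  apply: lee_nneseries => [n _ _|n _]; rewrite -EFinM lee_fin.
    by rewrite mulr_ge0 ?cmod_ge0.
  rewrite cmodM mulrA ler_wpM2r ?cmod_ge0//.
  apply: (@le_trans _ _ ((C * 8^-1 ^+ distn m (kap t)) *
      (C * 8^-1 ^+ distn n (kap t)))).
    by apply: ler_pM => //; exact: cmod_ge0.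
  rewrite mulrACA -exprD -expr2 ler_wpM2l ?sqr_ge0// ler_wiXn2l//.
  - by rewrite invf_le1; lra.
  - by rewrite /distn; lia.
rewrite big_seq; apply: (le_trans (lee_sum _ col)); rewrite -big_seq.
rewrite -nneseries_sum; last first.
  by move=> t n _; rewrite lee_fin !mulr_ge0 ?cmod_ge0 ?exprn_ge0// ltW.
under eq_eseriesr do rewrite sumEFin -mulr_sumr.
apply: (@le_nneseriesZl _ _ (fun n => 8^-1 ^+ distn n m)).
- by rewrite mulr_ge0 ?sqr_ge0// ltW.
- move=> n; rewrite !mulr_ge0 ?exprn_ge0 ?(ltW C_gt0)//.
  by apply: sumr_ge0 => *; exact: cmod_ge0.
- by move=> n; rewrite exprn_ge0.
- move=> n; rewrite [leRHS]mulrAC ler_wpM2l//.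
  by rewrite mulr_ge0 ?sqr_ge0// exprn_ge0// invr_ge0.
- exact: sum_eighth.
Qed.

(** Schur's test: absolute row sums are at most 4 C by the decay, absolute column sums at most M. *)
Lemma l2_upper_of_columns (M : R) c : 0 <= M ->
  (forall m, (\esum_(t in L) (cmod (A t m))%:E <= M%:E)%E) ->
  bounded_seq c ->
  (l2sq_on (row_apply c) <= (C * 4 * M)%:E * l2sq c)%E.
Proof.
move=> M0 HM [B cB].
have C40 : 0 < C * 4 by rewrite mulr_gt0.
have t0 t n : (0 <= (cmod (A t n) * cmod (c n) ^+ 2)%:E)%E.
  by rewrite lee_fin mulr_ge0 ?sqr_ge0// cmod_ge0.
apply: (@le_trans _ _ (\esum_(t in L) ((C * 4)%:E *
    \sum_(0 <= n <oo) (cmod (A t n) * cmod (c n) ^+ 2)%:E))%E).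
  apply: le_esum => t Lt; apply: weighted_cauchy_schwarz => //.
  - by move=> n; exact: cmod_ge0.
  - by move=> n; exact: cmod_ge0.
  - exact: cmod_ge0.
  - apply: (@le_nneseriesZl _ _ (fun n => 8^-1 ^+ distn n (kap t))) => //.
    + exact: ltW.
    + by move=> n; exact: cmod_ge0.
    + exact: sum_eighth.
  - have [sr _] := row_bound t cB; apply: (le_trans (le_csum sr)).
    by under eq_eseriesr do rewrite cmodM.
apply: (le_trans (esumZl_le _ _)); first exact: ltW.
  by move=> t _; exact: nneseries_ge0.
rewrite [X in (_ <= X * _)%E]EFinM -muleA lee_wpmul2l ?lee_fin ?(ltW C40)//.
apply: (le_trans (nneseries_esum_le _ _)) => //.
rewrite /l2sq -nneseriesZl; last by move=> n _; rewrite lee_fin sqr_ge0.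
apply: lee_nneseries => [n _ _|n _]; first exact: esum_ge0.
apply: (@le_trans _ _ (\esum_(t in L)
    ((cmod (c n) ^+ 2)%:E * (cmod (A t n))%:E))%E).
  by apply: le_esum => t _; rewrite -EFinM mulrC.
apply: (le_trans (esumZl_le _ _)); rewrite ?sqr_ge0//.
  by move=> t _; rewrite lee_fin cmod_ge0.
by rewrite muleC lee_wpmul2r// lee_fin sqr_ge0.
Qed.

Lemma small_step (K : R) : 0 < K -> exists2 s : R, 0 < s <= 1 & K * s <= 2^-1.
Proof.
move=> K0; exists (2 * K + 1)^-1.
  by rewrite invr_gt0 invf_le1//=; lra.
by rewrite ler_pdivrMr; lra.
Qed.

Lemma cis_sup_l2 : cis_sup -> cis_l2.
Proof.
move=> [[K K0 H1] H2].
have [|s s01 Ks] := @small_step (K * C * 4); first by rewrite !mulr_gt0.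
have Ks' : K * (s * C * 4) <= 2^-1.
  by rewrite [leLHS](_ : _ = K * C * 4 * s)//; ring.
have low := l2_lower_of_sup K0 s01 Ks' H1.
set K1 := (_ * _) in low.
have up c : bounded_seq c -> _ :=
  l2_upper_of_columns (_ : 0 <= C ^+ 2 * K * 4)
    (fun m => column_sum_of_cis m K0 H1 H2).
have M0 : 0 <= C ^+ 2 * K * 4 by rewrite !mulr_ge0 ?sqr_ge0// ltW.
set K2 := C * 4 * (C ^+ 2 * K * 4).
have K10 : 0 <= K1.
  have /andP[s0 s1] := s01.
  rewrite /K1 mulr_ge0 ?sqr_ge0// divr_ge0// subr_ge0 exprn_ile1//.
    by rewrite invr_ge0; lra.
  by rewrite invf_le1; lra.
have K20 : 0 <= K2 by rewrite /K2 !mulr_ge0// ltW.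
have g0 c : (0 <= l2sq_on (row_apply c))%E.
  by apply: esum_ge0 => *; rewrite lee_fin sqr_ge0.
have h0 c : (0 <= l2sq c)%E.
  by apply: nneseries_ge0 => *; rewrite lee_fin sqr_ge0.
split.
  exists (K1 + K2 + 1); first by rewrite ltr_pwDr// addr_ge0.
  move=> c /l2_bounded bc; split.
    apply: (le_trans (low c bc)); rewrite lee_wpmul2r// lee_fin; lra.
  apply: (le_trans (up M0 c bc)); rewrite lee_wpmul2r// lee_fin -/K2; lra.
move=> v fv.
have [|c bc cv] := H2 v (1 + fine (l2sq_on v)).
  move=> t Lt.
  have p u : (0 <= (cmod (v u) ^+ 2)%:E)%E by rewrite lee_fin sqr_ge0.
  have h : ((cmod (v t) ^+ 2)%:E <= l2sq_on v)%E.
    by apply: (@esum_ge_term _ _ L (fun t => (cmod (v t) ^+ 2)%:E)).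
  have l0 : (0 <= l2sq_on v)%E by apply: le_trans h.
  move: h; rewrite -[X in (_ <= X)%E]fineK ?ge0_fin_numE// lee_fin.
  have := cmod_ge0 (v t); set x := cmod _; set y := fine _; nra.
(* The bound [low] holds for every bounded sequence, so it shows that the bounded solution is itself
   square summable. *)
exists c => //; apply: (le_lt_trans (low c bc)).
have -> : l2sq_on (row_apply c) = l2sq_on v by apply: eq_esum => t /cv ->.
by rewrite lte_mul_pinfty.
Qed.

(** * From square summable to bounded sequences *)

Section l2_to_sup.
Variable K : R.
Hypothesis K_gt0 : 0 < K.
Hypothesis low : forall c, (l2sq c < +oo)%E ->
  (l2sq c <= K%:E * l2sq_on (row_apply c))%E.
Hypothesis up : forall c, (l2sq c < +oo)%E ->
  (l2sq_on (row_apply c) <= K%:E * l2sq c)%E.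
Hypothesis interp : forall v, (l2sq_on v < +oo)%E ->
  exists2 c, (l2sq c < +oo)%E & forall t, L t -> row_apply c t = v t.

(** The upper bound at the n-th unit vector, whose image is column n. *)
Lemma column_sq_sum n : (\esum_(t in L) (cmod (A t n) ^+ 2)%:E <= K%:E)%E.
Proof.
pose d k : R[i] := if k == n then 1 else 0.
have dE : l2sq d = 1%E.
  rewrite /l2sq -(nneseries_delta n ler01); apply: eq_eseriesr => k _.
  by rewrite /d; case: ifP; rewrite ?cmod1 ?cmod0 ?expr1n ?expr0n.
have := up (_ : l2sq d < +oo)%E; rewrite dE mule1 => /(_ (ltry _)).
apply: le_trans; apply: le_esum => t _; rewrite lee_fin.
suff -> : row_apply d t = A t n by [].
rewrite -[RHS](csum_delta n); apply: eq_csum => k; rewrite /d.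
by case: eqP => [->|]; rewrite ?mulr1 ?mulr0.
Qed.

(** Bounded density of the levels: since |A t (kap t)| >= c0, the weight r^|kap t - k| is at most
    c0^-2 times the sum over n of r^|n - k| |A t n|^2, and the sum over t is taken column by
    column. *)
Lemma weight_count (r : R) k : 0 <= r < 1 ->
  (\esum_(t in L) (r ^+ distn (kap t) k)%:E <=
    (c0 ^- 2 * K * (2 / (1 - r)))%:E)%E.
Proof.
move=> r01; have /andP[r0 r1] := r01.
have p0 t n : (0 <= (r ^+ distn n k * cmod (A t n) ^+ 2)%:E)%E.
  by rewrite lee_fin mulr_ge0 ?sqr_ge0 ?exprn_ge0.
have c2 : 0 < c0 ^- 2 by rewrite invr_gt0 exprn_gt0.
apply: (@le_trans _ _ (\esum_(t in L) ((c0 ^- 2)%:E *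
   \sum_(0 <= n <oo) (r ^+ distn n k * cmod (A t n) ^+ 2)%:E))%E).
  apply: le_esum => t Lt.
  apply: (@le_trans _ _ ((c0 ^- 2)%:E *
     (r ^+ distn (kap t) k * cmod (A t (kap t)) ^+ 2)%:E)%E).
    rewrite -EFinM lee_fin mulrCA ler_peMr ?exprn_ge0//.
    rewrite ler_pdivlMl ?exprn_gt0// mulr1 ler_pXn2r ?nnegrE ?cmod_ge0 ?(ltW c0_gt0)//.
    exact: A_diag.
  rewrite lee_wpmul2l ?lee_fin ?(ltW c2)//.
  exact: (nneseries_ge_eterm (kap t) (p0 t)).
apply: (le_trans (esumZl_le _ _)); first exact: ltW.
  by move=> t _; exact: nneseries_ge0.
rewrite -mulrA EFinM lee_wpmul2l ?lee_fin ?(ltW c2)//.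
apply: (le_trans (nneseries_esum_le _ _)) => //.
apply: (@le_trans _ _ (\sum_(0 <= n <oo) (K%:E * (r ^+ distn n k)%:E))%E).
  apply: lee_nneseries => [n _ _|n _]; first exact: esum_ge0.
  apply: (@le_trans _ _ (\esum_(t in L)
      ((r ^+ distn n k)%:E * (cmod (A t n) ^+ 2)%:E))%E); first exact: le_esum.
  apply: (le_trans (esumZl_le _ _)); rewrite ?exprn_ge0//.
    by move=> t _; rewrite lee_fin sqr_ge0.
  by rewrite muleC lee_wpmul2r ?lee_fin ?exprn_ge0// column_sq_sum.
rewrite nneseriesZl; last by move=> n _; rewrite lee_fin exprn_ge0.
by rewrite EFinM lee_wpmul2l ?lee_fin ?(ltW K_gt0)// sum_distn.
Qed.

Let N2 := c0 ^- 2 * K * 4.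

Lemma half_count k : (\esum_(t in L) (2^-1 ^+ distn (kap t) k)%:E <= N2%:E)%E.
Proof.
apply: (le_trans (weight_count _ (half_lt1 R))); rewrite lee_fin ler_wpM2l//.
  by rewrite mulr_ge0 ?invr_ge0 ?exprn_ge0 ?(ltW c0_gt0) ?(ltW K_gt0).
by rewrite ler_pdivrMr; lra.
Qed.

Lemma N2_ge0 : 0 <= N2.
Proof. by rewrite !mulr_ge0 ?invr_ge0 ?exprn_ge0 ?(ltW c0_gt0) ?(ltW K_gt0). Qed.

Lemma wgt_l2 s k c : 0 < s -> bounded_seq c ->
  (l2sq (fun n => ((wgt s k n)%:C * c n)%R) < +oo)%E.
Proof.
move=> s0 [B cB]; have B0 : 0 <= B := le_trans (cmod_ge0 _) (cB 0%N).
set r := (1 + s)^-1; have r01 : 0 <= r < 1.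
  by rewrite invr_ge0 invf_lt1 ?ltrDl//; lra.
apply: (@le_lt_trans _ _ (B ^+ 2 * (2 / (1 - r)))%:E); last exact: ltry.
apply: (@le_nneseriesZl _ _ (fun n => r ^+ distn n k)).
- exact: sqr_ge0.
- by move=> n; exact: sqr_ge0.
- by move=> n; rewrite exprn_ge0//; case/andP: r01.
- move=> n; rewrite cmodM cmod_real ger0_norm ?wgt_ge0// exprMn mulrC.
  rewrite ler_pM ?sqr_ge0 ?lerXn2r ?nnegrE ?cmod_ge0//.
  by rewrite expr2 ler_piMl ?wgt_ge0 ?wgt_le1.
- exact: sum_distn.
Qed.

Lemma commutator_l2 s k c : 0 < s <= 1 -> bounded_seq c ->
  (l2sq_on (fun t => (wgt s k (kap t))%:C * row_apply c t -
     row_apply (fun n => (wgt s k n)%:C * c n) t)%R <=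
   (s ^+ 2 * C ^+ 2 * 4 * N2)%:E * l2sq (fun n => (wgt s k n)%:C * c n)%R)%E.
Proof.
move=> s01 bc; have /andP[s0 s1] := s01.
set d := fun n => _ * c n.
have sC : 0 < s * C by rewrite mulr_gt0.
have t0 t n : (0 <= (s * C * 2^-1 ^+ distn n (kap t) * cmod (d n) ^+ 2)%:E)%E.
  by rewrite lee_fin mulr_ge0 ?sqr_ge0// mulr_ge0 ?exprn_ge0// ltW.
apply: (@le_trans _ _ (\esum_(t in L) ((s * C * 4)%:E *
    \sum_(0 <= n <oo) (s * C * 2^-1 ^+ distn n (kap t) * cmod (d n) ^+ 2)%:E))%E).
  apply: le_esum => t Lt; apply: weighted_cauchy_schwarz => //.
  - by move=> n; rewrite mulr_ge0 ?exprn_ge0 ?(ltW sC).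
  - by move=> n; exact: cmod_ge0.
  - by rewrite mulr_gt0.
  - exact: cmod_ge0.
  - apply: (@le_nneseriesZl _ _ (fun n => 2^-1 ^+ distn n (kap t))) => //.
    + exact: ltW.
    + by move=> n; rewrite mulr_ge0 ?exprn_ge0 ?(ltW sC).
    + exact: sum_half.
  - exact: wgt_commutator.
have sC4 : 0 <= s * C * 4 by apply: mulr_ge0 => //; exact: ltW.
apply: (le_trans (esumZl_le sC4 _)); first by move=> t _; exact: nneseries_ge0.
have -> : s ^+ 2 * C ^+ 2 * 4 * N2 = (s * C * 4) * (s * C * N2) by ring.
rewrite [X in (_ <= X * _)%E]EFinM -muleA lee_wpmul2l ?lee_fin//.
apply: (le_trans (nneseries_esum_le _ _)) => //.
rewrite /l2sq -nneseriesZl; last by move=> n _; rewrite lee_fin sqr_ge0.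
apply: lee_nneseries => [n _ _|n _]; first exact: esum_ge0.
apply: (@le_trans _ _ (\esum_(t in L)
    ((s * C * cmod (d n) ^+ 2)%:E * (2^-1 ^+ distn (kap t) n)%:E))%E).
  by apply: le_esum => t _; rewrite -EFinM distnC lee_fin [leRHS]mulrAC.
apply: (le_trans (esumZl_le _ _)).
- by rewrite mulr_ge0 ?sqr_ge0 ?(ltW sC).
- by move=> t _; rewrite lee_fin exprn_ge0.
have -> : ((s * C * N2)%:E * (cmod (d n) ^+ 2)%:E =
    (s * C * cmod (d n) ^+ 2)%:E * N2%:E)%E by rewrite -!EFinM mulrAC.
by rewrite lee_wpmul2l ?half_count// lee_fin mulr_ge0 ?sqr_ge0 ?(ltW sC).
Qed.

Lemma l2sq_on_ge0 v : (0 <= l2sq_on v)%E.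
Proof. by apply: esum_ge0 => t _; rewrite lee_fin sqr_ge0. Qed.

Lemma l2sq_ge0 c : (0 <= l2sq c)%E.
Proof. by apply: nneseries_ge0 => n _ _; rewrite lee_fin sqr_ge0. Qed.

(** The analogue of [localized_sup]. With |a - b|^2 <= 2 |a|^2 + 2 |b|^2 the commutator contributes
    the fraction 8 K C^2 N2 s^2 <= 1/2 of the left-hand side, which is finite by [wgt_l2]; absorbing
    it doubles 2 K to 4 K. *)
Lemma localized_l2 s k c : 0 < s <= 1 -> (8 * K * C ^+ 2 * N2 + 1) * s <= 2^-1 ->
  bounded_seq c ->
  (l2sq (fun n => (wgt s k n)%:C * c n)%R <=
   (4 * K)%:E * l2sq_on (fun t => (wgt s k (kap t))%:C * row_apply c t)%R)%E.
Proof.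
move=> s01 Ks bc; have /andP[s0 s1] := s01.
have df := wgt_l2 k s0 bc; have cm := commutator_l2 k s01 bc.
set d := fun n => _ * c n in df cm *.
set w := fun t => (wgt s k (kap t))%:C * row_apply c t.
have [->|] := eqVneq (l2sq_on w) +oo%E.
  by rewrite gt0_muley ?leey// lte_fin mulr_gt0.
rewrite -ltey => wf.
have tri : (l2sq_on (row_apply d) <= 2%:E * l2sq_on w +
   2%:E * l2sq_on (fun t => w t - row_apply d t)%R)%E.
  apply: (@le_trans _ _ (\esum_(t in L) ((2 * cmod (w t) ^+ 2)%:E +
      (2 * cmod (w t - row_apply d t) ^+ 2)%:E)%E)).
    apply: le_esum => t _; rewrite -EFinD lee_fin.
    rewrite -[X in cmod X ^+ 2 <= _](subKr (w t)).
    by apply: le_trans (cmod_sqD_le _ _) _; rewrite cmodN.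
  rewrite esumD; last 2 first.
  - by move=> t _; rewrite lee_fin mulr_ge0 ?sqr_ge0.
  - by move=> t _; rewrite lee_fin mulr_ge0 ?sqr_ge0.
  have Z (v : T -> R[i]) : (\esum_(t in L) (2 * cmod (v t) ^+ 2)%:E <=
      2%:E * l2sq_on v)%E.
    apply: le_trans (esumZl_le _ _); rewrite ?ler0n//.
    by move=> t _; rewrite lee_fin sqr_ge0.
  by apply: leeD; exact: Z.
have w0 := l2sq_on_ge0 w; have d0 := l2sq_ge0 d.
have := le_trans (low df) (lee_wpmul2l _ (le_trans tri (leeD2l _ (lee_wpmul2l _ cm)))).
rewrite !lee_fin => /(_ (ltW K_gt0) (ler0n _ _)).
rewrite -(fineK (_ : l2sq d \is a fin_num)) ?ge0_fin_numE//.
rewrite -(fineK (_ : l2sq_on w \is a fin_num)) ?ge0_fin_numE//.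
rewrite -EFinM lee_fin.
have : 0 <= fine (l2sq d) by rewrite fine_ge0.
have : 0 <= fine (l2sq_on w) by rewrite fine_ge0.
set x := fine (l2sq d); set y := fine _ => y0 x0 H.
have {}H : x <= K * (2 * y + 2 * (s ^+ 2 * C ^+ 2 * 4 * N2 * x)).
  by rewrite -lee_fin; exact: H.
have Kn : K * (2 * (s ^+ 2 * C ^+ 2 * 4 * N2)) <= 2^-1.
  have C2 : 0 <= K * C ^+ 2 * N2.
    by rewrite mulr_ge0 ?N2_ge0// mulr_ge0 ?sqr_ge0// ltW.
  have -> : K * (2 * (s ^+ 2 * C ^+ 2 * 4 * N2)) = 8 * (K * C ^+ 2 * N2) * s * s.
    by ring.
  have Ks2 : (8 * (K * C ^+ 2 * N2) + 1) * s <= 2^-1.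
    have -> : 8 * (K * C ^+ 2 * N2) = 8 * K * C ^+ 2 * N2 by ring.
    by [].
  have : 8 * (K * C ^+ 2 * N2) * s * s <= 8 * (K * C ^+ 2 * N2) * s * 1.
    by apply: ler_wpM2l => //; apply: mulr_ge0; [exact: mulr_ge0|exact: ltW].
  by move: Ks2; set P := K * C ^+ 2 * N2; lra.
have : K * (2 * (s ^+ 2 * C ^+ 2 * 4 * N2)) * x <= 2^-1 * x by rewrite ler_wpM2r.
move: H; set P := s ^+ 2 * C ^+ 2 * 4 * N2 => H H2.
by rewrite -EFinM lee_fin; nra.
Qed.

Lemma wgt_sq_count s k : 0 < s ->
  (\esum_(t in L) (wgt s k (kap t) ^+ 2)%:E <=
    (c0 ^- 2 * K * (2 / (1 - (1 + s)^-1 ^+ 2)))%:E)%E.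
Proof.
move=> s0; apply: (@le_trans _ _
    (\esum_(t in L) (((1 + s)^-1 ^+ 2) ^+ distn (kap t) k)%:E)%E).
  by apply: le_esum => t _; rewrite /wgt -!exprM mulnC.
apply: weight_count; rewrite sqr_ge0/= exprn_ilt1// ?invr_ge0 ?invf_lt1//; lra.
Qed.

(* Bounded data are interpolated by splitting them along the levels of [kap]:
   the l2 solution for the level N decays away from N. *)
Lemma l2_to_cis_sup : cis_sup.
Proof.
have [|s s01 Ks] := @small_step (8 * K * C ^+ 2 * N2 + 1).
  by rewrite ltr_wpDl// mulr_ge0 ?N2_ge0// mulr_ge0 ?sqr_ge0// mulr_ge0// ltW.
have /andP[s0 s1] := s01.
have c2 : 0 < c0 ^- 2 by rewrite invr_gt0 exprn_gt0.
pose r := (1 + s)^-1.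
have r0 : 0 <= r by rewrite invr_ge0; lra.
have r1 : r < 1 by rewrite invf_lt1; lra.
have r2 : r ^+ 2 < 1 by rewrite exprn_ilt1.
pose Q := c0 ^- 2 * K * (2 / (1 - (1 + s)^-1 ^+ 2)).
have Q0 : 0 <= Q.
  rewrite mulr_ge0 ?mulr_ge0 ?(ltW c2) ?(ltW K_gt0)// invr_ge0 subr_ge0.
  exact: ltW.
have coord k c : bounded_seq c -> ((cmod (c k) ^+ 2)%:E <=
    (4 * K)%:E * l2sq_on (fun t => ((wgt s k (kap t))%:C * row_apply c t)%R))%E.
  move=> bc; apply: le_trans (localized_l2 k s01 Ks bc).
  rewrite /l2sq (@nneseriesD1 _ _ k)//.
    by rewrite wgtkk mul1r leeDl// nneseries_ge0// => n _ _; rewrite lee_fin sqr_ge0.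
  by move=> n _; rewrite lee_fin sqr_ge0.
have wsq (v : T -> R[i]) k (M : R) : 0 <= M ->
    (forall t, L t -> cmod (v t) <= M) ->
    (l2sq_on (fun t => ((wgt s k (kap t))%:C * v t)%R) <=
      (M ^+ 2)%:E * \esum_(t in L) (wgt s k (kap t) ^+ 2)%:E)%E.
  move=> M0 vM.
  apply: le_trans (esumZl_le _ _); rewrite ?sqr_ge0//; last first.
    by move=> t _; rewrite lee_fin sqr_ge0.
  apply: le_esum => t Lt; rewrite -EFinM lee_fin cmodM cmod_real.
  rewrite ger0_norm ?wgt_ge0// exprMn mulrC ler_wpM2r ?sqr_ge0//.
  by rewrite lerXn2r ?nnegrE ?cmod_ge0 ?vM.
split.
  have X0 : 0 <= 4 * K * Q by rewrite mulr_ge0// mulr_ge0// ltW.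
  (* The estimate is obtained for squares with constant X = 4 K Q, and X <= (1 + X)^2. *)
  exists (1 + 4 * K * Q); first by lra.
  move=> c M bc M0 cM k.
  rewrite -(@ler_pXn2r _ 2)// ?nnegrE ?cmod_ge0 ?mulr_ge0 ?addr_ge0//.
  apply: (@le_trans _ _ (4 * K * Q * M ^+ 2)); last first.
    by rewrite exprMn ler_wpM2r ?sqr_ge0//; nra.
  rewrite -lee_fin; apply: (le_trans (coord k c bc)).
  have -> : 4 * K * Q * M ^+ 2 = 4 * K * (M ^+ 2 * Q) by ring.
  rewrite [leRHS]EFinM lee_wpmul2l ?lee_fin ?mulr_ge0 ?(ltW K_gt0)//.
  apply: (le_trans (wsq _ _ _ M0 cM)).
  by rewrite [leRHS]EFinM lee_wpmul2l ?lee_fin ?sqr_ge0// wgt_sq_count.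
move=> v M0 vM0; pose M := `|M0|.
have M_ge0 : 0 <= M by exact: normr_ge0.
have vM t : L t -> cmod (v t) <= M by move=> /vM0 /le_trans; apply; exact: ler_norm.
pose V N t := if kap t == N then v t else 0.
(* The indicator of the level N is dominated by 2^-|kap t - N|, so that [half_count] bounds the
   number of points on the level. *)
have VM N t : L t -> cmod (V N t) ^+ 2 <= M ^+ 2 * 2^-1 ^+ distn (kap t) N.
  move=> Lt; rewrite /V; case: eqP => [->|_].
    by rewrite /distn subnn expr0 mulr1 lerXn2r ?nnegrE ?cmod_ge0 ?vM.
  by rewrite cmod0 expr0n/= mulr_ge0 ?sqr_ge0// exprn_ge0.
have /choice[d Hd] : forall N, exists c, (l2sq c < +oo)%E /\
    forall t, L t -> row_apply c t = V N t.
  move=> N; have [|c] := @interp (V N); last by exists c.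
  apply: (@le_lt_trans _ _ ((M ^+ 2)%:E * N2%:E)%E); last exact: ltry.
  apply: (@le_trans _ _ (\esum_(t in L)
      ((M ^+ 2)%:E * (2^-1 ^+ distn (kap t) N)%:E))%E).
    by apply: le_esum => t Lt; rewrite -EFinM lee_fin VM.
  apply: (le_trans (esumZl_le _ _)); rewrite ?sqr_ge0//.
  by rewrite lee_wpmul2l ?lee_fin ?sqr_ge0// half_count.
pose X := 4 * K * (M ^+ 2 * N2).
have X0 : 0 <= X.
  by rewrite mulr_ge0// ?mulr_ge0 ?N2_ge0 ?sqr_ge0// ltW.
(* The data [V N] live on the level N, where the weight centred at k has the constant value r^|N -
   k|. *)
have dk N k : cmod (d N k) <= (1 + X) * r ^+ distn N k.
  have W0 := wgt_ge0 k N s0.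
  rewrite -[r ^+ _]/(wgt s k N).
  rewrite -(@ler_pXn2r _ 2)// ?nnegrE ?cmod_ge0 ?mulr_ge0 ?addr_ge0//.
  apply: (@le_trans _ _ (X * wgt s k N ^+ 2)); last first.
    by rewrite exprMn ler_wpM2r ?sqr_ge0//; nra.
  have [d2 dV] := Hd N.
  rewrite -lee_fin; apply: (le_trans (coord k _ (l2_bounded d2))).
  have -> : X * wgt s k N ^+ 2 = 4 * K * ((wgt s k N ^+ 2 * M ^+ 2) * N2).
    by rewrite /X; ring.
  rewrite [leRHS]EFinM lee_wpmul2l ?lee_fin ?mulr_ge0 ?(ltW K_gt0)//.
  apply: (@le_trans _ _ (\esum_(t in L) ((wgt s k N ^+ 2 * M ^+ 2)%:E *
      (2^-1 ^+ distn (kap t) N)%:E))%E).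
    apply: le_esum => t Lt; rewrite -EFinM lee_fin dV// cmodM cmod_real.
    rewrite ger0_norm ?wgt_ge0// exprMn -[leRHS]mulrA.
    have h := VM N t Lt; have [E|ne] := eqVneq (kap t) N.
      by rewrite E in h *; rewrite ler_wpM2l ?sqr_ge0.
    have -> : V N t = 0 by rewrite /V (negbTE ne).
    by rewrite cmod0 expr0n/= mulr0 mulr_ge0 ?sqr_ge0// mulr_ge0 ?sqr_ge0// exprn_ge0.
  apply: (le_trans (esumZl_le _ _)); rewrite ?mulr_ge0 ?sqr_ge0//.
  by rewrite [leRHS]EFinM lee_wpmul2l ?lee_fin ?mulr_ge0 ?sqr_ge0// half_count.
have r01 : 0 <= r < 1 by rewrite r0.
have X1 : 0 <= 1 + X by rewrite addr_ge0.
pose Y := (1 + X) * (2 / (1 - r)).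
have sdk k : (\sum_(0 <= N <oo) (cmod (d N k))%:E <= Y%:E)%E.
  apply: (@le_nneseriesZl _ _ (fun N => r ^+ distn N k)) => //.
  - by move=> n; exact: cmod_ge0.
  - by move=> n; rewrite exprn_ge0.
  - exact: sum_distn.
pose c k := csum (fun N => d N k).
have sd k : csummable (fun N => d N k) by apply: le_lt_trans (sdk k) (ltry _).
exists c.
  by exists Y => k; rewrite -lee_fin (le_trans (le_csum (sd k)))// sdk.
move=> t Lt; rewrite /row_apply /c.
under eq_csum do rewrite -csumZ//.
(* Summing over n first gives the sum over N of [V N t], whose only nonzero term can be N = kap
   t. *)
rewrite csum_exchange.
  transitivity (csum (fun N => V N t)).
    by apply: eq_csum => N; rewrite -(Hd N).2.
  by rewrite -[RHS](csum_delta (kap t)); apply: eq_csum => N; rewrite /V eq_sym.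
apply: (@le_lt_trans _ _ (\sum_(0 <= n <oo) (cmod (A t n) * Y)%:E)%E).
  apply: lee_nneseries => [n _ _|n _].
    by apply: nneseries_ge0 => *; rewrite lee_fin cmod_ge0.
  under eq_eseriesr do rewrite cmodM EFinM.
  rewrite nneseriesZl; last by move=> *; rewrite lee_fin cmod_ge0.
  by rewrite EFinM lee_wpmul2l// lee_fin cmod_ge0.
have Y0 : 0 <= Y.
  by rewrite mulr_ge0// divr_ge0// subr_ge0 ltW.
apply: (@le_lt_trans _ _ ((C * Y) * 4)%:E); last exact: ltry.
apply: (@le_nneseriesZl _ _ (fun n => 8^-1 ^+ distn n (kap t))).
- by rewrite mulr_ge0// ltW.
- by move=> n; rewrite mulr_ge0 ?cmod_ge0.
- by move=> n; rewrite exprn_ge0.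
- by move=> n; rewrite mulrAC ler_wpM2r.
- exact: sum_eighth.
Qed.

End l2_to_sup.

Theorem cis_sup_iff_l2 : cis_sup <-> cis_l2.
Proof.
split; first exact: cis_sup_l2.
move=> [[K K0 HK] I]; apply: (@l2_to_cis_sup K) => // c cf.
  by case: (HK c cf).
by case: (HK c cf).
Qed.

End localized_matrix.

(** * Power series of entire functions *)

Section segment_integral.
Context {R : realType}.
Notation mu := (@lebesgue_measure R).
Implicit Types (f g : R[i] -> R[i]) (p u : R[i]) (a b : R).

(** The integral with respect to the real parameter t; the direction u of dz is supplied separately,
    in [rect] and in [seg_ftc]. *)
Definition seg g p u a b : R[i] :=
  cint mu [set` `[a, b]] (fun t => g (p + t%:C * u)).

Definition ccont_seg g p u a b : Prop :=
  forall t, a <= t <= b -> ccont g (p + t%:C * u).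

(** Used for F = Re, Im and the modulus, all 1-Lipschitz. *)
Lemma lipschitz_line_continuous (F : R[i] -> R) g p u (t : R) :
  (forall z w, `|F z - F w| <= cmod (z - w)) -> cmod u = 1 ->
  ccont g (p + t%:C * u) ->
  {for t, continuous (fun t : R => F (g (p + t%:C * u)))}.
Proof.
move=> FL u1 H; apply/cvgrPdist_le => e e0.
have [r r0 Hr] := H _ e0.
apply/nbhs_ballP; exists r => // s; rewrite /ball/= => ts.
rewrite (le_trans (FL _ _))// cmodC.
have -> : p + s%:C * u = p + t%:C * u + (s - t)%:C * u by rewrite rmorphB/=; ring.
by apply: Hr; rewrite cmodM u1 mulr1 cmod_real distrC.
Qed.

Lemma ccont_line_continuous g p u (t : R) : cmod u = 1 ->
  ccont g (p + t%:C * u) ->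
  {for t, continuous (fun t : R => complex.Re (g (p + t%:C * u)))} /\
  {for t, continuous (fun t : R => complex.Im (g (p + t%:C * u)))}.
Proof.
move=> u1 H; split; apply: lipschitz_line_continuous => // z w.
  by rewrite -Re_oppc -Re_addc normRe_le_cmod.
by rewrite -Im_oppc -Im_addc normIm_le_cmod.
Qed.

Lemma ccont_seg_bounded g p u a b : cmod u = 1 -> a <= b -> ccont_seg g p u a b ->
  exists M, forall t, a <= t <= b -> cmod (g (p + t%:C * u)) <= M.
Proof.
move=> u1 ab H.
have [|c _ Hc] := @EVT_max R (fun t => cmod (g (p + t%:C * u))) a b ab.
  apply: continuous_in_subspaceT => t; rewrite inE/= in_itv/= => /H.
  apply: lipschitz_line_continuous => // z w.
  rewrite ler_norml cmodB_ge andbT lerNl opprB cmodC; exact: cmodB_ge.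
by exists (cmod (g (p + c%:C * u))) => t tab; apply: Hc; rewrite in_itv.
Qed.

Lemma seg_integrable g p u a b : cmod u = 1 -> ccont_seg g p u a b ->
  cintegrable mu [set` `[a, b]] (fun t => g (p + t%:C * u)).
Proof.
move=> u1 H; split; apply: continuous_compact_integrable;
  try exact: segment_compact.
all: apply: continuous_in_subspaceT => t; rewrite inE/= in_itv/= => /H /(ccont_line_continuous u1)[].
all: done.
Qed.

Lemma seg_split g p u a b c : cmod u = 1 -> a <= b -> b <= c ->
  ccont_seg g p u a c -> seg g p u a c = seg g p u a b + seg g p u b c.
Proof.
move=> u1 ab bc H; have [I1 I2] := seg_integrable u1 H.
have key (f : R -> R) : mu.-integrable [set` `[a, c]] (EFin \o f) ->
    \int[mu]_(t in [set` `[a, c]]) f t = \int[mu]_(t in [set` `[a, b]]) f t +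
    \int[mu]_(t in [set` `[b, c]]) f t.
  move=> If; have := @Rintegral_itvB _ f (BLeft a) (BRight c) b If.
  rewrite !bnd_simp => /(_ ab bc); rewrite Rintegral_itv_obnd_cbnd => [<-|].
    by rewrite addrC subrK.
  by apply: integrableS If => //; apply: subset_itv; rewrite bnd_simp.
by rewrite /seg /cint !key//; simpc.
Qed.

Lemma seg_le g p u a b (M : R) : cmod u = 1 -> a <= b -> ccont_seg g p u a b ->
  (forall t, a <= t <= b -> cmod (g (p + t%:C * u)) <= M) ->
  cmod (seg g p u a b) <= M * (b - a).
Proof.
move=> u1 ab H gM; have Ig := seg_integrable u1 H.
rewrite (le_trans (le_cmod_cint _ Ig))//.
apply: (@le_trans _ _ (\int[mu]_(t in [set` `[a, b]]) M)).
  apply: le_Rintegral => //.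
  - exact: integrable_cmod.
  - apply/integrableP; split; first exact: measurable_cst.
    rewrite integral_cst//= lebesgue_measure_itv/=.
    by case: ifP => _; rewrite ?mule0// -EFinB -EFinM ltry.
have E : fine (mu [set` `[a, b]]) = b - a.
  rewrite lebesgue_measure_itv/= lte_fin.
  move: ab; rewrite le_eqVlt => /predU1P[->|->]; last by rewrite -EFinB.
  by rewrite ltxx subrr.
by rewrite Rintegral_cst// -E.
Qed.

Lemma segB f g p u a b : cmod u = 1 ->
  ccont_seg f p u a b -> ccont_seg g p u a b ->
  seg (fun z => f z - g z) p u a b = seg f p u a b - seg g p u a b.
Proof. by move=> u1 Hf Hg; apply: cintB => //; exact: seg_integrable. Qed.

Lemma segZ c g p u a b : cmod u = 1 -> ccont_seg g p u a b ->
  seg (fun z => c * g z) p u a b = c * seg g p u a b.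
Proof. by move=> u1 Hg; apply: cintZ => //; exact: seg_integrable. Qed.

(** The real fundamental theorem of calculus for Re and Im of t -> f (p + t u), whose derivative is
    u g; both are instances of a real-linear F with |F z| <= |z|. *)
Lemma seg_ftc f g p u a b : cmod u = 1 -> a <= b -> ccont_seg g p u a b ->
  (forall t, a <= t <= b -> cdiff f (p + t%:C * u) (g (p + t%:C * u))) ->
  u * seg g p u a b = f (p + b%:C * u) - f (p + a%:C * u).
Proof.
move=> u1; rewrite le_eqVlt => /predU1P[->|ab] H D.
  rewrite subrr /seg /cint set_itv1 /Rintegral !integral_set1/=.
  by rewrite -[_ +i* _]/(0 : R[i]) mulr0.
have Ig := seg_integrable u1 H.
rewrite /seg -cintZ//.
have key (F : R[i] -> R) : (forall z, `|F z| <= cmod z) ->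
    (forall z w, F (z - w) = F z - F w) ->
    (forall (x : R) z, F (x%:C * z) = x * F z) ->
    {within [set` `[a, b]], continuous (fun t : R => F (u * g (p + t%:C * u)))} ->
    \int[mu]_(t in [set` `[a, b]]) F (u * g (p + t%:C * u)) =
    F (f (p + b%:C * u)) - F (f (p + a%:C * u)).
  move=> F1 F2 F3 cg.
  pose G := fun t => F (f (p + t%:C * u)).
  have GD t : a <= t <= b -> is_derive t 1 (G : R^o -> R^o) (F (u * g (p + t%:C * u))).
    move=> tab; apply/is_derive_numP => e e0.
    have [r r0 Hr] := D _ tab _ e0; exists r => // h hr.
    have := Hr (h%:C * u); rewrite cmodM u1 mulr1 cmod_real => /(_ hr).
    apply: le_trans; apply: le_trans (F1 _).
    rewrite /G !F2 [X in `|_ - X|]mulrC -F3.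
    rewrite (_ : p + (t + h)%:C * u = p + t%:C * u + h%:C * u); last first.
      by rewrite rmorphD/=; ring.
    by rewrite [X in _ <= `|_ - F X|]mulrC -mulrA.
  have := @continuous_FTC2 R _ G _ _ ab cg.
  rewrite /Rintegral => ->//.
    have Gc t : a <= t <= b -> {for t, continuous G}.
      move=> /GD[Dt _]; apply/differentiable_continuous.
      exact/derivable1_diffP.
    split.
    - move=> t; rewrite in_itv/= => /andP[at1 tb].
      by have [|Dt _] := GD t; first by rewrite !ltW.
    - by apply: cvg_at_right_filter; apply: Gc; rewrite lexx ltW.
    - by apply: cvg_at_left_filter; apply: Gc; rewrite lexx ltW.
  move=> t; rewrite in_itv/= => /andP[at1 tb].
  rewrite derive1E; have [|Dt ->//] := GD t; first by rewrite !ltW.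
have cc (F : R[i] -> R) : {within [set` `[a, b]], continuous (fun t : R =>
    complex.Re (u * g (p + t%:C * u)))} /\ {within [set` `[a, b]], continuous (fun t : R =>
    complex.Im (u * g (p + t%:C * u)))}.
  have cg : ccont_seg (fun z => u * g z) p u a b.
    move=> t /H c e /c[r r0 Hr]; exists r => // h /Hr.
    by rewrite -mulrBr cmodM u1 mul1r.
  split; apply: continuous_in_subspaceT => t; rewrite inE/= in_itv/= =>
    /cg /(ccont_line_continuous u1)[].
    by [].
  by [].
have [c1 c2] := cc (fun=> 0).
rewrite /cint !key//.
- by case: (f _) (f _) => x1 y1 [x2 y2]; simpc.
- exact: normIm_le_cmod.
- by move=> z w; rewrite Im_addc Im_oppc.
- by move=> x z; rewrite Im_mulc /= mul0r addr0.
- exact: normRe_le_cmod.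
- by move=> z w; rewrite Re_addc Re_oppc.
- by move=> x z; rewrite Re_mulc /= mul0r subr0.
Qed.

End segment_integral.

Lemma ccontB (R : realType) (f g : R[i] -> R[i]) (z : R[i]) :
  ccont f z -> ccont g z -> ccont (fun w => f w - g w) z.
Proof.
move=> Hf Hg e e0; have e20 : 0 < e / 2 by rewrite divr_gt0.
have [r1 r10 H1] := Hf _ e20; have [r2 r20 H2] := Hg _ e20.
exists (Num.min r1 r2); first by rewrite lt_min r10.
move=> h; rewrite lt_min => /andP[/H1 h1 /H2 h2].
have -> : f (z + h) - g (z + h) - (f z - g z) =
  (f (z + h) - f z) - (g (z + h) - g z) by ring.
by rewrite (le_trans (cmodB_le _ _))//; move: h1 h2; lra.
Qed.

Lemma exists_pos_below (R : realType) (s : seq R) : all (fun x => 0 < x) s ->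
  exists2 t : R, 0 < t & all (fun x => t <= x) s.
Proof.
elim: s => [_|x s IH /= /andP[x0 /IH[t t0 ts]]]; first by exists 1.
exists (Num.min x t); first by rewrite lt_min x0.
rewrite ge_min lexx/=; apply/allP => y /(allP ts) ty.
by rewrite ge_min ty orbT.
Qed.

(** * Cauchy's theorem on rectangles *)

Section rectangle_integral.
Context {R : realType}.
Implicit Types (f g : R[i] -> R[i]) (a b c d x y : R).

Definition hseg g y a b := seg g (y%:C * 'i) 1 a b.
Definition vseg g x c d := seg g x%:C 'i c d.

(** The contour integral, counterclockwise: dz is dt on the horizontal sides and i dt on the
    vertical ones. *)
Definition rect g a b c d : R[i] :=
  hseg g c a b - hseg g d a b + 'i * (vseg g b c d - vseg g a c d).

Definition on_rect (P : R[i] -> Prop) a b c d : Prop :=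
  forall x y, a <= x <= b -> c <= y <= d -> P (x +i* y).

Definition on_border (P : R[i] -> Prop) a b c d : Prop :=
  forall x y, a <= x <= b -> c <= y <= d ->
    [|| x == a, x == b, y == c | y == d] -> P (x +i* y).

Lemma on_rect_border P a b c d : on_rect P a b c d -> on_border P a b c d.
Proof. by move=> H x y hx hy _; exact: H. Qed.

Lemma hpointE y (t : R) : y%:C * 'i + t%:C * 1 = t +i* y.
Proof. by simpc. Qed.

Lemma vpointE x (t : R) : x%:C + t%:C * 'i = x +i* t.
Proof. by simpc. Qed.

Lemma on_border_h (P : R[i] -> Prop) a b c d y t : c <= d ->
  on_border P a b c d -> (y = c) \/ (y = d) -> a <= t <= b ->
  P (y%:C * 'i + t%:C * 1).
Proof.
move=> cd H yE tab; rewrite hpointE; apply: H => //.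
  by case: yE => ->; rewrite lexx ?cd.
by case: yE => ->; rewrite eqxx !orbT.
Qed.

Lemma on_border_v (P : R[i] -> Prop) a b c d x t : a <= b ->
  on_border P a b c d -> (x = a) \/ (x = b) -> c <= t <= d ->
  P (x%:C + t%:C * 'i).
Proof.
move=> ab H xE tcd; rewrite vpointE; apply: H => //.
  by case: xE => ->; rewrite lexx ?ab.
by case: xE => ->; rewrite eqxx ?orbT.
Qed.

Lemma rect_splitx g a m b c d : a <= m -> m <= b -> c <= d ->
  on_border (ccont g) a m c d -> on_border (ccont g) m b c d ->
  rect g a b c d = rect g a m c d + rect g m b c d.
Proof.
move=> am mb cd H1 H2.
have K y : (y = c) \/ (y = d) -> hseg g y a b = hseg g y a m + hseg g y m b.
  move=> yE; apply: seg_split => //; first exact: cmod1.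
  move=> t /andP[h1 h2]; have [tm|mt] := leP t m.
    by apply: (on_border_h cd H1 yE); rewrite h1.
  by apply: (on_border_h cd H2 yE); rewrite h2 ltW.
by rewrite /rect !K; [ring|right|left].
Qed.

Lemma rect_splity g a b c m d : a <= b -> c <= m -> m <= d ->
  on_border (ccont g) a b c m -> on_border (ccont g) a b m d ->
  rect g a b c d = rect g a b c m + rect g a b m d.
Proof.
move=> ab cm md H1 H2.
have K x : (x = a) \/ (x = b) -> vseg g x c d = vseg g x c m + vseg g x m d.
  move=> xE; apply: seg_split => //; first exact: cmod_i.
  move=> t /andP[h1 h2]; have [tm|mt] := leP t m.
    by apply: (on_border_v ab H1 xE); rewrite h1.
  by apply: (on_border_v ab H2 xE); rewrite h2 ltW.
by rewrite /rect !K; [ring|left|right].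
Qed.

Lemma rect_le g a b c d (M : R) : a <= b -> c <= d ->
  on_border (ccont g) a b c d -> on_border (fun z => cmod (g z) <= M) a b c d ->
  cmod (rect g a b c d) <= 2 * M * ((b - a) + (d - c)).
Proof.
move=> ab cd H B.
have Hh y : (y = c) \/ (y = d) -> cmod (hseg g y a b) <= M * (b - a).
  move=> yE; apply: seg_le => //; first exact: cmod1.
    by move=> t tab; exact: (on_border_h cd H yE).
  by move=> t tab; exact: (on_border_h cd B yE).
have Hv x : (x = a) \/ (x = b) -> cmod (vseg g x c d) <= M * (d - c).
  move=> xE; apply: seg_le => //; first exact: cmod_i.
    by move=> t tab; exact: (on_border_v ab H xE).
  by move=> t tab; exact: (on_border_v ab B xE).
rewrite (le_trans (cmodD_le _ _))// cmodM cmod_i mul1r.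
have h1 := le_trans (cmodB_le (hseg g c a b) (hseg g d a b))
  (lerD (Hh c (or_introl erefl)) (Hh d (or_intror erefl))).
have h2 := le_trans (cmodB_le (vseg g b c d) (vseg g a c d))
  (lerD (Hv b (or_intror erefl)) (Hv a (or_introl erefl))).
move: h1 h2; lra.
Qed.

Lemma rectB f g a b c d : a <= b -> c <= d ->
  on_border (ccont f) a b c d -> on_border (ccont g) a b c d ->
  rect (fun z => f z - g z) a b c d = rect f a b c d - rect g a b c d.
Proof.
move=> ab cd Hf Hg.
have K y : (y = c) \/ (y = d) ->
    hseg (fun z => f z - g z) y a b = hseg f y a b - hseg g y a b.
  move=> yE; apply: segB; first exact: cmod1.
    by move=> t; exact: (on_border_h cd Hf yE).
  by move=> t; exact: (on_border_h cd Hg yE).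
have K' x : (x = a) \/ (x = b) ->
    vseg (fun z => f z - g z) x c d = vseg f x c d - vseg g x c d.
  move=> xE; apply: segB; first exact: cmod_i.
    by move=> t; exact: (on_border_v ab Hf xE).
  by move=> t; exact: (on_border_v ab Hg xE).
by rewrite /rect !K ?K'; [ring|left|right|right|left].
Qed.

Lemma rectZ k g a b c d : a <= b -> c <= d -> on_border (ccont g) a b c d ->
  rect (fun z => k * g z) a b c d = k * rect g a b c d.
Proof.
move=> ab cd Hg.
have K y : (y = c) \/ (y = d) -> hseg (fun z => k * g z) y a b = k * hseg g y a b.
  move=> yE; apply: segZ; first exact: cmod1.
  by move=> t; exact: (on_border_h cd Hg yE).
have K' x : (x = a) \/ (x = b) ->
    vseg (fun z => k * g z) x c d = k * vseg g x c d.
  move=> xE; apply: segZ; first exact: cmod_i.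
  by move=> t; exact: (on_border_v ab Hg xE).
by rewrite /rect !K ?K'; [ring|left|right|right|left].
Qed.

Lemma rect_ftc f g a b c d : a <= b -> c <= d -> on_border (ccont g) a b c d ->
  on_border (fun z => cdiff f z (g z)) a b c d -> rect g a b c d = 0.
Proof.
move=> ab cd Hc Hd.
have K y : (y = c) \/ (y = d) -> hseg g y a b = f (b +i* y) - f (a +i* y).
  move=> yE; rewrite -(mul1r (hseg _ _ _ _)) -!hpointE; apply: seg_ftc => //.
  - exact: cmod1.
  - by move=> t; exact: (on_border_h cd Hc yE).
  - by move=> t; exact: (on_border_h cd Hd yE).
have K' x : (x = a) \/ (x = b) -> 'i * vseg g x c d = f (x +i* d) - f (x +i* c).
  move=> xE; rewrite -!vpointE; apply: seg_ftc => //.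
  - exact: cmod_i.
  - by move=> t; exact: (on_border_v ab Hc xE).
  - by move=> t; exact: (on_border_v ab Hd xE).
by rewrite /rect mulrBr !K ?K'; [ring|left|right|right|left].
Qed.

Lemma eq_rect f g a b c d : (forall z, f z = g z) ->
  rect f a b c d = rect g a b c d.
Proof. by move=> /funext ->. Qed.

Lemma on_rectS P a b c d a' b' c' d' :
  a <= a' -> b' <= b -> c <= c' -> d' <= d ->
  on_rect P a b c d -> on_rect P a' b' c' d'.
Proof.
move=> h1 h2 h3 h4 H x y /andP[x1 x2] /andP[y1 y2]; apply: H.
  by rewrite (le_trans h1)//= (le_trans x2).
by rewrite (le_trans h3)//= (le_trans y2).
Qed.

Lemma rect_bisect g a b c d : a <= b -> c <= d -> on_rect (ccont g) a b c d ->
  exists q : R * R * R * R, let: (a', b', c', d') := q in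
    [/\ [/\ a <= a', b' <= b, c <= c' & d' <= d],
        b' - a' = (b - a) / 2, d' - c' = (d - c) / 2 &
        cmod (rect g a b c d) <= 4 * cmod (rect g a' b' c' d')].
Proof.
move=> ab cd H; pose m := (a + b) / 2; pose n := (c + d) / 2.
have am : a <= m by rewrite /m; lra. have mb : m <= b by rewrite /m; lra.
have cn : c <= n by rewrite /n; lra. have nd : n <= d by rewrite /n; lra.
have B a' b' c' d' : a <= a' -> b' <= b -> c <= c' -> d' <= d ->
    on_border (ccont g) a' b' c' d'.
  by move=> *; apply: on_rect_border; apply: on_rectS H.
have E : rect g a b c d = (rect g a m c n + rect g a m n d) +
    (rect g m b c n + rect g m b n d).
  rewrite (@rect_splitx _ _ m)//; [|by apply: B|by apply: B].
  by congr (_ + _); apply: rect_splity => //; apply: B.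
have am2 : m - a = (b - a) / 2 by rewrite /m; lra.
have mb2 : b - m = (b - a) / 2 by rewrite /m; lra.
have cn2 : n - c = (d - c) / 2 by rewrite /n; lra.
have nd2 : d - n = (d - c) / 2 by rewrite /n; lra.
have [h1|h1] := leP (cmod (rect g a b c d)) (4 * cmod (rect g a m c n)).
  by exists (a, m, c, n).
have [h2|h2] := leP (cmod (rect g a b c d)) (4 * cmod (rect g a m n d)).
  by exists (a, m, n, d).
have [h3|h3] := leP (cmod (rect g a b c d)) (4 * cmod (rect g m b c n)).
  by exists (m, b, c, n).
exists (m, b, n, d); split => //.
have := le_trans (cmodD_le (rect g a m c n + rect g a m n d)
  (rect g m b c n + rect g m b n d)) (lerD (cmodD_le _ _) (cmodD_le _ _)).
have key (X q1 q2 q3 q4 : R) : 4 * q1 < X -> 4 * q2 < X -> 4 * q3 < X ->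
  X <= q1 + q2 + (q3 + q4) -> X <= 4 * q4 by clear; move=> *; lra.
by rewrite -E; exact: key h1 h2 h3.
Qed.

Lemma affine_border (k l z0 : R[i]) a b c d : a <= b -> c <= d ->
  on_border (ccont (fun z => k + l * (z - z0))) a b c d /\
  rect (fun z => k + l * (z - z0)) a b c d = 0.
Proof.
move=> ab cd.
have D z : cdiff (fun z => k + l * (z - z0)) z l.
  move=> e e0; exists 1 => // h _; rewrite [X in cmod X](_ : _ = 0) ?cmod0.
    by rewrite mulr_ge0 ?cmod_ge0// ltW.
  by ring.
have C : on_border (ccont (fun z => k + l * (z - z0))) a b c d.
  by move=> x y _ _ _; apply: cdiff_ccont; exact: D.
split => //; apply: (@rect_ftc (fun z => k * z + l / 2 * (z - z0) ^+ 2)) => //.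
move=> x y _ _ _; set z := x +i* y.
move=> e e0; pose L := cmod (l / 2) + 1.
have L0 : 0 < L by rewrite ltr_wpDl ?cmod_ge0.
exists (e / L); first by rewrite divr_gt0.
move=> h; rewrite ltr_pdivlMr// => hL.
have -> : k * (z + h) + l / 2 * (z + h - z0) ^+ 2 -
    (k * z + l / 2 * (z - z0) ^+ 2) - (k + l * (z - z0)) * h = l / 2 * h * h.
  by field.
rewrite [leLHS]cmodM ler_wpM2r ?cmod_ge0// cmodM; apply: le_trans (ltW hL).
by rewrite mulrC ler_wpM2l ?cmod_ge0// lerDl.
Qed.

(** Goursat's bisection. After n steps the integral is at most 4^n times that over a rectangle of
    size S / 2^n. Near the limit point g is affine up to e' |z - z0|; affine functions integrate to
    0, and the error is of order e' (S / 2^n)^2. *)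
Lemma goursat g a b c d : a <= b -> c <= d ->
  on_rect (fun z => exists k, cdiff g z k) a b c d -> rect g a b c d = 0.
Proof.
move=> ab cd D.
have C : on_rect (ccont g) a b c d.
  by move=> x y hx hy; have [k /cdiff_ccont] := D x y hx hy.
pose ok (q : R * R * R * R) := let: (a', b', c', d') := q in
  [/\ a' <= b', c' <= d', a <= a', b' <= b & c <= c' /\ d' <= d].
pose size1 (q : R * R * R * R) := let: (a', b', c', d') := q in b' - a'.
pose size2 (q : R * R * R * R) := let: (a', b', c', d') := q in d' - c'.
pose I (q : R * R * R * R) := let: (a', b', c', d') := q in rect g a' b' c' d'.
pose inc (q q' : R * R * R * R) := let: (a1, b1, c1, d1) := q in
  let: (a2, b2, c2, d2) := q' in [/\ a1 <= a2, b2 <= b1, c1 <= c2 & d2 <= d1].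
have /choice[F HF] : forall q, exists q', ok q -> [/\ ok q', inc q q',
    size1 q' = size1 q / 2, size2 q' = size2 q / 2 & cmod (I q) <= 4 * cmod (I q')].
  move=> [[[a1 b1] c1] d1].
  have [|nok] := pselect (ok (a1, b1, c1, d1)); last by exists (a1, b1, c1, d1).
  move=> [ab1 cd1 aa1 bb1 [cc1 dd1]].
  have [|[[[a2 b2] c2] d2] [[h1 h2 h3 h4] h5 h6 h7]] := rect_bisect ab1 cd1 (_ : on_rect (ccont g) a1 b1 c1 d1).
    exact: on_rectS C.
  exists (a2, b2, c2, d2) => _; split => //.
  split; [lra|lra|exact: le_trans h1|exact: le_trans bb1|].
  by split; [exact: le_trans h3|exact: le_trans dd1].
pose Q n := iter n F (a, b, c, d).
have okQ n : ok (Q n).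
  by elim: n => [|n IH]; [split|rewrite /Q iterS; case: (HF _ IH)].
have incQ n m : inc (Q n) (Q (m + n)%N).
  elim: m => [|m IH]; first by rewrite add0n; case: (Q n) => [[[]]].
  rewrite addSn; have [_ + _ _ _] := HF _ (okQ (m + n)%N); rewrite -/(Q _.+1).
  move: IH; rewrite -[F (Q _)]/(Q (m + n).+1).
  case: (Q n) => [[[a1 b1] c1] d1]; case: (Q (m + n)%N) => [[[a2 b2] c2] d2].
  case: (Q (m + n).+1) => [[[a3 b3] c3] d3] [h1 h2 h3 h4] [h5 h6 h7 h8].
  by split; lra.
have sQ n : size1 (Q n) = (b - a) / 2 ^+ n /\ size2 (Q n) = (d - c) / 2 ^+ n.
  elim: n => [|n [IH1 IH2]]; first by rewrite expr0 !divr1.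
  have [_ _ h1 h2 _] := HF _ (okQ n).
  by rewrite -[F (Q n)]/(Q n.+1) in h1 h2; rewrite h1 h2 IH1 IH2 exprS !invfM; split; ring.
have IQ n : cmod (rect g a b c d) <= 4 ^+ n * cmod (I (Q n)).
  elim: n => [|n IH]; first by rewrite expr0 mul1r.
  have [_ _ _ _ h] := HF _ (okQ n); rewrite -[F (Q n)]/(Q n.+1) in h.
  rewrite (le_trans IH)// exprS [4 * _]mulrC -mulrA ler_wpM2l// exprn_ge0//.
pose A n := (Q n).1.1.1; pose B n := (Q n).1.1.2.
pose A' n := (Q n).1.2; pose B' n := (Q n).2.
have AB n m : A n <= B m /\ A' n <= B' m.
  have := incQ n (m - n)%N; have := incQ m (n - m)%N.
  rewrite (_ : (m - n + n)%N = maxn n m); last by lia.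
  rewrite (_ : (n - m + m)%N = maxn n m); last by lia.
  have := okQ (maxn n m); rewrite /A /B /A' /B'.
  case: (Q n) => [[[a1 b1] c1] d1]; case: (Q m) => [[[a2 b2] c2] d2].
  case: (Q (maxn n m)) => [[[a3 b3] c3] d3] [? ? ? ? [? ?]] [? ? ? ?] [? ? ? ?] /=.
  by split; lra.
pose x := sup (range A); pose y := sup (range A').
have xA n : A n <= x <= B n.
  rewrite ub_le_sup/=; [|by exists (B 0%N) => _ [m _ <-]; case: (AB m 0%N)|by exists n].
  by apply: ge_sup; [exists (A 0%N), 0%N|move=> _ [m _ <-]; case: (AB m n)].
have yA n : A' n <= y <= B' n.
  rewrite ub_le_sup/=; [|by exists (B' 0%N) => _ [m _ <-]; case: (AB m 0%N)|by exists n].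
  by apply: ge_sup; [exists (A' 0%N), 0%N|move=> _ [m _ <-]; case: (AB m n)].
have [k Dk] := D x y (xA 0%N) (yA 0%N).
set z0 := x +i* y in Dk.
pose S := (b - a) + (d - c).
have S0 : 0 <= S by rewrite /S; lra.
apply: cmod_small_eq0 => e e0.
(* Chosen for the final estimate 4^n * 2 e' (S / 2^n)^2 = 2 e' S^2. *)
pose e' := e / (2 * S * S + 1).
have S10 : 0 < 2 * S * S + 1 by rewrite ltr_wpDl// mulr_ge0// mulr_ge0.
have e'0 : 0 < e' by rewrite divr_gt0.
have [r r0 Hr] := Dk _ e'0.
have [n Hn] : exists n : nat, S / r < 2 ^+ n.
  by exists (Num.bound (S / r)); apply: upper_nthrootP.
have p2 : 0 < (2 : R) ^+ n by rewrite exprn_gt0.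
have Sr : S / 2 ^+ n < r by rewrite ltr_pdivrMr// mulrC -ltr_pdivrMr.
have [s1 s2] := sQ n; have okn := okQ n; have xn := xA n; have yn := yA n.
apply: (le_trans (IQ n)).
move: s1 s2 okn xn yn; rewrite /A /B /A' /B'.
case: (Q n) => [[[a1 b1] c1] d1]; rewrite -[I _]/(rect g a1 b1 c1 d1).
rewrite -[size1 _]/(b1 - a1) -[size2 _]/(d1 - c1).
rewrite -[(_, _, _, _).1.1.1]/a1 -[(_, _, _, _).1.1.2]/b1.
rewrite -[(_, _, _, _).1.2]/c1 -[(_, _, _, _).2]/d1.
move=> s1 s2 [ab1 cd1 aa1 bb1 [cc1 dd1]] xn yn.
have [aff aff0] := affine_border (g z0) k z0 ab1 cd1.
have Cg : on_border (ccont g) a1 b1 c1 d1 by apply: on_rect_border; exact: on_rectS C.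
have -> : rect g a1 b1 c1 d1 = rect (fun z => g z - (g z0 + k * (z - z0))) a1 b1 c1 d1.
  by rewrite rectB// aff0 subr0.
have dist x1 y1 : a1 <= x1 <= b1 -> c1 <= y1 <= d1 ->
    cmod ((x1 +i* y1) - z0) <= S / 2 ^+ n.
  move=> hx hy; rewrite (le_trans (cmod_le_ReIm _))// /S mulrDl -s1 -s2 /z0 /=.
  clear -hx hy xn yn; apply: lerD; rewrite ler_norml; lra.
have Cd : on_border (ccont (fun z => g z - (g z0 + k * (z - z0)))) a1 b1 c1 d1.
  move=> x1 y1 hx hy hb; apply: ccontB; first exact: Cg.
  exact: aff.
have bound : on_border (fun z => cmod (g z - (g z0 + k * (z - z0))) <=
    e' * (S / 2 ^+ n)) a1 b1 c1 d1.
  move=> x1 y1 hx hy _; have dz := dist x1 y1 hx hy.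
  have := Hr (x1 +i* y1 - z0) (le_lt_trans dz Sr).
  rewrite addrCA subrr addr0 => h.
  have -> : g (x1 +i* y1) - (g z0 + k * (x1 +i* y1 - z0)) =
    g (x1 +i* y1) - g z0 - k * (x1 +i* y1 - z0) by ring.
  by rewrite (le_trans h)// ler_wpM2l// ltW.
have := rect_le ab1 cd1 Cd bound; rewrite s1 s2 -mulrDl -/S => h.
apply: (@le_trans _ _ (4 ^+ n * (2 * (e' * (S / 2 ^+ n)) * (S / 2 ^+ n)))).
  by rewrite ler_wpM2l// exprn_ge0.
have -> : 4 ^+ n * (2 * (e' * (S / 2 ^+ n)) * (S / 2 ^+ n)) = e' * (2 * S * S).
  have -> : (4 : R) = 2 * 2 by ring.
  by rewrite exprMn; field; rewrite gt_eqF.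
rewrite /e' mulrAC ler_pdivrMr// ler_wpM2l ?ltW//; lra.
Qed.

(** Cauchy's theorem with one point at which g is only continuous: cutting around z0 leaves a square
    of half side t, whose integral is O(t). It is meant for difference quotients at z0. *)
Lemma rect_hole g a b c d (z0 : R[i]) :
  a < complex.Re z0 < b -> c < complex.Im z0 < d ->
  on_rect (ccont g) a b c d ->
  on_rect (fun z => z != z0 -> exists k, cdiff g z k) a b c d ->
  rect g a b c d = 0.
Proof.
case: z0 => x0 y0 /= /andP[ax xb] /andP[cy yd] C D.
apply: cmod_small_eq0 => e e0.
have Cz : ccont g (x0 +i* y0) by apply: C; rewrite !ltW.
have [r r0 Hr] := Cz _ ltr01.
pose M := cmod (g (x0 +i* y0)) + 1.
have M0 : 0 < M by rewrite ltr_wpDl// cmod_ge0.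
have [t t0 [ta tb tc td [tr te]]] : exists2 t, 0 < t &
    [/\ a <= x0 - t, x0 + t <= b, c <= y0 - t, y0 + t <= d &
        2 * t < r /\ 8 * M * t <= e].
  (* The square must fit into the rectangle, lie where |g - g z0| <= 1, and satisfy 8 M t <= e, the
     bound that [rect_le] gives for half side t. *)
  have [|t t0] := @exists_pos_below R [:: x0 - a; b - x0; y0 - c; d - y0;
      r / 3; e / (8 * M)].
    by rewrite /= !subr_gt0 ax xb cy yd !divr_gt0// mulr_gt0.
  rewrite /= => /and5P[h1 h2 h3 h4 /and3P[h5 h6 _]].
  exists t => //; split; [lra|lra|lra|lra|split; [lra|]].
  by rewrite mulrC -ler_pdivlMr// mulr_gt0.
have B a' b' c' d' : a <= a' -> b' <= b -> c <= c' -> d' <= d ->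
    on_border (ccont g) a' b' c' d'.
  by move=> *; apply: on_rect_border; apply: on_rectS C.
have Z a' b' c' d' : a <= a' -> b' <= b -> c <= c' -> d' <= d ->
    a' <= b' -> c' <= d' ->
    (forall x y, a' <= x <= b' -> c' <= y <= d' -> ~ (x = x0 /\ y = y0)) ->
    rect g a' b' c' d' = 0.
  move=> h1 h2 h3 h4 h5 h6 nz; apply: goursat => // x y hx hy.
  apply: (on_rectS h1 h2 h3 h4 D) => //.
  by apply/eqP => -[? ?]; apply: (nz x y).
have E : rect g a b c d = rect g (x0 - t) (x0 + t) (y0 - t) (y0 + t).
  have [x1 x2] : x0 - t < x0 /\ x0 < x0 + t by clear -t0; split; lra.
  have [y1 y2] : y0 - t < y0 /\ y0 < y0 + t by clear -t0; split; lra.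
  move: ta tb tc td x1 x2 y1 y2.
  move: (x0 - t) (x0 + t) (y0 - t) (y0 + t) => xl xr yl yr.
  move=> ta tb tc td x1 x2 y1 y2.
  have xlr : xl <= xr := ltW (lt_trans x1 x2).
  have ylr : yl <= yr := ltW (lt_trans y1 y2).
  have axr := le_trans ta xlr; have xlb := le_trans xlr tb.
  have cyr := le_trans tc ylr; have yld := le_trans ylr td.
  have cd := le_trans tc yld.
  rewrite (@rect_splitx g a xl b c d)//; [|by apply: B|by apply: B].
  rewrite [rect g a xl c d]Z//; last first.
    move=> x y /andP[_ h] _ [h3 _]; move: h; rewrite h3 leNgt x1//.
  rewrite add0r (@rect_splitx g xl xr b c d)//; [|by apply: B|by apply: B].
  rewrite [rect g xr b c d]Z//; last first.
    move=> x y /andP[h _] _ [h3 _]; move: h; rewrite h3 leNgt x2//.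
  rewrite addr0 (@rect_splity g xl xr c yl d)//; [|by apply: B|by apply: B].
  rewrite [rect g xl xr c yl]Z//; last first.
    move=> x y _ /andP[_ h] [_ h3]; move: h; rewrite h3 leNgt y1//.
  rewrite add0r (@rect_splity g xl xr yl yr d)//; [|by apply: B|by apply: B].
  rewrite [rect g xl xr yr d]Z ?addr0//.
  by move=> x y _ /andP[h _] [_ h3]; move: h; rewrite h3 leNgt y2.
rewrite E; apply: le_trans te.
have -> : 8 * M * t = 2 * M * ((x0 + t - (x0 - t)) + (y0 + t - (y0 - t))).
  by clear; ring.
have [h1 h2] : x0 - t <= x0 + t /\ y0 - t <= y0 + t by clear -t0; split; lra.
apply: rect_le => //; first by apply: B.
move=> x y hx hy _.
have : cmod ((x +i* y) - (x0 +i* y0)) < r.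
  apply: le_lt_trans tr; rewrite (le_trans (cmod_le_ReIm _))//=.
  rewrite (_ : 2 * t = t + t); last by ring.
  by clear -hx hy; apply: lerD; rewrite ler_norml; lra.
move=> /Hr; rewrite addrCA subrr addr0 => h.
rewrite -[g (x +i* y)](subrK (g (x0 +i* y0))) (le_trans (cmodD_le _ _))//.
by rewrite /M addrC lerD2l.
Qed.

End rectangle_integral.

(** * Rules for complex derivatives *)

Lemma is_derive_mul (K : numFieldType) (f g : K -> K) (z d1 d2 : K) :
  is_derive (z : K^o) 1 (f : K^o -> K^o) d1 ->
  is_derive (z : K^o) 1 (g : K^o -> K^o) d2 ->
  is_derive (z : K^o) 1 ((fun w => f w * g w) : K^o -> K^o) (d1 * g z + f z * d2).
Proof.
move=> H1 H2.
apply: (@is_derive_eq _ _ _ _ _ _ _ _ (is_deriveM H1 H2)).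
by rewrite addrC [g z *: _]mulrC.
Qed.

Lemma is_derive_inv (K : numFieldType) (f : K -> K) (z d : K) : f z != 0 ->
  is_derive (z : K^o) 1 (f : K^o -> K^o) d ->
  is_derive (z : K^o) 1 ((fun w => (f w)^-1) : K^o -> K^o) (- (f z) ^- 2 * d).
Proof.
move=> fz [Df E]; split; first exact: derivableV.
by rewrite deriveV// E.
Qed.

Lemma cdiffM (R : realType) (f g : R[i] -> R[i]) (z d1 d2 : R[i]) :
  cdiff f z d1 -> cdiff g z d2 ->
  cdiff (fun w => f w * g w) z (d1 * g z + f z * d2).
Proof.
move=> /is_derive_cdiff H1 /is_derive_cdiff H2.
have H := @is_derive_mul R[i] f g z d1 d2 H1 H2.
have {}H := (is_derive_cdiff _ _ _).1 H.
exact: H.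
Qed.

Lemma cdiffV (R : realType) (f : R[i] -> R[i]) (z d : R[i]) :
  f z != 0 -> cdiff f z d -> cdiff (fun w => (f w)^-1) z (- (f z) ^- 2 * d).
Proof.
move=> fz /is_derive_cdiff H.
by apply/is_derive_cdiff; exact: (@is_derive_inv R[i] f z d fz H).
Qed.

Lemma cdiff_translation (R : realType) (z w : R[i]) : cdiff (fun v => v - w) z 1.
Proof.
move=> e e0; exists 1 => // h _; rewrite [X in cmod X](_ : _ = 0); last by ring.
by rewrite cmod0 mulr_ge0 ?cmod_ge0// ltW.
Qed.

Lemma cdiff_id (R : realType) (z : R[i]) : cdiff id z 1.
Proof.
have := @cdiff_translation R z 0.
by rewrite (_ : (fun v => v - 0) = id)//; apply/funext => v; rewrite subr0.
Qed.

Lemma cdiffZ (R : realType) (c : R[i]) (f : R[i] -> R[i]) (z d : R[i]) :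
  cdiff f z d -> cdiff (fun v => c * f v) z (c * d).
Proof.
move=> H; have C : cdiff (fun=> c) z 0.
  move=> e e0; exists 1 => // h _.
  by rewrite subrr mul0r subr0 cmod0 mulr_ge0 ?cmod_ge0// ltW.
by have := cdiffM C H; rewrite mul0r add0r.
Qed.

Lemma cdiff_subc (R : realType) (c : R[i]) (f : R[i] -> R[i]) (z d : R[i]) :
  cdiff f z d -> cdiff (fun v => f v - c) z d.
Proof.
by move=> H e /H[r r0 Hr]; exists r => // h /Hr; rewrite opprB addrA subrK.
Qed.

Lemma cdiffX (R : realType) (n : nat) (z : R[i]) :
  cdiff (fun v => v ^+ n) z (n%:R * z ^+ n.-1).
Proof.
elim: n => [|n IH].
  move=> e e0; exists 1 => // h _.
  by rewrite !mul0r subrr subr0 cmod0 mulr_ge0 ?cmod_ge0// ltW.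
have := cdiffM (cdiff_translation z 0) IH.
rewrite subr0 mul1r /=.
have -> : z ^+ n + z * (n%:R * z ^+ n.-1) = n.+1%:R * z ^+ n.
  case: n {IH} => [|n] /=; first by rewrite mul0r mulr0 addr0 mulr1n mul1r.
  by rewrite mulrCA -exprS [n.+2%:R]mulrS mulrDl mul1r.
by under eq_fun do rewrite subr0 -exprS.
Qed.

Lemma cdiff_local (R : realType) (f g : R[i] -> R[i]) (z d : R[i]) (r : R) :
  0 < r -> (forall h, cmod h < r -> f (z + h) = g (z + h)) ->
  cdiff f z d -> cdiff g z d.
Proof.
move=> r0 fg H e /H[s s0 Hs]; exists (Num.min r s); first by rewrite lt_min r0.
move=> h; rewrite lt_min => /andP[hr /Hs]; rewrite -(fg h hr).
by have := fg 0; rewrite addr0 cmod0 => <-.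
Qed.

Lemma cdiff_div (R : realType) (f : R[i] -> R[i]) (z d w : R[i]) : z != w ->
  cdiff f z d -> exists k, cdiff (fun v => f v / (v - w)) z k.
Proof.
move=> zw H; eexists; apply: (cdiffM H); apply: (cdiffV _ (cdiff_translation z w)).
by rewrite subr_eq0.
Qed.

(** * Cauchy's formula on squares and the Taylor expansion *)

Section cauchy.
Context {R : realType}.
Implicit Types (f g : R[i] -> R[i]) (r x y : R) (z w : R[i]).

Definition sq g r : R[i] := rect g (- r) r (- r) r.

Definition on_sq (P : R[i] -> Prop) r := on_border P (- r) r (- r) r.

(** The boundary of the square of half side r lies outside the open disc of radius r, so a condition
    on it can be checked for |z| >= r. *)
Lemma on_sqP (P : R[i] -> Prop) r : 0 < r ->
  (forall z, r <= cmod z -> P z) -> on_sq P r.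
Proof.
move=> r0 H x y hx hy hb; apply: H.
have Ax : `|x| <= cmod (x +i* y) := normRe_le_cmod (x +i* y).
have Ay : `|y| <= cmod (x +i* y) := normIm_le_cmod (x +i* y).
case/or4P: hb => /eqP E.
- by apply: le_trans Ax; rewrite E normrN gtr0_norm.
- by apply: le_trans Ax; rewrite E gtr0_norm.
- by apply: le_trans Ay; rewrite E normrN gtr0_norm.
- by apply: le_trans Ay; rewrite E gtr0_norm.
Qed.

Lemma eq_rect_border f g (a b c d : R) : a <= b -> c <= d ->
  on_border (fun z => f z = g z) a b c d -> rect f a b c d = rect g a b c d.
Proof.
move=> ab cd H.
have K y : (y = c) \/ (y = d) -> hseg f y a b = hseg g y a b.
  move=> yE; apply: eq_cint => t; rewrite inE/= in_itv/=.
  exact: (on_border_h cd H yE).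
have K' x : (x = a) \/ (x = b) -> vseg f x c d = vseg g x c d.
  move=> xE; apply: eq_cint => t; rewrite inE/= in_itv/=.
  exact: (on_border_v ab H xE).
by rewrite /rect !K ?K'; [|left|right|right|left].
Qed.

Lemma border_bounded g (a b c d : R) : a <= b -> c <= d ->
  on_border (ccont g) a b c d ->
  exists M, on_border (fun z => cmod (g z) <= M) a b c d.
Proof.
move=> ab cd H.
have Kh y : (y = c) \/ (y = d) -> exists M, forall t, a <= t <= b ->
    cmod (g (y%:C * 'i + t%:C * 1)) <= M.
  move=> yE; apply: ccont_seg_bounded => //; first exact: cmod1.
  by move=> t; exact: (on_border_h cd H yE).
have Kv x : (x = a) \/ (x = b) -> exists M, forall t, c <= t <= d ->
    cmod (g (x%:C + t%:C * 'i)) <= M.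
  move=> xE; apply: ccont_seg_bounded => //; first exact: cmod_i.
  by move=> t; exact: (on_border_v ab H xE).
have [M1 H1] := Kh c (or_introl erefl); have [M2 H2] := Kh d (or_intror erefl).
have [M3 H3] := Kv a (or_introl erefl); have [M4 H4] := Kv b (or_intror erefl).
exists (Num.max (Num.max M1 M2) (Num.max M3 M4)) => x y hx hy.
rewrite !le_max => /or4P[] /eqP E.
- by move: (H3 y hy); rewrite vpointE -E => ->; rewrite !orbT.
- by move: (H4 y hy); rewrite vpointE -E => ->; rewrite !orbT.
- by move: (H1 x hx); rewrite hpointE -E => ->.
- by move: (H2 x hx); rewrite hpointE -E => ->; rewrite !orbT.
Qed.

(** The difference quotient of f at z, completed by the derivative, is continuous at z and
    differentiable elsewhere, so its integral vanishes by [rect_hole]. *)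
Lemma cauchy_sq f r z : (forall w, exists k, cdiff f w k) -> cmod z < r ->
  sq (fun w => f w / (w - z)) r = f z * sq (fun w => (w - z)^-1) r.
Proof.
move=> Df zr; have r0 : 0 < r := le_lt_trans (cmod_ge0 z) zr.
have rr : - r <= r by clear -r0; lra.
have [k Dk] := Df z.
pose g w := if w == z then k else (f w - f z) / (w - z).
have ne w : r <= cmod w -> w != z.
  by move=> rw; apply/eqP => E; move: rw; rewrite E leNgt zr.
have Dq w : w != z -> exists l, cdiff g w l.
  move=> wz; have [l Hl] := Df w.
  have [l' Hl'] := cdiff_div wz (cdiff_subc (f z) Hl).
  exists l'; have wz0 : 0 < cmod (w - z) by rewrite cmod_gt0 subr_eq0.
  apply: cdiff_local Hl'; first exact: wz0.
  move=> h hwz; rewrite /g; case: eqP => // E; exfalso.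
  by move: hwz; rewrite -E opprD addrA subrr sub0r cmodN ltxx.
have Cg w : ccont g w.
  have [->|wz] := eqVneq w z; last by have [l /cdiff_ccont] := Dq w wz.
  move=> e e0; have [s s0 Hs] := Dk _ e0; exists s => // h hs.
  rewrite {2}/g eqxx /g; case: eqP => [_|/eqP E].
    by rewrite subrr cmod0 ltW.
  have h0 : h != 0 by apply: contraNN E => /eqP ->; rewrite addr0.
  rewrite -(ler_pM2r (_ : 0 < cmod h)) ?cmod_gt0// -cmodM.
  apply: le_trans (Hs h hs); rewrite le_eqVlt; apply/orP; left; apply/eqP.
  by congr cmod; rewrite [z + h]addrC addrK; field.
have G0 : sq g r = 0.
  case: z zr @g Dk ne Dq Cg => x0 y0 zr g Dk ne Dq Cg.
  have h1 := le_lt_trans (normRe_le_cmod _) zr.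
  have h2 := le_lt_trans (normIm_le_cmod _) zr.
  apply: (@rect_hole _ g _ _ _ _ (x0 +i* y0)).
  - by rewrite -ltr_norml.
  - by rewrite -ltr_norml.
  - by move=> *; exact: Cg.
  - by move=> x y _ _; exact: Dq.
have Cq (h : R[i] -> R[i]) : (forall w, exists k, cdiff h w k) ->
    on_border (ccont (fun w => h w / (w - z))) (- r) r (- r) r.
  move=> Dh; apply: on_sqP => // w /ne wz.
  have [l Hl] := Dh w; have [l' Hl'] := cdiff_div wz Hl.
  exact: cdiff_ccont Hl'.
have C1 : on_border (ccont (fun w => (w - z)^-1)) (- r) r (- r) r.
  apply: on_sqP => // w /ne wz; apply: cdiff_ccont.
  by apply: cdiffV; [rewrite subr_eq0|exact: cdiff_translation].
have C2 : on_border (ccont (fun w => f z * (w - z)^-1)) (- r) r (- r) r.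
  apply: on_sqP => // w /ne wz; apply: cdiff_ccont; apply: cdiffZ.
  by apply: cdiffV; [rewrite subr_eq0|exact: cdiff_translation].
rewrite /sq -rectZ//; apply/eqP; rewrite -subr_eq0 -rectB//; last exact: Cq.
apply/eqP; rewrite -[RHS]G0; apply: eq_rect_border => //.
apply: on_sqP => // w /ne wz; rewrite /g (negbTE wz) mulrBl.
by [].
Qed.

(** The Taylor coefficient times the integral of 1 / w, which is divided out in
    [entire_local_series]. *)
Definition cauchy_coeff f r k : R[i] := sq (fun w => f w / w ^+ k.+1) r.

Lemma cauchy_expand f r z (M : R) : (forall w, exists k, cdiff f w k) ->
  cmod z < r -> 0 <= M -> on_sq (fun w => cmod (f w) <= M) r ->
  (forall k, cmod (cauchy_coeff f r k) <= 8 * M * r ^- k) /\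
  (csummable (fun k => cauchy_coeff f r k * z ^+ k) /\
   csum (fun k => cauchy_coeff f r k * z ^+ k) = sq (fun w => f w / (w - z)) r).
Proof.
set a := cauchy_coeff f r; move=> Df zr M0 fM; have r0 : 0 < r := le_lt_trans (cmod_ge0 z) zr.
have rr : - r <= r by clear -r0; lra.
have z0 := cmod_ge0 z.
have ne w : r <= cmod w -> w != z.
  by move=> rw; apply/eqP => E; move: rw; rewrite E leNgt zr.
have ne0 w : r <= cmod w -> w != 0.
  by move=> rw; rewrite -cmod_gt0 (lt_le_trans r0).
have D1 w k : r <= cmod w -> exists l, cdiff (fun w => f w / w ^+ k) w l.
  move=> /ne0 w0; have [l Hl] := Df w; eexists; apply: cdiffM; first exact: Hl.
  apply: cdiffV; first by rewrite expf_neq0.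
  exact: cdiffX.
have D2 w k : r <= cmod w -> exists l, cdiff (fun w => f w / w ^+ k / (w - z)) w l.
  by move=> h; have [l Hl] := D1 w k h; apply: cdiff_div Hl; exact: ne.
have C1 k : on_sq (ccont (fun w => f w / w ^+ k)) r.
  by apply: on_sqP => // w /(D1 w k)[l]; exact: cdiff_ccont.
have C2 k : on_sq (ccont (fun w => f w / w ^+ k / (w - z))) r.
  by apply: on_sqP => // w /(D2 w k)[l]; exact: cdiff_ccont.
have bd1 k : on_sq (fun w => cmod (f w / w ^+ k) <= M * r ^- k) r.
  move=> x y hx hy hb; have fb := fM x y hx hy hb.
  have rw : r <= cmod (x +i* y) by have := @on_sqP (fun w => r <= cmod w) r r0 (fun w h => h) x y hx hy hb.
  rewrite cmodM cmodV cmodX ler_pM ?cmod_ge0 ?invr_ge0 ?exprn_ge0 ?cmod_ge0//.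
  by rewrite lef_pV2 ?posrE ?exprn_gt0 ?(lt_le_trans r0)// lerXn2r ?nnegrE ?cmod_ge0// ltW.
have bda k : cmod (a k) <= 8 * M * r ^- k.
  have := rect_le rr rr (C1 k.+1) (bd1 k.+1); rewrite -/(a k) => h.
  apply: (le_trans h); rewrite le_eqVlt; apply/orP; left; apply/eqP.
  have r0' : r != 0 by rewrite gt_eqF.
  have rk : r ^+ k != 0 by rewrite expf_neq0.
  by rewrite exprS; field; rewrite r0' rk.
split => //.
pose q := cmod z / r.
have q0 : 0 <= q by rewrite divr_ge0// ltW.
have q1 : q < 1 by rewrite ltr_pdivrMr// mul1r.
have sa : csummable (fun k => a k * z ^+ k).
  apply: (@csummable_bound _ _ (fun k => 8 * M * q ^+ k)).
    move=> k; rewrite cmodM cmodX.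
    have -> : 8 * M * q ^+ k = 8 * M * r ^- k * cmod z ^+ k.
      by rewrite /q expr_div_n; ring.
    by apply: ler_wpM2r => //; exact: exprn_ge0.
  by rewrite nneseries_geometricZ ?q0//= ltry.
split => //.
(* Exact remainder of the finite geometric expansion of 1 / (w - z) in powers of z / w; it is O((|z|
   / r)^N). *)
have rem N : sq (fun w => f w / (w - z)) r - \sum_(i < N) a i * z ^+ i =
    z ^+ N * sq (fun w => f w / w ^+ N / (w - z)) r.
  elim: N => [|N IH].
    rewrite big_ord0 subr0 expr0 mul1r; apply: eq_rect => w.
    by rewrite expr0 divr1.
  rewrite big_ord_recr/= opprD addrA IH [a N * _]mulrC -mulrBr exprSr -mulrA.
  congr (_ * _); rewrite /sq -rectB// -?rectZ//; [|exact: C2|exact: C2|exact: C1].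
  apply: eq_rect_border => //; apply: on_sqP => // w h.
  have w0 := ne0 w h; have wz := ne w h; rewrite -subr_eq0 in wz.
  by rewrite exprS; field; rewrite w0 wz expf_neq0.
apply: csum_unique => // e e0.
pose K := 8 * r * (M / (r - cmod z)).
have K0 : 0 <= K.
  by rewrite mulr_ge0 ?(mulr_ge0 _ (ltW r0))// divr_ge0// subr_ge0 ltW.
have remb N : cmod (z ^+ N * sq (fun w => f w / w ^+ N / (w - z)) r) <= K * q ^+ N.
  rewrite cmodM cmodX.
  have bd2 : on_sq (fun w => cmod (f w / w ^+ N / (w - z)) <= M * r ^- N / (r - cmod z)) r.
    move=> x y hx hy hb; have := bd1 N x y hx hy hb; rewrite [X in X -> _]/= => b1.
    have rw : r <= cmod (x +i* y) by have := @on_sqP (fun w => r <= cmod w) r r0 (fun w h => h) x y hx hy hb.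
    rewrite cmodM cmodV ler_pM ?cmod_ge0 ?invr_ge0 ?cmod_ge0//.
    rewrite lef_pV2 ?posrE ?cmod_gt0 ?subr_eq0 ?subr_gt0//; last exact: ne.
    by apply: le_trans (cmodB_ge _ _); rewrite lerB.
  have := rect_le rr rr (C2 N) bd2; rewrite -[rect _ _ _ _ _]/(sq _ r) => h.
  apply: (@le_trans _ _ (cmod z ^+ N * (2 * (M * r ^- N / (r - cmod z)) * (r - - r + (r - - r))))).
    by rewrite ler_wpM2l// exprn_ge0.
  rewrite le_eqVlt; apply/orP; left; apply/eqP.
  rewrite /K /q expr_div_n; field.
  by rewrite expf_neq0 ?gt_eqF// subr_gt0.
have sK : (\sum_(0 <= n <oo) (K * q ^+ n)%:E < +oo)%E.
  by rewrite nneseries_geometricZ ?q0//= ltry.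
have [|N HN] := nneseries_tail_small _ sK e0.
  by move=> n; rewrite lee_fin mulr_ge0// exprn_ge0.
exists N => m Nm; rewrite rem (le_trans (remb m))// -lee_fin.
apply: le_trans (HN m Nm).
rewrite -nneseries_addn; last by move=> n; rewrite lee_fin mulr_ge0// exprn_ge0.
rewrite (@nneseriesD1 _ _ 0)//; last first.
  by move=> n _; rewrite lee_fin mulr_ge0// exprn_ge0.
rewrite add0n leeDl// nneseries_ge0// => n _ _.
by rewrite lee_fin mulr_ge0// exprn_ge0.
Qed.

Lemma Rintegral_itv_cst (a b c : R) : a <= b ->
  lebesgue_measure.-integrable [set` `[a, b]] (EFin \o (fun=> c)) /\
  \int[@lebesgue_measure R]_(t in [set` `[a, b]]) c = c * (b - a).
Proof.
move=> ab; split.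
  apply/integrableP; split; first exact: measurable_cst.
  rewrite integral_cst//= lebesgue_measure_itv/=.
  by case: ifP => _; rewrite ?mule0// -EFinB -EFinM ltry.
have E : fine (@lebesgue_measure R [set` `[a, b]]) = b - a.
  rewrite lebesgue_measure_itv/= lte_fin.
  move: ab; rewrite le_eqVlt => /predU1P[->|->]; last by rewrite -EFinB.
  by rewrite ltxx subrr.
by rewrite -E -Rintegral_cst.
Qed.

Lemma le_cst_Rintegral (f : R -> R) (a b c : R) : a <= b ->
  lebesgue_measure.-integrable [set` `[a, b]] (EFin \o f) ->
  (forall t, a <= t <= b -> c <= f t) ->
  c * (b - a) <= \int[@lebesgue_measure R]_(t in [set` `[a, b]]) f t.
Proof.
move=> ab If cf; have [Ic <-] := Rintegral_itv_cst c ab.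
by apply: le_Rintegral.
Qed.

Lemma Rintegral_le_cst (f : R -> R) (a b c : R) : a <= b ->
  lebesgue_measure.-integrable [set` `[a, b]] (EFin \o f) ->
  (forall t, a <= t <= b -> f t <= c) ->
  \int[@lebesgue_measure R]_(t in [set` `[a, b]]) f t <= c * (b - a).
Proof.
move=> ab If cf; have [Ic <-] := Rintegral_itv_cst c ab.
by apply: le_Rintegral.
Qed.

(* Only the nonvanishing of this integral is needed, not its value 2 pi i. *)
Lemma sq_inv_neq0 r : 0 < r -> sq (fun w => w^-1) r != 0.
Proof.
move=> r0; have rr : - r <= r by clear -r0; lra.
have C : on_sq (ccont (fun w => w^-1)) r.
  apply: on_sqP => // w rw; apply: cdiff_ccont; apply: (@cdiffV _ id _ 1).
    by rewrite -cmod_gt0 (lt_le_trans r0).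
  exact: cdiff_id.
have q t s : - r <= t <= r -> s ^+ 2 = r ^+ 2 ->
    (2 * r)^-1 <= r / (t ^+ 2 + s ^+ 2).
  move=> tr ->; have t2 : t ^+ 2 <= r ^+ 2.
    by rewrite -[t ^+ 2]real_normK ?num_real// lerXn2r ?nnegrE ?(ltW r0)// ler_norml.
  have d0 : 0 < t ^+ 2 + r ^+ 2 by rewrite ltr_wpDl ?sqr_ge0 ?exprn_gt0.
  rewrite ler_pdivlMr// mulrC ler_pdivrMr ?mulr_gt0//; nra.
have h1 : 1 <= complex.Im (hseg (fun w => w^-1) (- r) (- r) r).
  have [_ I] := seg_integrable (cmod1 R) (fun t ht => on_border_h rr C (or_introl erefl) ht).
  have -> : 1 = (2 * r)^-1 * (r - - r) by field; rewrite gt_eqF.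
  apply: le_cst_Rintegral => // t tr; rewrite hpointE /= mulNr opprK.
  by apply: q => //; rewrite sqrrN.
have h2 : complex.Im (hseg (fun w => w^-1) r (- r) r) <= - 1.
  have [_ I] := seg_integrable (cmod1 R) (fun t ht => on_border_h rr C (or_intror erefl) ht).
  have -> : - 1 = - (2 * r)^-1 * (r - - r) by field; rewrite gt_eqF.
  apply: Rintegral_le_cst => // t tr; rewrite hpointE /= lerN2.
  exact: q.
have h3 : 1 <= complex.Re (vseg (fun w => w^-1) r (- r) r).
  have [I _] := seg_integrable (cmod_i R) (fun t ht => on_border_v rr C (or_intror erefl) ht).
  have -> : 1 = (2 * r)^-1 * (r - - r) by field; rewrite gt_eqF.
  apply: le_cst_Rintegral => // t tr; rewrite vpointE /= addrC.
  exact: q.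
have h4 : complex.Re (vseg (fun w => w^-1) (- r) (- r) r) <= - 1.
  have [I _] := seg_integrable (cmod_i R) (fun t ht => on_border_v rr C (or_introl erefl) ht).
  have -> : - 1 = - (2 * r)^-1 * (r - - r) by field; rewrite gt_eqF.
  apply: Rintegral_le_cst => // t tr; rewrite vpointE /= mulNr lerN2 addrC.
  by apply: q => //; rewrite sqrrN.
apply/eqP => E; have : complex.Im (sq (fun w => w^-1) r) = 0 by rewrite E.
rewrite /sq /rect; move: h1 h2 h3 h4.
move: (hseg _ _ _ _) (hseg _ _ _ _) (vseg _ _ _ _) (vseg _ _ _ _).
by move=> [x1 y1] [x2 y2] [x3 y3] [x4 y4] /=; rewrite mul0r add0r mul1r; clear; lra.
Qed.

Lemma sq_inv_pow r k : 0 < r -> sq (fun w => 1 / w ^+ k.+2) r = 0.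
Proof.
move=> r0; have rr : - r <= r by clear -r0; lra.
have w0 w : r <= cmod w -> w != 0 by move=> h; rewrite -cmod_gt0 (lt_le_trans r0).
have k0 : (k.+1%:R : R[i]) != 0 by rewrite pnatr_eq0.
have D w : w != 0 ->
    cdiff (fun w => - k.+1%:R^-1 * (w ^+ k.+1)^-1) w (1 / w ^+ k.+2).
  move=> wn; have := cdiffZ (- k.+1%:R^-1) (cdiffV (_ : (fun v => v ^+ k.+1) w != 0) (cdiffX k.+1 w)).
  rewrite expf_neq0// => /(_ isT) /=.
  have -> // : - k.+1%:R^-1 * (- (w ^+ k.+1) ^- 2 * (k.+1%:R * w ^+ k)) = 1 / w ^+ k.+2.
  move: (k.+1%:R : R[i]) k0 => m k0.
  by rewrite !exprS expr0; field; rewrite wn k0 expf_neq0.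
have D2 w : w != 0 -> ccont (fun w => 1 / w ^+ k.+2) w.
  move=> wn; apply: cdiff_ccont; apply: (@cdiffZ _ 1); apply: cdiffV.
    by rewrite expf_neq0.
  exact: cdiffX.
apply: (@rect_ftc _ (fun w => - k.+1%:R^-1 * (w ^+ k.+1)^-1)) => //.
  by apply: on_sqP => // w /w0; exact: D2.
by apply: on_sqP => // w /w0; exact: D.
Qed.

(** The expansion of the constant function 1: by [sq_inv_pow] only the term k = 0 survives. *)
Lemma sq_inv_shift r z : cmod z < r ->
  sq (fun w => (w - z)^-1) r = sq (fun w => w^-1) r.
Proof.
move=> zr; have r0 : 0 < r := le_lt_trans (cmod_ge0 z) zr.
have D1 w : exists k, cdiff (fun=> 1 : R[i]) w k.
  exists 0 => e e0; exists 1 => // h _.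
  by rewrite subrr mul0r subr0 cmod0 mulr_ge0 ?cmod_ge0// ltW.
have M1 : on_sq (fun w => cmod (1 : R[i]) <= 1) r by move=> x y *; rewrite cmod1.
have [_ [s1 e1]] := @cauchy_expand (fun=> 1) r z 1 D1 zr ler01 M1.
rewrite [RHS](_ : _ = sq (fun w => 1 / w ^+ 1) r); last first.
  by apply: eq_rect => w; rewrite expr1 mul1r.
rewrite [LHS](_ : _ = sq (fun w => 1 / (w - z)) r); last first.
  by apply: eq_rect => w; rewrite mul1r.
rewrite -e1 csum_recl// expr0 mulr1 [X in _ + X](_ : _ = 0) ?addr0//.
rewrite -[RHS]csum0; apply: eq_csum => k.
by rewrite /cauchy_coeff sq_inv_pow// mul0r.
Qed.

Lemma entire_local_series f r : (forall w, exists k, cdiff f w k) -> 0 < r ->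
  exists a : nat -> R[i], exists2 M, (forall k, cmod (a k) <= M * r ^- k) &
    forall z, cmod z < r -> csummable (fun k => a k * z ^+ k) /\
      f z = csum (fun k => a k * z ^+ k).
Proof.
move=> Df r0; have rr : - r <= r by clear -r0; lra.
have [M0 HM0] : exists M, on_sq (fun w => cmod (f w) <= M) r.
  apply: border_bounded => // x y _ _ _.
  by have [k /cdiff_ccont] := Df (x +i* y).
pose M := `|M0|; have M_ge0 : 0 <= M by exact: normr_ge0.
have HM : on_sq (fun w => cmod (f w) <= M) r.
  by move=> x y h1 h2 h3; apply: (le_trans (HM0 x y h1 h2 h3)); exact: ler_norm.
pose J := sq (fun w => w^-1) r; have J0 : J != 0 := sq_inv_neq0 r0.
exists (fun k => J^-1 * cauchy_coeff f r k).
exists (cmod J^-1 * (8 * M)).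
  have r1 : cmod (0 : R[i]) < r by rewrite cmod0.
  have [h _] := @cauchy_expand f r 0 M Df r1 M_ge0 HM.
  by move=> k; rewrite cmodM -mulrA ler_wpM2l// cmod_ge0.
move=> z zr; have [_ [s e]] := @cauchy_expand f r z M Df zr M_ge0 HM.
have sE : (fun k => J^-1 * cauchy_coeff f r k * z ^+ k) =
    (fun k => J^-1 * (cauchy_coeff f r k * z ^+ k)).
  by apply/funext => k; rewrite mulrA.
rewrite sE; split; first exact: csummableZ.
by rewrite csumZ// e cauchy_sq// sq_inv_shift// mulrCA mulVf// mulr1.
Qed.

(** The constant term vanishes by letting z tend to 0 along the positive reals; off 0 the series can
    then be divided by z, and the argument repeats. Restricting to |z| <= r / 2 bounds the terms by
    a geometric series of ratio 1/2. *)
Lemma series_coeff_eq0 (b : nat -> R[i]) (M r : R) : 0 < r ->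
  (forall k, cmod (b k) <= M * r ^- k) ->
  (forall z, z != 0 -> cmod z < r -> csum (fun k => b k * z ^+ k) = 0) ->
  forall k, b k = 0.
Proof.
move=> r0 bM bz k.
have summ (c : nat -> R[i]) (K : R) z : (forall k, cmod (c k) <= K * r ^- k) ->
    cmod z <= r / 2 -> csummable (fun k => c k * z ^+ k) /\
    cmod (csum (fun k => c k * z ^+ k)) <= K * 2.
  move=> cK zr; have K0 : 0 <= K.
    by have := le_trans (cmod_ge0 _) (cK 0%N); rewrite expr0 invr1 mulr1.
  apply: (@csum_le_bound _ _ (fun k => K * 2^-1 ^+ k)).
    move=> n; rewrite cmodM cmodX.
    apply: (@le_trans _ _ (K * r ^- n * (r / 2) ^+ n)).
      by rewrite ler_pM ?cmod_ge0 ?exprn_ge0 ?cmod_ge0// lerXn2r// nnegrE ?cmod_ge0// divr_ge0// ltW.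
    rewrite expr_div_n exprVn le_eqVlt; apply/orP; left; apply/eqP; field.
    by rewrite !expf_neq0// gt_eqF.
  by rewrite nneseries_halves.
have shift c K : (forall k, cmod (c k) <= K * r ^- k) ->
    (forall z, z != 0 -> cmod z < r / 2 -> csum (fun k => c k * z ^+ k) = 0) ->
    c 0%N = 0 /\ (forall k, cmod (c k.+1) <= K / r * r ^- k) /\
    (forall z, z != 0 -> cmod z < r / 2 -> csum (fun k => c k.+1 * z ^+ k) = 0).
  move=> cK cz.
  have cK' n : cmod (c n.+1) <= K / r * r ^- n.
    by have := cK n.+1; rewrite exprS invfM mulrA.
  have rec z : z != 0 -> cmod z < r / 2 ->
      c 0%N + z * csum (fun k => c k.+1 * z ^+ k) = 0.
    move=> z0 zr;
    have [s1 _] := summ c K z cK (ltW zr).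
    have [s2 _] := summ (fun k => c k.+1) _ z cK' (ltW zr).
    rewrite -[RHS](cz z z0 zr) [RHS]csum_recl// expr0 mulr1 -csumZ//; congr (_ + _).
    by apply: eq_csum => n; rewrite exprS mulrCA.
  have c0 : c 0%N = 0.
    apply: cmod_small_eq0 => e e0.
    have K0 : 0 <= K.
      by have := le_trans (cmod_ge0 _) (cK 0%N); rewrite expr0 invr1 mulr1.
    have Kr : 0 <= K / r * 2 by rewrite mulr_ge0// divr_ge0// ltW.
    have [|t t0 /= /and3P[t1 t2 _]] := @exists_pos_below R [:: r / 3; e / (K / r * 2 + 1)].
      by rewrite /= !divr_gt0// ltr_wpDl.
    have tc : cmod t%:C = t by rewrite cmod_real gtr0_norm.
    have tz : t%:C != 0 :> R[i] by rewrite -cmod_gt0 tc.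
    have tr : cmod t%:C < r / 2 by rewrite tc; clear -t1 r0; lra.
    have := rec _ tz tr; have [_] := summ (fun k => c k.+1) _ t%:C cK' (ltW tr).
    move=> h /eqP; rewrite addr_eq0 => /eqP ->; rewrite cmodN cmodM tc.
    apply: (@le_trans _ _ (t * (K / r * 2 + 1))).
      by rewrite ler_wpM2l ?(ltW t0)// (le_trans h)// lerDl.
    by rewrite -ler_pdivlMr// ltr_wpDl.
  split => //; split => // z z0 zr; have := rec z z0 zr.
  by rewrite c0 add0r => /eqP; rewrite mulf_eq0 (negbTE z0) => /eqP.
have {}bz z : z != 0 -> cmod z < r / 2 -> csum (fun k => b k * z ^+ k) = 0.
  by move=> z0 zr; apply: bz => //; clear -zr r0; lra.
elim: k b M bM bz => [|k IH] b M bM bz; first by have [] := shift b M bM bz.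
have [_ [h1 h2]] := shift b M bM bz.
exact: (IH (fun k => b k.+1) (M / r)).
Qed.

(** Infinite radius of convergence, in the form of Cauchy's estimates. *)
Definition entire_coeffs (a : nat -> R[i]) : Prop :=
  forall r, 0 < r -> exists M, forall k, cmod (a k) * r ^+ k <= M.

Lemma entire_coeffs_bound (a : nat -> R[i]) (r : R) : entire_coeffs a -> 0 < r ->
  exists2 M, 0 <= M & forall z, cmod z <= r ->
    (forall k, cmod (a k * z ^+ k) <= M * 2^-1 ^+ k).
Proof.
move=> Ea r0; have r20 : 0 < r * 2 by rewrite mulr_gt0.
have [M HM] := Ea _ r20.
exists M; first by apply: le_trans (HM 0%N); rewrite mulr_ge0 ?cmod_ge0 ?exprn_ge0 ?ltW.
move=> z zr k; rewrite cmodM cmodX.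
apply: (@le_trans _ _ (cmod (a k) * r ^+ k)).
  by rewrite ler_wpM2l ?cmod_ge0// lerXn2r// nnegrE ?cmod_ge0// ltW.
have -> : cmod (a k) * r ^+ k = cmod (a k) * (r * 2) ^+ k * 2^-1 ^+ k.
  by rewrite -mulrA -exprMn mulfK// pnatr_eq0.
by rewrite ler_wpM2r ?exprn_ge0 ?invr_ge0.
Qed.

Lemma entire_csummable (a : nat -> R[i]) z : entire_coeffs a ->
  csummable (fun k => a k * z ^+ k).
Proof.
move=> Ea; have [|M M0 HM] := @entire_coeffs_bound a (cmod z + 1) Ea.
  by rewrite ltr_wpDl ?cmod_ge0.
apply: (csummable_bound (HM z _)); first by rewrite lerDl.
by rewrite nneseries_halves ltry.
Qed.

(** The expansions obtained on squares of different sizes agree on the unit disc, hence have the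
    same coefficients, and those of r = 1 represent f everywhere. *)
Theorem entire_power_series f : entire f ->
  exists2 a, entire_coeffs a & forall z, f z = csum (fun k => a k * z ^+ k).
Proof.
move=> Ef; have Df w : exists k, cdiff f w k by exact/derivable_cdiff/Ef.
have /choice[A HA] : forall r : R, exists a : nat -> R[i], 0 < r ->
    exists2 M, (forall k, cmod (a k) <= M * r ^- k) &
    forall z, cmod z < r -> csummable (fun k => a k * z ^+ k) /\
      f z = csum (fun k => a k * z ^+ k).
  move=> r; have [r0|r0] := ltP 0 r.
    by have [a Ha] := entire_local_series Df r0; exists a.
  by exists (fun=> 0).
have same r : 1 <= r -> A r = A 1.
  move=> r1; have r0 : 0 < r by apply: lt_le_trans r1.
  have [M1 B1 S1] := HA _ r0; have [M2 B2 S2] := HA _ ltr01.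
  apply/funext => k; apply/eqP; rewrite -subr_eq0; apply/eqP.
  apply: (@series_coeff_eq0 (fun k => A r k - A 1 k) (`|M1| + M2) 1) => //.
    move=> n; rewrite expr1n invr1 mulr1 (le_trans (cmodB_le _ _))// lerD//.
      rewrite (le_trans (B1 n))// (le_trans (ler_norm _))// normrM ler_piMr//.
      by rewrite ger0_norm ?invr_ge0 ?exprn_ge0 ?(ltW r0)// invf_le1 ?exprn_gt0// exprn_ege1.
    by have := B2 n; rewrite expr1n invr1 mulr1.
  move=> z z0 z1; have [s1 e1] := S1 _ (lt_le_trans z1 r1); have [s2 e2] := S2 _ z1.
  under eq_csum do rewrite mulrBl.
  by rewrite csumB// -e1 -e2 subrr.
exists (A 1).
  move=> r r0; pose s := Num.max r 1.
  have s1 : 1 <= s by rewrite le_max lexx orbT.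
  have s0 : 0 < s := lt_le_trans ltr01 s1.
  have [M HM _] := HA _ s0; exists M => k.
  rewrite -(same s s1); have := HM k; rewrite ler_pdivlMr ?exprn_gt0//.
  apply: le_trans; rewrite ler_wpM2l ?cmod_ge0// lerXn2r ?nnegrE ?(ltW r0) ?(ltW s0)//.
  by rewrite le_max lexx.
move=> z; pose s := cmod z + 1.
have s1 : 1 <= s by rewrite lerDr cmod_ge0.
have [_ _ H] := HA _ (lt_le_trans ltr01 s1).
have [|_ ->] := H z; first by rewrite ltrDl.
by rewrite same.
Qed.

End cauchy.

(** * Entire power series and division by z - l *)

Section power_series.
Context {R : realType}.
Implicit Types (a b : nat -> R[i]) (z w : R[i]).

Definition pser a z : R[i] := csum (fun k => a k * z ^+ k).

Lemma entire_coeffsD a b : entire_coeffs a -> entire_coeffs b ->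
  entire_coeffs (fun n => a n + b n).
Proof.
move=> Ea Eb r r0; have [M HM] := Ea _ r0; have [K HK] := Eb _ r0.
exists (M + K) => k; rewrite (le_trans _ (lerD (HM k) (HK k)))//.
by rewrite -mulrDl ler_wpM2r ?cmodD_le// exprn_ge0// ltW.
Qed.

Lemma entire_coeffsZ c a : entire_coeffs a -> entire_coeffs (fun n => c * a n).
Proof.
move=> Ea r r0; have [M HM] := Ea _ r0; exists (cmod c * M) => k.
by rewrite cmodM -mulrA ler_wpM2l ?cmod_ge0.
Qed.

Lemma pserD a b z : entire_coeffs a -> entire_coeffs b ->
  pser (fun n => a n + b n) z = pser a z + pser b z.
Proof.
move=> Ea Eb; rewrite /pser -csumD; [|exact: entire_csummable..].
by apply: eq_csum => k; rewrite mulrDl.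
Qed.

Lemma pserZ c a z : entire_coeffs a -> pser (fun n => c * a n) z = c * pser a z.
Proof.
move=> Ea; rewrite /pser -csumZ; last exact: entire_csummable.
by apply: eq_csum => k; rewrite mulrA.
Qed.

Lemma pser_bound a (r : R) : entire_coeffs a -> 0 < r ->
  exists2 M, 0 <= M & forall z, cmod z <= r -> cmod (pser a z) <= M.
Proof.
move=> Ea r0; have [M M0 HM] := entire_coeffs_bound Ea r0.
exists (M * 2) => [|z zr]; first by rewrite mulr_ge0.
have [] := @csum_le_bound _ _ _ (M * 2) (HM z zr); last by [].
by rewrite nneseries_halves.
Qed.

(** The numbers g n are the coefficients of (f z - f l) / (z - l); the identity follows from the
    recursion g n = a n.+1 + l g n.+1. *)
Lemma division a l : entire_coeffs a ->
  let g n := csum (fun j => a (n + j).+1 * l ^+ j) in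
  entire_coeffs g /\ forall z, pser a z - pser a l = (z - l) * pser g z.
Proof.
move=> Ea g.
(* For s >= s0 one has |l| <= s / 2, so that the series for g n is dominated by a geometric one of
   ratio 1/2. *)
pose s0 := 2 * cmod l + 1.
have l0 := cmod_ge0 l.
have s00 : 0 < s0 by rewrite ltr_wpDl ?mulr_ge0.
have bound s : s0 <= s -> exists2 M, 0 <= M & forall n,
    csummable (fun j => a (n + j).+1 * l ^+ j) /\ cmod (g n) <= M * s ^- n.
  move=> ss; have sp : 0 < s := lt_le_trans s00 ss.
  have [M HM] := Ea _ sp.
  have M0 : 0 <= M by apply: le_trans (HM 0%N); rewrite mulr_ge0 ?cmod_ge0// exprn_ge0// ltW.
  exists (M / s * 2); first by rewrite mulr_ge0// divr_ge0// ltW.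
  move=> n; apply: (@csum_le_bound _ _ (fun j => M / s * s ^- n * 2^-1 ^+ j)).
    move=> j; rewrite cmodM cmodX.
    have h1 : cmod (a (n + j).+1) <= M * s ^- (n + j).+1.
      by rewrite ler_pdivlMr ?exprn_gt0.
    have h2 : cmod l ^+ j <= (s / 2) ^+ j.
      rewrite lerXn2r ?nnegrE// ?divr_ge0 ?(ltW sp)//.
      by rewrite ler_pdivlMr//; move: ss; rewrite /s0; clear; lra.
    rewrite (le_trans (ler_pM (cmod_ge0 _) (exprn_ge0 _ l0) h1 h2))//.
    rewrite expr_div_n exprS exprD le_eqVlt; apply/orP; left; apply/eqP.
    by rewrite -exprVn; field; rewrite !expf_neq0 ?gt_eqF.
  by rewrite nneseries_halves lee_fin mulrAC.
have sg n : csummable (fun j => a (n + j).+1 * l ^+ j).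
  by have [M _ HM] := bound s0 (lexx _); case: (HM n).
have Eg : entire_coeffs g.
  move=> r r0; have [|M M0 HM] := bound (Num.max r s0); first by rewrite le_max lexx orbT.
  exists M => k; have [_] := HM k.
  have mp : 0 < Num.max r s0 by rewrite lt_max r0.
  rewrite ler_pdivlMr ?exprn_gt0//; apply: le_trans.
  by rewrite ler_wpM2l ?cmod_ge0// lerXn2r ?nnegrE ?(ltW r0) ?(ltW mp)// le_max lexx.
split => // z.
have rec n : g n = a n.+1 + l * g n.+1.
  rewrite {1}/g csum_recl// addn0 expr0 mulr1; congr (_ + _).
  rewrite -csumZ//; apply: eq_csum => j.
  by rewrite addnS addSn exprS mulrCA.
have al : pser a l = a 0%N + l * g 0%N.
  rewrite /pser csum_recl; last exact: entire_csummable.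
  rewrite expr0 mulr1 -csumZ//; congr (_ + _); apply: eq_csum => j.
  by rewrite add0n exprS mulrCA.
have sgz := entire_csummable z Eg.
have saz := entire_csummable z Ea.
rewrite mulrBl.
have -> : z * pser g z = csum (fun n => g n * z ^+ n.+1).
  by rewrite /pser -csumZ//; apply: eq_csum => n; rewrite exprS mulrCA.
have -> : l * pser g z = l * g 0%N + csum (fun n => l * g n.+1 * z ^+ n.+1).
  rewrite /pser csum_recl// expr0 mulr1 mulrDr -csumZ; last exact: (csummable_behead sgz).
  by congr (_ + _); apply: eq_csum => n; rewrite mulrA.
have -> : pser a z = a 0%N + csum (fun n => a n.+1 * z ^+ n.+1).
  by rewrite /pser csum_recl// expr0 mulr1.
have s1 : csummable (fun n => g n * z ^+ n.+1).
  have := csummableZ z sgz; congr csummable; apply/funext => n.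
  by rewrite exprS mulrCA.
have s2 : csummable (fun n => l * g n.+1 * z ^+ n.+1).
  have := csummableZ l (csummable_behead sgz); congr csummable; apply/funext => n.
  by rewrite mulrA.
have -> : csum (fun n => a n.+1 * z ^+ n.+1) =
    csum (fun n => g n * z ^+ n.+1) - csum (fun n => l * g n.+1 * z ^+ n.+1).
  by rewrite -csumB//; apply: eq_csum => n; rewrite [g n]rec; ring.
by rewrite al; ring.
Qed.

(** Dividing twice gives f (l + h) - f l = h g l + h^2 g2 (l + h) with g2 locally bounded, so the
    derivative is g l. *)
Lemma pser_entire a : entire_coeffs a -> entire (pser a).
Proof.
move=> Ea l; apply/derivable_cdiff.
have [/=] := division l Ea; set g := fun n => csum _ => Eg Hg.
have [/=] := division l Eg; set g2 := fun n => csum _ => Eg2 Hg2.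
exists (pser g l) => e e0.
have l1 : 0 < cmod l + 1 by rewrite ltr_wpDl ?cmod_ge0.
have [M M0 HM] := pser_bound Eg2 l1.
exists (Num.min 1 (e / (M + 1))); first by rewrite lt_min ltr01 divr_gt0// ltr_wpDl.
move=> h; rewrite lt_min ltr_pdivlMr ?ltr_wpDl// => /andP[h1 h2].
have E : l + h - l = h by rewrite addrAC subrr add0r.
rewrite Hg E [pser g l * h]mulrC -mulrBr Hg2 E !cmodM mulrC ler_wpM2r ?cmod_ge0//.
have lh : cmod (l + h) <= cmod l + 1 by rewrite (le_trans (cmodD_le _ _))// lerD2l ltW.
have := HM _ lh.
have := cmod_ge0 h; have := cmod_ge0 (pser g2 (l + h)).
by move: h2; clear; nra.
Qed.

Definition monomial (n : nat) : nat -> R[i] := fun k => if k == n then 1 else 0.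

Lemma monomial_coeffs n : entire_coeffs (monomial n).
Proof.
move=> r r0; exists (r ^+ n) => k; rewrite /monomial; case: eqP => [->|_].
  by rewrite cmod1 mul1r.
by rewrite cmod0 mul0r exprn_ge0// ltW.
Qed.

Lemma pser_monomial n z : pser (monomial n) z = z ^+ n.
Proof.
rewrite /pser -[RHS](csum_delta n); apply: eq_csum => k; rewrite /monomial.
by case: eqP => [->|_]; rewrite ?mul1r ?mul0r.
Qed.

End power_series.

(** * Orthogonality of monomials for radial weights *)

Section rotation.
Context {R : realType}.
Notation mR := (measurableTypeR R).
Notation leb := (@lebesgue_measure R).

Lemma measurable_shift (c : R) : measurable_fun [set: mR] (fun x : mR => (x + c : mR)).
Proof. by apply: measurable_funD => //; exact: measurable_cst. Qed.

(** The image of Lebesgue measure under the translation has the right value on intervals, and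
    Lebesgue measure is determined by these. *)
Lemma integral_shift (c : R) (F : mR -> \bar R) : measurable_fun setT F ->
  (forall x, (0 <= F x)%E) ->
  (\int[leb]_x F (x + c)%R = \int[leb]_x F x)%E.
Proof.
move=> mF F0.
have ms := measurable_shift c.
rewrite -[LHS](@ge0_integral_pushforward _ _ mR mR R _ ms leb setT F)//.
apply: eq_measure_integral => A mA _; apply/esym.
apply: lebesgue_measure_unique => // X [[a b] _ <-].
transitivity (leb [set` `]a - c, b - c]]); last first.
  congr (leb _); apply/seteqP; split => x /=;
    by rewrite !in_itv/= ltrBlDr lerBrDr.
rewrite /= !lebesgue_measure_itv/= !lte_fin ltrD2r; case: ifP => // _.
by rewrite -!EFinD; congr (_%:E); ring.
Qed.

Notation mu := (@planar_lebesgue R).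
Notation RR := (mR * mR)%type.

Definition shear1 (t : R) (p : RR) : RR := (p.1 + t * p.2, p.2).
Definition shear2 (t : R) (p : RR) : RR := (p.1, p.2 + t * p.1).

Lemma measurable_shear1 t : measurable_fun setT (shear1 t).
Proof.
apply: measurable_fun_pair; last exact: measurable_snd.
apply: measurable_funD; first exact: measurable_fst.
by apply: measurable_funM; [exact: measurable_cst|exact: measurable_snd].
Qed.

Lemma measurable_shear2 t : measurable_fun setT (shear2 t).
Proof.
apply: measurable_fun_pair; first exact: measurable_fst.
apply: measurable_funD; first exact: measurable_snd.
by apply: measurable_funM; [exact: measurable_cst|exact: measurable_fst].
Qed.

(** For fixed y the shear is a translation in x, so Tonelli reduces the claim to
    [integral_shift]. *)
Lemma integral_shear1 t (F : RR -> \bar R) : measurable_fun setT F ->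
  (forall p, (0 <= F p)%E) -> (\int[mu]_p F (shear1 t p) = \int[mu]_p F p)%E.
Proof.
move=> mF F0.
have mFs := measurableT_comp mF (measurable_shear1 t).
have E1 := fubini_tonelli2 (m1 := leb) (m2 := leb) (F \o shear1 t) mFs (fun p => F0 _).
have E2 := fubini_tonelli2 (m1 := leb) (m2 := leb) F mF F0.
refine (etrans E1 (etrans _ (esym E2))).
apply: eq_integral => y _; rewrite /fubini_G/= /shear1/=.
rewrite (@integral_shift (t * y) (fun x => F (x, y)))//.
exact: measurableT_comp mF (measurable_pair2 y).
Qed.

Lemma integral_shear2 t (F : RR -> \bar R) : measurable_fun setT F ->
  (forall p, (0 <= F p)%E) -> (\int[mu]_p F (shear2 t p) = \int[mu]_p F p)%E.
Proof.
move=> mF F0.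
have mFs := measurableT_comp mF (measurable_shear2 t).
have E1 := fubini_tonelli1 (m1 := leb) (m2 := leb) (F \o shear2 t) mFs (fun p => F0 _).
have E2 := fubini_tonelli1 (m1 := leb) (m2 := leb) F mF F0.
refine (etrans E1 (etrans _ (esym E2))).
apply: eq_integral => x _; rewrite /fubini_F/= /shear2/=.
rewrite (@integral_shift (t * x) (fun y => F (x, y)))//.
exact: measurableT_comp mF (measurable_pair1 x).
Qed.

(* The rotation of angle arctan (4/3), as a product of three shears. *)
Definition rot (p : RR) : RR := (shear1 (- 2^-1) (shear2 (4 / 5) (shear1 (- 2^-1) p))).

Definition rot_unit : R[i] := (3 / 5) +i* (4 / 5).

Lemma to_complex_rot p : to_complex (rot p) = rot_unit * to_complex p.
Proof.
case: p => x y; rewrite /to_complex /rot /shear1 /shear2 /rot_unit /=.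
by simpc; congr (_ +i* _); field.
Qed.

Lemma ge0_integral_rot (F : RR -> \bar R) : measurable_fun setT F ->
  (forall p, (0 <= F p)%E) -> (\int[mu]_p F (rot p) = \int[mu]_p F p)%E.
Proof.
move=> mF F0.
have m1 := measurableT_comp mF (measurable_shear1 (- 2^-1)).
have m2 := measurableT_comp m1 (measurable_shear2 (4 / 5)).
rewrite (@integral_shear1 _ (fun p => F (shear1 (- 2^-1) (shear2 (4 / 5) p))))//.
by rewrite (@integral_shear2 _ (fun p => F (shear1 (- 2^-1) p)))// integral_shear1.
Qed.

Lemma integrable_rot (F : RR -> \bar R) : mu.-integrable setT F ->
  (\int[mu]_p F (rot p) = \int[mu]_p F p)%E.
Proof.
move=> IF; have mF := measurable_int mu IF.
rewrite integralE [RHS]integralE; congr (_ - _)%E.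
  rewrite -(ge0_integral_rot (measurable_funepos mF) (funepos_ge0 F)).
  by apply: eq_integral => p _; rewrite !funeposE.
rewrite -(ge0_integral_rot (measurable_funeneg mF) (funeneg_ge0 F)).
by apply: eq_integral => p _; rewrite !funenegE.
Qed.

(* The numerator of the imaginary part is 4 modulo 5, so rot_unit is not a root of 1. *)
Lemma rot_unit_pow (k : nat) :
  exists2 A : int, complex.Im (rot_unit ^+ k.+1) = A%:~R / 5 ^+ k.+1 & (A %% 5)%Z = 4.
Proof.
suff [A [B [h1 h2 h3 h4]]] : exists A B : int, [/\
    complex.Re (rot_unit ^+ k.+1) = A%:~R / 5 ^+ k.+1,
    complex.Im (rot_unit ^+ k.+1) = B%:~R / 5 ^+ k.+1,
    (A %% 5)%Z = 3 & (B %% 5)%Z = 4] by exists B.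
elim: k => [|k [A [B [h1 h2 h3 h4]]]].
  by exists 3, 4; rewrite !expr1 /rot_unit/=; split.
exists (3 * A - 4 * B), (4 * A + 3 * B).
have p5 : (5 : R) ^+ k.+1 != 0 by rewrite expf_neq0.
rewrite [rot_unit ^+ k.+2]exprS Re_mulc Im_mulc h1 h2 /rot_unit /=; split.
- by rewrite [_ ^+ k.+2]exprS rmorphB !rmorphM/=; field.
- by rewrite [_ ^+ k.+2]exprS rmorphD !rmorphM/=; field.
- by lia.
- by lia.
Qed.

Lemma rot_unit_pow_neq1 k : rot_unit ^+ k.+1 != 1.
Proof.
have [A h1 h2] := rot_unit_pow k; apply/eqP => E.
move: h1; rewrite E /= => /esym/eqP; rewrite mulf_eq0 invr_eq0 expf_eq0/=.
rewrite pnatr_eq0/= orbF intr_eq0 => /eqP A0.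
by rewrite A0 in h2.
Qed.

Lemma cmod_rot_unit : cmod rot_unit = 1.
Proof.
rewrite cmodE /rot_unit/= (_ : _ + _ = 1) ?sqrtr1//.
by field.
Qed.

End rotation.

(** * Parseval's identity for radial weights *)

Section parseval.
Context {R : realType}.
Notation mR := (measurableTypeR R).
Notation RR := (mR * mR)%type.
Notation mu := (@planar_lebesgue R).
Implicit Types (a b : nat -> R[i]) (z w : R[i]).

Lemma cmeasurable_to_complex : cmeasurable setT (fun p : RR => to_complex p).
Proof. by split; [exact: measurable_fst|exact: measurable_snd]. Qed.

Lemma measurable_cmod_to_complex :
  measurable_fun setT (fun p : RR => cmod (to_complex p)).
Proof. exact/measurable_cmod/cmeasurable_to_complex. Qed.

Lemma csum_cvg (f : nat -> R[i]) : csummable f ->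
  complex.Re (\sum_(i < n) f i) @[n --> \oo] --> complex.Re (csum f) /\
  complex.Im (\sum_(i < n) f i) @[n --> \oo] --> complex.Im (csum f).
Proof.
move=> sf; split; apply/cvgrPdist_le => e e0; have [N HN] := csum_approx sf e0;
  exists N => // n; rewrite /mkset => Nn; apply: le_trans (HN n Nn).
  by rewrite -Re_oppc -Re_addc normRe_le_cmod.
by rewrite -Im_oppc -Im_addc normIm_le_cmod.
Qed.

Lemma cmeasurable_poly a n :
  cmeasurable setT (fun p : RR => \sum_(i < n) a i * to_complex p ^+ i).
Proof.
apply: (@cmeasurable_sum _ _ _ _ (fun i p => a i * to_complex p ^+ i)) => i.
apply: cmeasurableM; first exact: cmeasurable_cst.
exact/cmeasurableX/cmeasurable_to_complex.
Qed.

Lemma cmeasurable_pser a : entire_coeffs a ->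
  cmeasurable setT (fun p : RR => pser a (to_complex p)).
Proof.
move=> Ea.
split.
  apply: (@measurable_fun_cvg _ _ _ _
    (fun n (p : RR) => complex.Re (\sum_(i < n) a i * to_complex p ^+ i))).
    by move=> n; case: (cmeasurable_poly a n).
  by move=> p _; case: (csum_cvg (entire_csummable (to_complex p) Ea)).
apply: (@measurable_fun_cvg _ _ _ _
    (fun n (p : RR) => complex.Im (\sum_(i < n) a i * to_complex p ^+ i))).
  by move=> n; case: (cmeasurable_poly a n).
by move=> p _; case: (csum_cvg (entire_csummable (to_complex p) Ea)).
Qed.

Lemma csum_sqr_cvg (f : nat -> R[i]) : csummable f ->
  cmod (\sum_(i < n) f i) ^+ 2 @[n --> \oo] --> cmod (csum f) ^+ 2.
Proof.
move=> sf; have [h1 h2] := csum_cvg sf.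
rewrite cmod_sqr; under eq_fun do rewrite cmod_sqr.
by apply: cvgD; apply: cvgM.
Qed.

(** Invariance under the rotation [rot_unit], of infinite order, is what makes z^n and z^m
    orthogonal for n <> m; the bound by 1 gives integrability on discs. *)
Definition radial (W : R[i] -> R) : Prop :=
  [/\ forall z, 0 <= W z <= 1,
      measurable_fun setT (fun p : RR => W (to_complex p)) &
      forall z, W (rot_unit * z) = W z].

Definition moment (W : R[i] -> R) n : \bar R :=
  (\int[mu]_p (cmod (to_complex p) ^+ (2 * n) * W (to_complex p))%:E)%E.

Lemma moment_ge0 W n : radial W -> (0 <= moment W n)%E.
Proof.
move=> [W0 _ _]; apply: integral_ge0 => p _; rewrite lee_fin mulr_ge0//.
  by rewrite exprn_ge0// cmod_ge0.
by case/andP: (W0 (to_complex p)).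
Qed.

Lemma radial_mul_annulus W k : radial W ->
  radial (fun z => W z * ((k%:R <= cmod z < k.+1%:R)%R)%:R).
Proof.
move=> [W0 mW Wr]; split.
- by move=> z; case: (_ <= _ < _); rewrite ?mulr1 ?mulr0 ?lexx ?ler01.
- apply: measurable_funM => //.
  rewrite (_ : (fun p => _) = fun p : RR => if (k%:R <= cmod (to_complex p)) &&
     (cmod (to_complex p) < k.+1%:R) then (1 : R) else 0); last first.
    by apply/funext => p; case: ifP.
  have mc := measurable_cmod_to_complex.
  apply: measurable_fun_ifT; [|exact: measurable_cst..].
  apply: measurable_and.
    by apply: measurable_fun_ler => //; exact: measurable_cst.
  by apply: measurable_fun_ltr => //; exact: measurable_cst.
- by move=> z; rewrite Wr cmodM cmod_rot_unit mul1r.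
Qed.

Lemma measurable_disc (r : R) : measurable [set p : RR | cmod (to_complex p) <= r].
Proof.
have := measurable_cmod_to_complex measurableT (measurable_itv `]-oo, r]).
by congr (measurable _); apply/seteqP; split => p /=; rewrite in_itv; [case|split].
Qed.

(** Comparison with the circumscribed square. *)
Lemma disc_area (r : R) : 0 <= r ->
  (mu [set p : RR | (cmod (to_complex p) <= r)%R] <= (4 * r ^+ 2)%:E)%E.
Proof.
move=> r0; pose I : set mR := [set` `[- r, r]].
have mI : measurable I by exact: measurable_itv.
have mII : measurable (I `*` I) by exact: measurableX.
have E : mu (I `*` I) = (4 * r ^+ 2)%:E.
  transitivity (@lebesgue_measure R I * @lebesgue_measure R I)%E.
    exact: product_measure1E.
  rewrite /I lebesgue_measure_itv/= lte_fin.
  case: ifPn => [_|]; first by rewrite -EFinB -EFinM; congr (_%:E); ring.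
  rewrite -leNgt mul0e => h; have -> : r = 0 by lra.
  by rewrite expr0n mulr0.
rewrite -E; apply: le_measure; rewrite ?inE//.
  exact: measurable_disc.
move=> p /= pr; split; rewrite /I /= in_itv/= -ler_norml.
  exact: le_trans (normRe_le_cmod (to_complex p)) pr.
exact: le_trans (normIm_le_cmod (to_complex p)) pr.
Qed.

Lemma radial_integrable W (r : R) : radial W -> 0 <= r ->
  (forall z, r < cmod z -> W z = 0) ->
  mu.-integrable setT (fun p => (W (to_complex p))%:E).
Proof.
move=> [W0 mW _] r0 Wr; apply/integrableP; split; first exact/measurable_EFinP.
pose D := [set p : RR | cmod (to_complex p) <= r].
have mD : measurable D := measurable_disc r.
apply: (@le_lt_trans _ _ (\int[mu]_p (\1_D p)%:E)%E).
  apply: ge0_le_integral => //.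
  - apply/measurable_EFinP/measurableT_comp => //.
  - by apply/measurable_EFinP/measurable_indic.
  move=> p _; rewrite /= lee_fin; have /andP[w0 w1] := W0 (to_complex p).
  rewrite ger0_norm// indicE; have [pr|pr] := leP (cmod (to_complex p)) r.
    by rewrite mem_set.
  by rewrite Wr// ler0n.
rewrite integral_indic// setIT.
by apply: le_lt_trans (disc_area r0) _; rewrite ltry.
Qed.

Lemma monomial_scale (u z w : R[i]) n m :
  (u * z) ^+ n * ((u * z) ^+ m)^* * w =
  u ^+ n * (u ^+ m)^* * (z ^+ n * (z ^+ m)^* * w).
Proof.
have conjM (x y : R[i]) : Num.conj (x * y) = x^* * y^* by rewrite rmorphM.
by rewrite !exprMn conjM -!mulrA; congr (_ * _); rewrite mulrCA.
Qed.

Section compact_support.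
Variables (W : R[i] -> R) (r : R).
Hypothesis W_radial : radial W.
Hypothesis r_ge0 : 0 <= r.
Hypothesis W_supp : forall z, r < cmod z -> W z = 0.

Let W_ge0 z : 0 <= W z. Proof. by case: W_radial => h _ _; case/andP: (h z). Qed.

Let iW := radial_integrable W_radial r_ge0 W_supp.

Lemma integrable_weight_bounded (F : RR -> R[i]) (M : R) : cmeasurable setT F -> 0 <= M ->
  (forall p, cmod (to_complex p) <= r -> cmod (F p) <= M) ->
  cintegrable mu setT (fun p => F p * (W (to_complex p))%:C).
Proof.
move=> mF M0 HM.
have mG : cmeasurable setT (fun p => F p * (W (to_complex p))%:C).
  by apply: cmeasurableM => //; apply: cmeasurable_real; case: W_radial.
apply: cintegrableP => //.
apply: (@le_lt_trans _ _ (\int[mu]_p (M%:E * (W (to_complex p))%:E))%E).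
  apply: ge0_le_integral => //.
  - by move=> p _; rewrite lee_fin cmod_ge0.
  - exact/measurable_EFinP/measurable_cmod.
  - by apply/measurable_EFinP/measurable_funM => //; case: W_radial.
  move=> p _; rewrite -EFinM lee_fin cmodM cmod_real ger0_norm//.
  have [pr|pr] := leP (cmod (to_complex p)) r; first by rewrite ler_wpM2r// HM.
  by rewrite W_supp// !mulr0.
rewrite ge0_integralZl_EFin//.
- apply: lte_mul_pinfty; rewrite ?lee_fin//.
  case/integrableP : iW => _; apply: le_lt_trans.
  by rewrite le_eqVlt; apply/orP; left; apply/eqP; apply: eq_integral => p _;
    rewrite /= ger0_norm.
- by move=> p _; rewrite lee_fin.
- by apply/measurable_EFinP; case: W_radial.
Qed.

Let mono n m (p : RR) : R[i] := to_complex p ^+ n * (to_complex p ^+ m)^*.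

Lemma mono_integrable n m :
  cintegrable mu setT (fun p => mono n m p * (W (to_complex p))%:C).
Proof.
apply: (@integrable_weight_bounded _ (r ^+ n * r ^+ m)).
- apply: cmeasurableM; first exact/cmeasurableX/cmeasurable_to_complex.
  exact/cmeasurable_conj/cmeasurableX/cmeasurable_to_complex.
- by rewrite mulr_ge0 ?exprn_ge0.
- move=> p pr; rewrite cmodM cmod_conj !cmodX.
  by apply: ler_pM; rewrite ?exprn_ge0 ?cmod_ge0// lerXn2r// nnegrE cmod_ge0.
Qed.

(** The rotation multiplies the integral by u = rot_unit^n conj(rot_unit)^m without changing its
    value, and u = 1 would make rot_unit a root of unity. *)
Lemma mono_orthogonal n m : n != m ->
  cint mu setT (fun p => mono n m p * (W (to_complex p))%:C) = 0.
Proof.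
move=> nm; have := mono_integrable n m; set F := fun p => _ => iF.
pose u : R[i] := rot_unit ^+ n * (rot_unit ^+ m)^*.
have E p : F (rot p) = u * F p.
  rewrite /F /mono to_complex_rot; case: W_radial => _ _ ->.
  exact: monomial_scale.
have : cint mu setT F = u * cint mu setT F.
  rewrite -cintZ//; case: iF => i1 i2.
  transitivity (cint mu setT (fun p => F (rot p))); last by apply: eq_cint => p _; exact: E.
  rewrite /cint /Rintegral; congr (_ +i* _); congr fine; apply/esym.
    exact: integrable_rot i1.
  exact: integrable_rot i2.
move/eqP; rewrite -subr_eq0 -{1}[cint _ _ _]mul1r -mulrBl mulf_eq0 => /orP[|/eqP//].
rewrite subr_eq0 => /eqP/esym u1; exfalso.
have : rot_unit ^+ n = rot_unit ^+ m :> R[i].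
  have : u * rot_unit ^+ m = rot_unit ^+ m by rewrite u1 mul1r.
  rewrite /u -mulrA [_^* * _]mulrC mulc_conj cmodX cmod_rot_unit !expr1n.
  by rewrite mulr1.
have u0 k : rot_unit ^+ k != 0 :> R[i].
  by rewrite -cmod_eq0 cmodX cmod_rot_unit expr1n oner_eq0.
wlog nm' : n m {nm F iF u E u1} / (n < m)%N => [H|].
  move=> h; move: (nm); rewrite neq_ltn => /orP[/H|/H]; first exact.
  by apply.
move=> h; have := @rot_unit_pow_neq1 R (m - n).-1.
rewrite prednK ?subn_gt0//; case/eqP.
apply: (mulfI (u0 n)); rewrite -exprD mulr1 subnKC// ltnW//.
Qed.

Lemma poly_parseval a N :
  (\int[mu]_p (cmod (\sum_(i < N) a i * to_complex p ^+ i) ^+ 2 *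
     W (to_complex p))%:E = \sum_(i < N) (cmod (a i) ^+ 2)%:E * moment W i)%E.
Proof.
pose E (i j : nat) p := a i * (a j)^* * (mono i j p * (W (to_complex p))%:C).
have iE i j : cintegrable mu setT (E i j) by exact/cintegrableZ/mono_integrable.
pose S p := \sum_(i < N) \sum_(j < N) E i j p.
have iS : cintegrable mu setT S.
  apply: (cintegrable_sum (F := fun i p => \sum_(j < N) E i j p)) => // i.
  exact: cintegrable_sum.
have SE p : S p = (cmod (\sum_(i < N) a i * to_complex p ^+ i) ^+ 2 *
     W (to_complex p))%:C.
  rewrite rmorphM/= -mulc_conj rmorph_sum mulr_suml mulr_suml; apply: eq_bigr => i _.
  rewrite mulr_sumr mulr_suml; apply: eq_bigr => j _.
  by rewrite /E /mono rmorphM/=; ring.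
have mE i : moment W i = (complex.Re (cint mu setT
    (fun p => mono i i p * (W (to_complex p))%:C)))%:E.
  rewrite /= /Rintegral fineK; last by case: (mono_integrable i i) => /integrable_fin_num ->.
  apply: eq_integral => p _; congr (_%:E); rewrite /mono mulc_conj -rmorphM/=.
  by rewrite cmodX -exprM mulnC.
have SI : cint mu setT S = \sum_(i < N) a i * (a i)^* *
    cint mu setT (fun p => mono i i p * (W (to_complex p))%:C).
  have -> : cint mu setT S = \sum_(i < N) cint mu setT (fun p => \sum_(j < N) E i j p).
    apply: (cint_sum (F := fun i p => \sum_(j < N) E i j p)) => // i.
    exact: cintegrable_sum.
  apply: eq_bigr => i _; rewrite (cint_sum (F := E i))// (bigD1 i)//= big1 ?addr0.
    by rewrite cintZ//; exact: mono_integrable.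
  move=> j ji; rewrite cintZ ?mono_orthogonal ?mulr0//; last exact: mono_integrable.
  by rewrite eq_sym.
have [iS1 _] := iS.
transitivity ((complex.Re (cint mu setT S))%:E).
  rewrite /= /Rintegral fineK; last by rewrite integrable_fin_num.
  by apply: eq_integral => p _; rewrite SE.
rewrite SI (_ : complex.Re (\sum_(i < N) _) = \sum_(i < N) cmod (a i) ^+ 2 *
  fine (moment W i)).
  rewrite -sumEFin; apply: eq_bigr => i _; by rewrite mE /= EFinM.
rewrite (big_morph _ (@Re_addc R) (erefl (complex.Re 0))); apply: eq_bigr => i _.
by rewrite mulc_conj Re_mulc mE /= mul0r subr0.
Qed.

(** The identity for the partial sums passes to the limit by dominated convergence: they are bounded
    on the support of W uniformly in their length. *)
Lemma parseval_compact a : entire_coeffs a ->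
  (\int[mu]_p (cmod (pser a (to_complex p)) ^+ 2 * W (to_complex p))%:E =
   \sum_(0 <= i <oo) (cmod (a i) ^+ 2)%:E * moment W i)%E.
Proof.
move=> Ea.
have r1 : 0 < r + 1 by rewrite ltr_wpDl.
have [M M0 HM] := entire_coeffs_bound Ea r1.
have PM n p : cmod (to_complex p) <= r ->
    cmod (\sum_(i < n) a i * to_complex p ^+ i) <= 2 * M.
  move=> pr; have pr1 : cmod (to_complex p) <= r + 1 by rewrite (le_trans pr)// lerDl.
  (* The sum of the bounds M 2^-i over i < n, in closed form. *)
  have : cmod (\sum_(i < n) a i * to_complex p ^+ i) <= 2 * M * (1 - 2^-1 ^+ n).
    elim: n => [|n IH]; first by rewrite big_ord0 cmod0 expr0 subrr mulr0.
    rewrite big_ord_recr/= (le_trans (cmodD_le _ _))//.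
    apply: (le_trans (lerD IH (HM _ pr1 n))); rewrite le_eqVlt; apply/orP; left.
    by rewrite exprS; apply/eqP; field.
  move/le_trans; apply; rewrite ler_piMr ?mulr_ge0// gerBl.
have := @dominated_cvg _ _ _ mu setT measurableT
  (fun n p => (cmod (\sum_(i < n) a i * to_complex p ^+ i) ^+ 2 * W (to_complex p))%:E)
  (fun p => (cmod (pser a (to_complex p)) ^+ 2 * W (to_complex p))%:E)
  (fun p => ((2 * M) ^+ 2 * W (to_complex p))%:E).
case: W_radial => _ mW _.
have mom0 i : (0 <= (cmod (a i) ^+ 2)%:E * moment W i)%E.
  by rewrite mule_ge0 ?lee_fin ?sqr_ge0 ?moment_ge0.
move=> H; have {}H := H _ _ _ _ _.
apply/esym; apply: cvg_unique; last first.
  apply: H.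
  - move=> n; apply/measurable_EFinP/measurable_funM => //.
    by apply: measurable_funX; apply: measurable_cmod => //; exact: cmeasurable_poly.
  - move=> p _; apply: cvg_EFin; first exact: nearW.
    apply: cvgM; last exact: cvg_cst.
    exact: csum_sqr_cvg (entire_csummable _ Ea).
  - by [].
  - by under eq_fun do rewrite EFinM; exact: integrableZl.
  - move=> n p _; rewrite /= lee_fin ger0_norm; last by apply: mulr_ge0 => //; exact: sqr_ge0.
    have [pr|pr] := leP (cmod (to_complex p)) r; last by rewrite W_supp// !mulr0.
    have := PM n _ pr; have := cmod_ge0 (\sum_(i < n) a i * to_complex p ^+ i).
    move: (cmod _) => x x0 xM.
    by rewrite ler_wpM2r// lerXn2r// nnegrE (le_trans x0).
- rewrite /= (_ : (fun n => _) = fun n => (\sum_(0 <= i < n) (cmod (a i) ^+ 2)%:E * moment W i)%E).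
    exact: is_cvg_nneseries.
  by apply/funext => n; rewrite poly_parseval big_mkord.
- exact: fmap_proper_filter.
- exact: ereal_hausdorff.
Qed.

End compact_support.

Lemma annulus_sum z (x : R) : 0 <= x ->
  (\sum_(0 <= k <oo) (x * ((k%:R <= cmod z < k.+1%:R)%R)%:R)%:E = x%:E)%E.
Proof.
move=> x0; rewrite -[RHS](nneseries_delta (Num.trunc (cmod z)) x0).
apply: eq_eseriesr => k _; congr (_%:E).
have [->|kz] := eqVneq k (Num.trunc (cmod z)).
  by rewrite truncn_itv ?cmod_ge0// mulr1.
have [h|_] := boolP (k%:R <= cmod z < k.+1%:R)%R; last by rewrite mulr0.
case/negP: kz; apply/eqP/esym; exact: truncn_def.
Qed.

(** The weight is cut into unit annuli, on each of which [parseval_compact] applies; all terms are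
    nonnegative, so the sums may be exchanged. *)
Theorem parseval W a : radial W -> entire_coeffs a ->
  (\int[mu]_p (cmod (pser a (to_complex p)) ^+ 2 * W (to_complex p))%:E =
   \sum_(0 <= i <oo) (cmod (a i) ^+ 2)%:E * moment W i)%E.
Proof.
move=> rW Ea; have [W0 mW _] := rW.
pose V k z := W z * ((k%:R <= cmod z < k.+1%:R)%R)%:R.
have rV k : radial (V k) := radial_mul_annulus k rW.
have split (F : RR -> R) : measurable_fun setT F -> (forall p, 0 <= F p) ->
    (\int[mu]_p (F p * W (to_complex p))%:E =
     \sum_(0 <= k <oo) \int[mu]_p (F p * V k (to_complex p))%:E)%E.
  move=> mF F0; rewrite -integral_nneseries//.
  - apply: eq_integral => p _.
    rewrite -(annulus_sum (to_complex p)); last first.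
      by rewrite mulr_ge0//; case/andP: (W0 (to_complex p)).
    by apply: eq_eseriesr => k _; rewrite /V mulrA.
  - by move=> k; apply/measurable_EFinP/measurable_funM => //; case: (rV k).
  - move=> k p _; rewrite lee_fin mulr_ge0//.
    by have [h _ _] := rV k; case/andP: (h (to_complex p)).
rewrite (split (fun p => cmod (pser a (to_complex p)) ^+ 2)); last 2 first.
  by apply/measurable_funX/measurable_cmod => //; exact: cmeasurable_pser.
  by move=> p; rewrite sqr_ge0.
under eq_eseriesr => k _.
  rewrite (@parseval_compact (V k) k.+1%:R)//; last first.
    by move=> z kz; rewrite /V ltNge (ltW kz) andbF mulr0.
  over.
rewrite nneseries_interchange; last first.
  by move=> k n; rewrite mule_ge0 ?lee_fin ?sqr_ge0 ?moment_ge0.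
apply: eq_eseriesr => n _; rewrite nneseriesZl; last first.
  by move=> k _; rewrite moment_ge0.
congr (_ * _)%E; rewrite /moment (split (fun p => cmod (to_complex p) ^+ (2 * n)))//.
  by apply: measurable_funX; exact: measurable_cmod_to_complex.
by move=> p; rewrite exprn_ge0// cmod_ge0.
Qed.

End parseval.

(** * The weight and the norms of monomials *)

Section gaussian_weight.
Context {R : realType}.
Implicit Types (z : R[i]) (x y t u : R).

(** Completing the square in a y^2 - |y| ln 8. The slack 2 absorbs integer parts and shifts of the
    index by one. *)
Lemma gauss_decay (a : R) : 0 < a -> exists2 C : R, 0 < C & forall y (d : nat),
  d%:R <= `|y| + 2 -> expR (- (a * y ^+ 2)) <= C * 8^-1 ^+ d.
Proof.
move=> a0; pose L := ln (8 : R).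
have L0 : 0 <= L by rewrite ln_ge0// ler1n.
have e8 : expR (- L) = 8^-1 by rewrite expRN lnK// posrE.
exists (expR (L ^+ 2 / (4 * a) + 2 * L)) => [|y d dy]; first exact: expR_gt0.
rewrite -e8 -expRM_natl -expRD ler_expR.
have h1 : d%:R * L <= (`|y| + 2) * L by rewrite ler_wpM2r.
have h2 : `|y| * L <= a * y ^+ 2 + L ^+ 2 / (4 * a).
  rewrite -subr_ge0 -[y ^+ 2]real_normK ?num_real//.
  have -> : a * `|y| ^+ 2 + L ^+ 2 / (4 * a) - `|y| * L =
      a * (`|y| - L / (2 * a)) ^+ 2 by field; rewrite gt_eqF.
  by rewrite mulr_ge0 ?sqr_ge0// ltW.
by rewrite mulrN; move: h1 h2; clear; lra.
Qed.

Lemma distn_le_nat (n m : nat) (x : R) : n%:R - m%:R <= x -> m%:R - n%:R <= x ->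
  (distn n m)%:R <= x.
Proof.
move=> h1 h2; rewrite /distn; have [nm|/ltnW nm] := leqP n m.
  by rewrite (eqP nm) add0n natrB.
by rewrite (eqP nm) addn0 natrB.
Qed.

Lemma distn_trunc (n : nat) (x : R) : 0 <= x ->
  (distn n (Num.trunc x))%:R <= `|n%:R - x| + 1.
Proof.
move=> x0; have /andP[h1 h2] := truncn_itv x0.
have h3 := ler_norm (n%:R - x); have h4 := ler_norm (x - n%:R).
rewrite distrC in h4; rewrite -natr1 in h2.
by apply: distn_le_nat; move: h1 h2 h3 h4; rewrite distrC; lra.
Qed.

Definition logmod z : R := logplus (cmod z).

Lemma logmod_ge0 z : 0 <= logmod z.
Proof. by rewrite /logmod /logplus le_max lexx orbT. Qed.

Lemma cmod_le_explog z : cmod z <= expR (logmod z).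
Proof.
have [->|z0] := eqVneq z 0; first by rewrite cmod0 expR_ge0.
rewrite -[leLHS]lnK ?posrE ?cmod_gt0// ler_expR.
by rewrite /logmod /logplus le_max lexx.
Qed.

Lemma cmod_explog z : 1 <= cmod z -> cmod z = expR (logmod z).
Proof.
move=> z1; have z0 := lt_le_trans ltr01 z1.
rewrite /logmod /logplus max_l ?lnK ?posrE//.
by rewrite ln_ge0.
Qed.

Lemma logmod_lt1 z : cmod z < 1 -> logmod z = 0.
Proof.
by move=> z1; rewrite /logmod /logplus max_r// ln_le0// ltW.
Qed.

Lemma explog_le z : expR (logmod z) <= 1 + cmod z.
Proof.
have [z1|z1] := leP 1 (cmod z); first by rewrite -cmod_explog// lerDr.
by rewrite logmod_lt1// expR0 lerDl cmod_ge0.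
Qed.

Variable alpha : R.
Hypothesis alpha_gt0 : 0 < alpha.
Notation phi := (logsq_weight alpha).

Lemma phiE z : phi z = alpha * logmod z ^+ 2.
Proof. by []. Qed.

Lemma phi_ge0 z : 0 <= phi z.
Proof. by rewrite phiE mulr_ge0 ?sqr_ge0// ltW. Qed.

Definition wt z : R := expR (- (2 * phi z)).

Lemma measurable_logmod : measurable_fun setT
  (fun p : measurableTypeR R * measurableTypeR R => logmod (to_complex p)).
Proof.
apply: measurable_maxr; last exact: measurable_cst.
apply: (measurableT_comp (@measurable_ln R)); exact: measurable_cmod_to_complex.
Qed.

Lemma radial_wt : radial wt.
Proof.
split.
- move=> z; rewrite expR_ge0/= -[leRHS]expR0 ler_expR.
  by have := phi_ge0 z; lra.
- apply: measurableT_comp; first exact: measurable_expR.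
  apply: measurable_funN; apply: measurable_funM; first exact: measurable_cst.
  apply: measurable_funM; first exact: measurable_cst.
  apply: measurable_funX; exact: measurable_logmod.
- by move=> z; rewrite /wt !phiE /logmod cmodM cmod_rot_unit mul1r.
Qed.

Lemma cmodX_le z n : cmod z ^+ n <= expR (n%:R * logmod z).
Proof. by rewrite expRM_natl lerXn2r ?nnegrE ?cmod_ge0 ?expR_ge0// cmod_le_explog. Qed.

Lemma cmodX_eq z n : 1 <= cmod z -> cmod z ^+ n = expR (n%:R * logmod z).
Proof. by move=> z1; rewrite expRM_natl -cmod_explog. Qed.

Definition entry z n : R[i] := (expR (- (n%:R ^+ 2 / (4 * alpha))) * expR (- phi z))%:C * z ^+ n.

Definition kap z : nat := Num.trunc (2 * alpha * logmod z).

(** With u = log |z| this is the logarithm of |[entry z n]| for |z| >= 1, a Gaussian in n centred at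
    2 alpha u. *)
Lemma square_complete (n u : R) :
  n * u - n ^+ 2 / (4 * alpha) - alpha * u ^+ 2 = - ((4 * alpha)^-1 * (n - 2 * alpha * u) ^+ 2).
Proof. by field; rewrite gt_eqF. Qed.

Lemma cmod_entry z n : cmod (entry z n) =
  expR (- (n%:R ^+ 2 / (4 * alpha))) * expR (- phi z) * cmod z ^+ n.
Proof. by rewrite /entry cmodM cmodX cmod_real ger0_norm// mulr_ge0 ?expR_ge0. Qed.

Lemma entry_le z n :
  cmod (entry z n) <= expR (- ((4 * alpha)^-1 * (n%:R - 2 * alpha * logmod z) ^+ 2)).
Proof.
rewrite cmod_entry -square_complete.
have -> : n%:R * logmod z - n%:R ^+ 2 / (4 * alpha) - alpha * logmod z ^+ 2 =
  (- (n%:R ^+ 2 / (4 * alpha)) + - phi z) + n%:R * logmod z by rewrite phiE; ring.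
by rewrite !expRD ler_wpM2l ?mulr_ge0 ?expR_ge0// cmodX_le.
Qed.

Lemma entry_eq z n : 1 <= cmod z ->
  cmod (entry z n) = expR (- ((4 * alpha)^-1 * (n%:R - 2 * alpha * logmod z) ^+ 2)).
Proof.
move=> z1; rewrite cmod_entry -square_complete.
have -> : n%:R * logmod z - n%:R ^+ 2 / (4 * alpha) - alpha * logmod z ^+ 2 =
  (- (n%:R ^+ 2 / (4 * alpha)) + - phi z) + n%:R * logmod z by rewrite phiE; ring.
by rewrite !expRD cmodX_eq.
Qed.

Lemma index_ge0 z : 0 <= 2 * alpha * logmod z.
Proof. by rewrite !mulr_ge0 ?logmod_ge0// ltW. Qed.

Lemma entry_decay : exists2 C : R, 0 < C &
  forall z n, cmod (entry z n) <= C * 8^-1 ^+ distn n (kap z).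
Proof.
have a0 : 0 < (4 * alpha)^-1 by rewrite invr_gt0 mulr_gt0.
have [C C0 HC] := gauss_decay a0; exists C => // z n.
apply: le_trans (entry_le z n) _; apply: HC.
by apply: le_trans (distn_trunc n (index_ge0 z)) _; rewrite lerD2l ler1n.
Qed.

Lemma entry_diag z : expR (- (4 * alpha)^-1) <= cmod (entry z (kap z)).
Proof.
have [z1|z1] := leP 1 (cmod z); last first.
  (* Inside the unit disc [kap z] is 0 and the entry there is 1. *)
  rewrite /kap logmod_lt1// mulr0 truncn0 cmod_entry phiE logmod_lt1//.
  rewrite !expr0n/= mulr0 mul0r oppr0 expR0 !mulr1 -expR0 ler_expR oppr_le0.
  by rewrite invr_ge0 mulr_ge0// ltW.
rewrite entry_eq// ler_expR lerN2 ler_piMr ?invr_ge0 ?mulr_ge0 ?(ltW alpha_gt0)//.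
rewrite /kap; have := truncn_itv (index_ge0 z).
move: (2 * alpha * logmod z) => x; rewrite -natr1 => /andP[].
by move: (Num.trunc x)%:R => m h1 h2; rewrite -sqrrN -subr_ge0; nra.
Qed.

(** The maximum of |z|^(2 n + 2) e^(-2 phi(z)), attained at log |z| = (n + 1) / (2 alpha). The extra
    |z|^2 is the area element in the variable log |z|, so this is the order of the squared norm of
    z^n in F^2. *)
Definition peak n : R := expR (n.+1%:R ^+ 2 / (2 * alpha)).

Lemma peak_gt0 n : 0 < peak n. Proof. exact: expR_gt0. Qed.

(** Stated for any W that dominates the weight on the annulus of the peak, so that it applies to
    [wt] and to its restriction to that annulus. *)
Lemma moment_lower W n : radial W ->
  (forall z, expR (n.+1%:R / (2 * alpha)) <= cmod z <=
     2 * expR (n.+1%:R / (2 * alpha)) -> wt z <= W z) ->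
  ((2^-1 * expR (- (2 * alpha + 2)) * peak n)%:E <= moment W n)%E.
Proof.
move=> [W0 mW _] HW.
set t := n.+1%:R / (2 * alpha) in HW *; set r := expR t in HW *.
have t0 : 0 <= t by rewrite divr_ge0// mulr_ge0// ltW.
have r0 : 0 < r := expR_gt0 _.
have r1 : 1 <= r by rewrite -expR0 ler_expR.
(* The rectangle [r, 3 r / 2] x [0, r] lies in the annulus r <= |z| <= 2 r, as 9/4 + 1 <= 4. *)
pose I : set (measurableTypeR R) := [set` `[r, 3 / 2 * r]].
pose J : set (measurableTypeR R) := [set` `[0, r]].
have mI : measurable I by exact: measurable_itv.
have mJ : measurable J by exact: measurable_itv.
have mIJ : measurable (I `*` J) by exact: measurableX.
have E : planar_lebesgue R (I `*` J) = (2^-1 * r ^+ 2)%:E.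
  transitivity (@lebesgue_measure R I * @lebesgue_measure R J)%E.
    exact: product_measure1E.
  rewrite /I /J !lebesgue_measure_itv/= !lte_fin r0.
  have -> : (r < 3 / 2 * r)%R by lra.
  by rewrite -!EFinB -EFinM; congr (_%:E); field.
have m0 p : 0 <= cmod (to_complex p) ^+ (2 * n) * W (to_complex p).
  rewrite mulr_ge0 ?exprn_ge0 ?cmod_ge0//; by case/andP: (W0 (to_complex p)).
(* On the rectangle log |z| = t + s with 0 <= s <= 1, because 2 <= e, and the exponent 2 n u - 2
   alpha u^2 then loses 2 s + 2 alpha s^2 <= 2 + 2 alpha against its value at u = t. *)
pose c := expR (n%:R * 2 * t - 2 * alpha * t ^+ 2 - (2 * alpha + 2)).
have -> : 2^-1 * expR (- (2 * alpha + 2)) * peak n = c * (2^-1 * r ^+ 2).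
  rewrite /c /r /peak -expRM_natl [RHS]mulrCA -mulrA -!expRD; congr (_ * expR _).
  by rewrite /t -natr1; field; rewrite gt_eqF.
rewrite EFinM -E.
apply: (@le_trans _ _ (\int[planar_lebesgue R]_(p in I `*` J) (cst c%:E) p)%E).
  by rewrite integral_cst.
apply: (@le_trans _ _ (\int[planar_lebesgue R]_(p in I `*` J)
   (cmod (to_complex p) ^+ (2 * n) * W (to_complex p))%:E)%E); last first.
  apply: ge0_subset_integral => //.
    apply/measurable_EFinP/measurable_funM => //.
    by apply: measurable_funX; exact: measurable_cmod_to_complex.
  by move=> p _; rewrite lee_fin.
apply: ge0_le_integral => //.
- by move=> p _; rewrite lee_fin expR_ge0.
- apply/measurable_EFinP/(@measurable_funS _ _ _ _ setT) => //.
  apply: measurable_funM => //.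
  by apply: measurable_funX; exact: measurable_cmod_to_complex.
move=> [x y] [/=]; rewrite /I /J /= !in_itv/= => /andP[x1 x2] /andP[y1 y2].
set z := to_complex _; rewrite lee_fin.
have z1 : r <= cmod z.
  rewrite (le_trans x1)//; apply: le_trans (normRe_le_cmod z).
  exact: ler_norm.
have z2 : cmod z <= 2 * r.
  rewrite -(@ler_pXn2r _ 2%N)// ?nnegrE ?cmod_ge0 ?mulr_ge0 ?(ltW r0)// cmod_sqr /=.
  by nra.
have Wz : wt z <= W z by apply: HW; rewrite z1.
apply: le_trans (_ : c <= cmod z ^+ (2 * n) * wt z) _; last first.
  by rewrite ler_wpM2l// exprn_ge0// cmod_ge0.
have z3 : 1 <= cmod z := le_trans r1 z1.
rewrite cmodX_eq// /wt -expRD ler_expR phiE.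
set u := logmod z.
have u1 : t <= u by rewrite -ler_expR -cmod_explog.
have u2 : u <= t + 1.
  rewrite -ler_expR -cmod_explog// (le_trans z2)// expRD mulrC ler_wpM2l ?expR_ge0//.
  by apply: le_trans (expR_ge1Dx 1); rewrite (_ : 1 + 1 = 2)//; ring.
have Et : 2 * alpha * t = n%:R + 1 by rewrite /t -natr1; field; rewrite gt_eqF.
clear -alpha_gt0 Et u1 u2; rewrite natrM.
have s0 : 0 <= u - t by rewrite subr_ge0.
have s1 : u - t <= 1 by lra.
have -> : u = t + (u - t) by ring.
move: (u - t) s0 s1 => s s0 s1.
have -> : 2%:R * n%:R * (t + s) + - (2 * (alpha * (t + s) ^+ 2)) =
  n%:R * 2 * t - 2 * alpha * t ^+ 2 + (2 * n%:R * s - 2 * (2 * alpha * t) * s - 2 * alpha * s ^+ 2) by ring.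
rewrite Et lerD2l; have : 0 <= alpha * (1 - s ^+ 2).
  by rewrite mulr_ge0 ?(ltW alpha_gt0)// subr_ge0 expr_le1.
by lra.
Qed.

Lemma moment_integrand_le z n :
  cmod z ^+ (2 * n) * wt z <= peak n * expR (- (2 * alpha *
    (logmod z - n.+1%:R / (2 * alpha)) ^+ 2)) * expR (- (2 * logmod z)).
Proof.
apply: le_trans (ler_wpM2r (expR_ge0 _) (cmodX_le z (2 * n))) _.
rewrite /wt /peak -!expRD ler_expR phiE natrM -natr1 le_eqVlt.
by apply/orP; left; apply/eqP; field; rewrite gt_eqF.
Qed.

(** On the layer k <= log^+ |z| < k + 1 the integrand is at most g k, and the disc D k contains the
    layer. The factor e^(-2 k) in g k cancels the area bound 4 e^(2 k + 2), which leaves 4 e^2 and a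
    geometric sum around the peak. *)
Lemma moment_upper : exists2 C : R, 0 < C &
  forall n, (moment wt n <= (C * peak n)%:E)%E.
Proof.
have a0 : 0 < 2 * alpha by rewrite mulr_gt0.
have [C C0 HC] := gauss_decay a0.
exists (C * 4 * expR 2 * 4) => [|n]; first by rewrite !mulr_gt0// expR_gt0.
set t := n.+1%:R / (2 * alpha).
have t0 : 0 <= t by rewrite divr_ge0// ltW.
pose g k := C * peak n * 8^-1 ^+ distn k (Num.trunc t) * expR (- (2 * k%:R)).
have g0 k : 0 <= g k by rewrite !mulr_ge0 ?expR_ge0 ?exprn_ge0 ?invr_ge0 ?(ltW C0)//.
pose D k : set (measurableTypeR R * measurableTypeR R) :=
  [set p | cmod (to_complex p) <= expR k.+1%:R].
have mD k : measurable (D k) := measurable_disc _.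
apply: (@le_trans _ _ (\int[planar_lebesgue R]_p
    \sum_(0 <= k <oo) (g k * \1_(D k) p)%:E)%E).
  apply: ge0_le_integral => //.
  - by move=> p _; rewrite lee_fin mulr_ge0 ?expR_ge0// exprn_ge0// cmod_ge0.
  - apply/measurable_EFinP/measurable_funM; last by case: radial_wt.
    by apply: measurable_funX; exact: measurable_cmod_to_complex.
  - apply: ge0_emeasurable_sum => k; first by move=> p _ _; rewrite lee_fin mulr_ge0.
    by move=> _; apply/measurable_EFinP/measurable_funM.
  move=> p _; set z := to_complex p.
  set k := Num.trunc (logmod z).
  have /andP[k1 k2] := truncn_itv (logmod_ge0 z); rewrite -/k in k1 k2.
  have gD0 j : 0 <= g j * \1_(D j) p by rewrite mulr_ge0.
  apply: le_trans (nneseries_ge_term k gD0).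
  rewrite lee_fin (_ : \1_(D k) p = 1) ?mulr1; last first.
    rewrite indicE mem_set// /D /=; apply: le_trans (cmod_le_explog z) _.
    by rewrite ler_expR ltW.
  apply: le_trans (moment_integrand_le z n) _.
  rewrite /g -/t [C * _]mulrC -(mulrA (peak n) C); apply: ler_pM; rewrite ?mulr_ge0 ?expR_ge0//.
    rewrite ler_wpM2l ?expR_ge0//; apply: HC; rewrite distnC.
    have /andP[m1 m2] := truncn_itv t0.
    have h3 := ler_norm (logmod z - t); have h4 := ler_norm (t - logmod z).
    rewrite distrC in h4; rewrite -natr1 in k2 m2.
    by apply: distn_le_nat; move: k1 k2 m1 m2 h3 h4; lra.
  by rewrite ler_expR lerN2 ler_wpM2l.
rewrite integral_nneseries//; last 2 first.
  by move=> k; apply/measurable_EFinP/measurable_funM.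
  by move=> k p _; rewrite lee_fin mulr_ge0.
have -> : C * 4 * expR 2 * 4 * peak n = (C * peak n * 4 * expR 2) * 4 by ring.
rewrite EFinM; apply: le_trans (_ : _ <= (C * peak n * 4 * expR 2)%:E *
    \sum_(0 <= k <oo) (8^-1 ^+ distn k (Num.trunc t) : R)%:E)%E _; last first.
  rewrite lee_wpmul2l ?lee_fin ?mulr_ge0 ?expR_ge0 ?(ltW C0)//.
  exact: sum_eighth.
rewrite -nneseriesZl; last by move=> k _; rewrite lee_fin exprn_ge0.
apply: lee_nneseries => k _.
  by move=> _; apply: integral_ge0 => p _; rewrite lee_fin mulr_ge0.
under eq_integral do rewrite EFinM.
rewrite ge0_integralZl_EFin//; last exact/measurable_EFinP.
rewrite integral_indic// setIT.
apply: le_trans (lee_wpmul2l _ (disc_area (expR_ge0 _))) _; first by rewrite lee_fin.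
rewrite -!EFinM lee_fin le_eqVlt; apply/orP; left; apply/eqP.
have e0 : expR (2 * k%:R) != 0 :> R by rewrite gt_eqF ?expR_gt0.
have E2 : expR (2 * k.+1%:R) = expR 2 * expR (2 * k%:R) :> R.
  by rewrite -expRD -natr1; congr expR; ring.
rewrite /g -expRM_natl E2 expRN.
move: (8^-1 ^+ _) (expR 2) (peak n) => w v u.
by field.
Qed.

End gaussian_weight.

(** * The reproducing kernel *)

Lemma Re_mul_real (R : realType) (z : R[i]) (r : R) :
  complex.Re (z * r%:C) = complex.Re z * r.
Proof. by case: z => a b; simpc. Qed.

Section polarization.
Context d (T : measurableType d) (R : realType).
Variable mu : {measure set T -> \bar R}.
Implicit Types (F G : T -> R[i]).
Variable w : T -> R.
Hypothesis w_ge0 : forall x, 0 <= w x.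
Hypothesis mw : measurable_fun setT w.

Definition sqint F : \bar R := (\int[mu]_x (cmod (F x) ^+ 2 * w x)%:E)%E.

Lemma measurable_sqw F : cmeasurable setT F ->
  measurable_fun setT (fun x => cmod (F x) ^+ 2 * w x).
Proof. by move=> mF; apply: measurable_funM => //; apply: measurable_funX; exact: measurable_cmod. Qed.

Lemma sqint_integrable F : cmeasurable setT F -> (sqint F < +oo)%E ->
  mu.-integrable setT (fun x => (cmod (F x) ^+ 2 * w x)%:E).
Proof.
move=> mF iF; apply/integrableP; split; first exact/measurable_EFinP/measurable_sqw.
apply: le_lt_trans iF; rewrite le_eqVlt; apply/orP; left; apply/eqP.
by apply: eq_integral => x _; rewrite /= ger0_norm// mulr_ge0// sqr_ge0.
Qed.

Lemma sqintD_fin F G : cmeasurable setT F -> cmeasurable setT G ->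
  (sqint F < +oo)%E -> (sqint G < +oo)%E -> (sqint (fun x => F x + G x)%R < +oo)%E.
Proof.
move=> mF mG iF iG; have m1 := measurable_sqw mF; have m2 := measurable_sqw mG.
apply: (@le_lt_trans _ _ (\int[mu]_x (2%:E * (cmod (F x) ^+ 2 * w x)%:E +
    2%:E * (cmod (G x) ^+ 2 * w x)%:E))%E).
  apply: ge0_le_integral => //.
  - by move=> x _; rewrite lee_fin mulr_ge0// sqr_ge0.
  - exact/measurable_EFinP/measurable_sqw/cmeasurableD.
  - by apply: emeasurable_funD; apply/measurable_EFinP/measurable_funM.
  move=> x _; rewrite -!EFinM -EFinD lee_fin.
  apply: le_trans (ler_wpM2r (w_ge0 x) (cmod_sqD_le (F x) (G x))) _.
  by rewrite mulrDl -!mulrA.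
have z0 H (x : T) : (0 <= (cmod (H x) ^+ 2 * w x)%:E)%E.
  by rewrite lee_fin mulr_ge0// sqr_ge0.
rewrite ge0_integralD//; last 4 first.
- by move=> x _; rewrite mule_ge0.
- by apply/measurable_EFinP/measurable_funM.
- by move=> x _; rewrite mule_ge0.
- by apply/measurable_EFinP/measurable_funM.
rewrite !ge0_integralZl_EFin//; [|exact/measurable_EFinP..].
by apply: lte_add_pinfty; apply: lte_mul_pinfty.
Qed.

Lemma sqintZ F (c : R[i]) : cmeasurable setT F ->
  sqint (fun x => c * F x) = ((cmod c ^+ 2)%:E * sqint F)%E.
Proof.
move=> mF; rewrite -ge0_integralZl_EFin ?sqr_ge0//; last exact/measurable_EFinP/measurable_sqw.
  by apply: eq_integral => x _; rewrite cmodM exprMn -mulrA EFinM.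
by move=> x _; rewrite lee_fin mulr_ge0// sqr_ge0.
Qed.

Lemma Re_cint_mul_conj F G : cmeasurable setT F -> cmeasurable setT G ->
  (sqint F < +oo)%E -> (sqint G < +oo)%E ->
  complex.Re (cint mu setT (fun x => F x * (G x)^* * (w x)%:C)) =
  2^-1 * (fine (sqint (fun x => F x + G x)%R) - fine (sqint F) - fine (sqint G)).
Proof.
move=> mF mG iF iG.
have i1 := sqint_integrable mF iF; have i2 := sqint_integrable mG iG.
have i3 := sqint_integrable (cmeasurableD mF mG) (sqintD_fin mF mG iF iG).
rewrite /=; transitivity (\int[mu]_x (2^-1 * ((cmod (F x + G x) ^+ 2 * w x -
    cmod (F x) ^+ 2 * w x) - cmod (G x) ^+ 2 * w x))).
  apply: eq_Rintegral => x _; rewrite cmod_sqD Re_mul_real.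
  by move: (complex.Re _) => r; field.
have i31 : mu.-integrable setT (EFin \o (fun x => cmod (F x + G x) ^+ 2 * w x -
    cmod (F x) ^+ 2 * w x)).
  by rewrite /comp; under eq_fun do rewrite EFinB; exact: integrableB.
rewrite RintegralZl//; last first.
  by rewrite /comp; under eq_fun do rewrite EFinB; exact: integrableB.
by rewrite !RintegralB.
Qed.

Lemma Im_cint_mul_conj F G :
  complex.Im (cint mu setT (fun x => F x * (G x)^* * (w x)%:C)) =
  complex.Re (cint mu setT (fun x => F x * ('i * G x)^* * (w x)%:C)).
Proof.
apply: eq_Rintegral => x _; case: (F x) (G x) => [a b] [c e].
by rewrite /=; simpc; ring.
Qed.

End polarization.

(** By polarization, inner products are determined by the norms of F + c G. This carries Parseval's
    identity from norms to inner products, with the plane on one side and the counting measure on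
    the other. *)
Lemma cint_mul_conj_transfer (R : realType) d1 (T1 : measurableType d1) d2
    (T2 : measurableType d2) (m1 : {measure set T1 -> \bar R})
    (m2 : {measure set T2 -> \bar R}) (w1 : T1 -> R) (w2 : T2 -> R)
    (F1 G1 : T1 -> R[i]) (F2 G2 : T2 -> R[i]) :
  (forall x, 0 <= w1 x) -> (forall x, 0 <= w2 x) ->
  measurable_fun setT w1 -> measurable_fun setT w2 ->
  cmeasurable setT F1 -> cmeasurable setT G1 ->
  cmeasurable setT F2 -> cmeasurable setT G2 ->
  (sqint m1 w1 F1 < +oo)%E -> (sqint m1 w1 G1 < +oo)%E ->
  sqint m1 w1 F1 = sqint m2 w2 F2 -> sqint m1 w1 G1 = sqint m2 w2 G2 ->
  (forall c, sqint m1 w1 (fun x => F1 x + c * G1 x)%R = sqint m2 w2 (fun x => F2 x + c * G2 x)%R) ->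
  cint m1 setT (fun x => F1 x * (G1 x)^* * (w1 x)%:C) =
  cint m2 setT (fun x => F2 x * (G2 x)^* * (w2 x)%:C).
Proof.
move=> p1 p2 mw1 mw2 mF1 mG1 mF2 mG2 iF1 iG1 EF EG EFG.
have mc1 c : cmeasurable setT (fun x => c * G1 x).
  by apply: cmeasurableM => //; exact: cmeasurable_cst.
have mc2 c : cmeasurable setT (fun x => c * G2 x).
  by apply: cmeasurableM => //; exact: cmeasurable_cst.
have iF2 : (sqint m2 w2 F2 < +oo)%E by rewrite -EF.
have iG2 : (sqint m2 w2 G2 < +oo)%E by rewrite -EG.
have K c : complex.Re (cint m1 setT (fun x => F1 x * (c * G1 x)^* * (w1 x)%:C)) =
    complex.Re (cint m2 setT (fun x => F2 x * (c * G2 x)^* * (w2 x)%:C)).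
  rewrite !Re_cint_mul_conj// ?sqintZ//.
  - by rewrite EFG EF EG.
  - by apply: lte_mul_pinfty; rewrite ?lee_fin ?sqr_ge0.
  - by apply: lte_mul_pinfty; rewrite ?lee_fin ?sqr_ge0.
apply/eqP; rewrite eq_complex; apply/andP; split; apply/eqP; last first.
  by rewrite !Im_cint_mul_conj; exact: K.
rewrite (eq_cint m1 (G := fun x => F1 x * (1 * G1 x)^* * (w1 x)%:C)); last first.
  by move=> x _; rewrite mul1r.
rewrite (eq_cint m2 (G := fun x => F2 x * (1 * G2 x)^* * (w2 x)%:C)); last first.
  by move=> x _; rewrite mul1r.
exact: K.
Qed.

Lemma sqrte_lty (R : realType) (x : \bar R) : (0 <= x)%E ->
  (sqrte x < +oo)%E = (x < +oo)%E.
Proof.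
move=> x0; have := sqrte_fin_num x0.
by rewrite !ge0_fin_numE ?sqrte_ge0.
Qed.

Lemma Re_csum_real (R : realType) (x : nat -> R) : (forall n, 0 <= x n) ->
  complex.Re (csum (fun n => (x n)%:C)) = fine (\sum_(0 <= n <oo) (x n)%:E)%E.
Proof. by move=> x0; rewrite -ge0_integral_count// => n; rewrite lee_fin. Qed.

Section reproducing_kernel.
Context {R : realType}.
Variable alpha : R.
Hypothesis alpha_gt0 : 0 < alpha.
Notation phi := (logsq_weight alpha).
Notation wt := (wt alpha).
Notation peak := (peak alpha).
Notation mu := (@planar_lebesgue R).
Implicit Types (a b : nat -> R[i]) (z : R[i]).

(** The square of the norm of z^n. *)
Definition mono_norm n : R := fine (moment wt n).

Lemma mono_norm_bounds : exists c C : R, [/\ 0 < c, 0 < C &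
  forall n, moment wt n = (mono_norm n)%:E /\ c * peak n <= mono_norm n <= C * peak n].
Proof.
have [C C0 HC] := moment_upper alpha_gt0.
exists (2^-1 * expR (- (2 * alpha + 2))), C; split => // [|n].
  by rewrite mulr_gt0 ?expR_gt0.
have rw := radial_wt alpha_gt0.
have lo := moment_lower alpha_gt0 rw (n := n) (fun z _ => lexx _).
have E : moment wt n = (mono_norm n)%:E.
  rewrite fineK// ge0_fin_numE ?moment_ge0//.
  by apply: le_lt_trans (HC n) _; rewrite ltry.
by split => //; rewrite -!lee_fin -E lo HC.
Qed.

Lemma moment_mono_norm n : moment wt n = (mono_norm n)%:E.
Proof. by have [c [C [_ _ /(_ n)[]]]] := mono_norm_bounds. Qed.

Lemma mono_norm_gt0 n : 0 < mono_norm n.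
Proof.
have [c [C [c0 _ /(_ n)[_ /andP[h _]]]]] := mono_norm_bounds.
by apply: lt_le_trans h; rewrite mulr_gt0 ?peak_gt0.
Qed.

Lemma mono_norm_ge0 n : 0 <= mono_norm n. Proof. exact/ltW/mono_norm_gt0. Qed.

Definition fock_sum a : \bar R := (\sum_(0 <= n <oo) (cmod (a n) ^+ 2 * mono_norm n)%:E)%E.

Lemma fock_sum_ge0 a : (0 <= fock_sum a)%E.
Proof. by apply: nneseries_ge0 => n _ _; rewrite lee_fin mulr_ge0 ?sqr_ge0 ?mono_norm_ge0. Qed.

Lemma parseval_wt a : entire_coeffs a ->
  sqint mu (fun p => wt (to_complex p)) (fun p => pser a (to_complex p)) = fock_sum a.
Proof.
move=> Ea; rewrite /sqint (parseval (radial_wt alpha_gt0) Ea).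
by apply: eq_eseriesr => n _; rewrite moment_mono_norm EFinM.
Qed.

Lemma norm2_pser a : entire_coeffs a -> norm2 phi (pser a) = sqrte (fock_sum a).
Proof. by move=> Ea; rewrite -parseval_wt. Qed.

Lemma fock2P f : fock2 phi f <->
  exists a, [/\ entire_coeffs a, f = pser a & (fock_sum a < +oo)%E].
Proof.
split=> [[/entire_power_series[a Ea fa]]|[a [Ea -> fa]]].
  have {}fa : f = pser a by exact/funext.
  rewrite fa norm2_pser// sqrte_lty ?fock_sum_ge0// => H.
  by exists a; split.
split; first exact: pser_entire.
by rewrite norm2_pser// sqrte_lty ?fock_sum_ge0.
Qed.

Lemma sqint_count a : sqint (@counting nat R) mono_norm a = fock_sum a.
Proof.
by rewrite /sqint ge0_integral_count// => n; rewrite lee_fin mulr_ge0 ?sqr_ge0 ?mono_norm_ge0.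
Qed.

Lemma inner2_pser a b : entire_coeffs a -> entire_coeffs b ->
  (fock_sum a < +oo)%E -> (fock_sum b < +oo)%E ->
  inner2 phi (pser a) (pser b) = csum (fun n => a n * (b n)^* * (mono_norm n)%:C).
Proof.
move=> Ea Eb fa fb; have [W0 mW _] := radial_wt alpha_gt0.
rewrite /csum; transitivity (cint mu setT (fun p => pser a (to_complex p) *
   (pser b (to_complex p))^* * (wt (to_complex p))%:C)); first by [].
apply: cint_mul_conj_transfer => //.
- by move=> p; case/andP: (W0 (to_complex p)).
- exact: mono_norm_ge0.
- exact: cmeasurable_pser.
- exact: cmeasurable_pser.
- by rewrite parseval_wt.
- by rewrite parseval_wt.
- by rewrite parseval_wt ?sqint_count.
- by rewrite parseval_wt ?sqint_count.
move=> c; rewrite sqint_count -parseval_wt; last first.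
  exact/entire_coeffsD/entire_coeffsZ.
congr (sqint _ _ _); apply/funext => p.
by rewrite pserD ?pserZ//; exact: entire_coeffsZ.
Qed.

(** With r = e^u, completing the square bounds e^(- n^2 / (4 alpha)) r^n by e^(alpha u^2), uniformly
    in n. *)
Lemma entire_of_decay a (M : R) :
  (forall n, cmod (a n) <= M * expR (- (n%:R ^+ 2 / (4 * alpha)))) -> entire_coeffs a.
Proof.
move=> H r r0; have M0 : 0 <= M.
  by have := le_trans (cmod_ge0 _) (H 0%N); rewrite pmulr_lge0// expR_gt0.
pose u := ln r; exists (M * expR (alpha * u ^+ 2)) => n.
have -> : r ^+ n = expR (n%:R * u) by rewrite expRM_natl lnK// posrE.
apply: le_trans (ler_wpM2r (expR_ge0 _) (H n)) _.
rewrite -mulrA ler_wpM2l// -expRD ler_expR.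
have := square_complete alpha_gt0 n%:R u.
have : 0 <= (4 * alpha)^-1 * (n%:R - 2 * alpha * u) ^+ 2.
  by rewrite mulr_ge0 ?sqr_ge0// invr_ge0 mulr_ge0// ltW.
lra.
Qed.

Lemma csum_monomial n a : csum (fun k => monomial n k * a k) = a n.
Proof.
rewrite -[RHS](csum_delta n); apply: eq_csum => k; rewrite /monomial.
by case: eqP => [->|_]; rewrite ?mul1r ?mul0r.
Qed.

Lemma fock_sum_monomial n : (fock_sum (monomial n) < +oo)%E.
Proof.
apply: (@le_lt_trans _ _ (mono_norm n)%:E); last by rewrite ltry.
rewrite -(nneseries_delta n (mono_norm_ge0 n)); apply: lee_nneseries => k _.
  by move=> _; rewrite lee_fin mulr_ge0 ?sqr_ge0 ?mono_norm_ge0.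
rewrite lee_fin /monomial; case: eqP => [->|_].
  by rewrite cmod1 expr1n mul1r.
by rewrite cmod0 expr0n mul0r.
Qed.

Definition ker_coeff z n : R[i] := (z^*)%R ^+ n / (mono_norm n)%:C.

Lemma cmod_ker_coeff z n : cmod (ker_coeff z n) = cmod z ^+ n / mono_norm n.
Proof.
by rewrite /ker_coeff cmodM cmodV cmod_real ger0_norm ?mono_norm_ge0// cmodX cmod_conj.
Qed.

Definition ker_diag z : \bar R := (\sum_(0 <= n <oo) (cmod z ^+ (2 * n) / mono_norm n)%:E)%E.

Lemma fock_sum_ker_coeff z : fock_sum (ker_coeff z) = ker_diag z.
Proof.
apply: eq_eseriesr => n _; congr (_%:E); rewrite cmod_ker_coeff mulnC exprM.
by field; rewrite gt_eqF ?mono_norm_gt0.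
Qed.

Lemma pow_peak z n : cmod z ^+ (2 * n) / peak n <=
  expR (2 * phi z - 2 * logmod z) *
  expR (- ((2 * alpha)^-1 * (n.+1%:R - 2 * alpha * logmod z) ^+ 2)).
Proof.
rewrite ler_pdivrMr ?peak_gt0// (le_trans (cmodX_le _ _))// -!expRD ler_expR phiE.
rewrite natrM -natr1 le_eqVlt; apply/orP; left; apply/eqP.
by field; rewrite gt_eqF.
Qed.

Lemma pow_peak_eq z n : 1 <= cmod z -> cmod z ^+ (2 * n) / peak n =
  expR (2 * phi z - 2 * logmod z) *
  expR (- ((2 * alpha)^-1 * (n.+1%:R - 2 * alpha * logmod z) ^+ 2)).
Proof.
move=> z1; rewrite cmodX_eq// -expRN -!expRD phiE; congr expR.
by rewrite natrM -natr1; field; rewrite gt_eqF.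
Qed.

(** The terms form a Gaussian in n + 1 centred at x = 2 alpha log^+ |z|. The single term n = kap z,
    for which n + 1 - x lies between 0 and 1 when |z| >= 1, gives the lower bound; the decay of the
    others gives the upper one. *)
Lemma ker_diag_bounds : exists c C : R, [/\ 0 < c, 0 < C & forall z,
  ((c * expR (2 * phi z - 2 * logmod z))%:E <= ker_diag z <=
  (C * expR (2 * phi z - 2 * logmod z))%:E)%E].
Proof.
have [c [C [c0 C0 H]]] := mono_norm_bounds.
have a0 : 0 < (2 * alpha)^-1 by rewrite invr_gt0 mulr_gt0.
have [D D0 HD] := gauss_decay a0.
exists (C^-1 * expR (- (2 * alpha)^-1)), (c^-1 * D * 4); split => [||z].
- by rewrite mulr_gt0 ?invr_gt0 ?expR_gt0.
- by rewrite !mulr_gt0 ?invr_gt0.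
have t0 n : 0 <= cmod z ^+ (2 * n) / mono_norm n.
  by rewrite divr_ge0 ?mono_norm_ge0// exprn_ge0// cmod_ge0.
have e0 := expR_ge0 (2 * phi z - 2 * logmod z).
apply/andP; split.
  apply: le_trans (nneseries_ge_term (kap alpha z) t0); rewrite lee_fin.
  have [_ /andP[_ h]] := H (kap alpha z).
  apply: le_trans (_ : C^-1 * (cmod z ^+ (2 * kap alpha z) / peak (kap alpha z)) <= _); last first.
    rewrite mulrCA -invfM ler_wpM2l ?exprn_ge0 ?cmod_ge0//.
    by rewrite lef_pV2// posrE ?mono_norm_gt0// mulr_gt0 ?peak_gt0.
  rewrite -mulrA ler_wpM2l ?invr_ge0 ?(ltW C0)//.
  have [z1|z1] := leP 1 (cmod z).
    rewrite pow_peak_eq// mulrC ler_wpM2l// ler_expR lerN2 ler_piMr ?(ltW a0)//.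
    rewrite /kap; have := truncn_itv (index_ge0 alpha_gt0 z).
    move: (2 * alpha * logmod z) => x; rewrite -natr1 => /andP[].
    by move: (Num.trunc x)%:R => m h1 h2; nra.
  rewrite /kap logmod_lt1// !mulr0 truncn0 muln0 expr0 phiE logmod_lt1// expr0n/=.
  by rewrite !mulr0 subr0 expR0 mulr1 mul1r /peak expRN expr1n mul1r.
apply: (@le_trans _ _ ((c^-1 * expR (2 * phi z - 2 * logmod z) * D)%:E *
    \sum_(0 <= n <oo) (8^-1 ^+ distn n (kap alpha z) : R)%:E)%E); last first.
  have -> : c^-1 * D * 4 * expR (2 * phi z - 2 * logmod z) =
    c^-1 * expR (2 * phi z - 2 * logmod z) * D * 4 by ring.
  rewrite [leRHS]EFinM lee_wpmul2l ?lee_fin ?mulr_ge0 ?invr_ge0 ?(ltW c0) ?(ltW D0)//.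
  exact: sum_eighth.
rewrite -nneseriesZl; last by move=> k _; rewrite lee_fin exprn_ge0.
apply: lee_nneseries => n _; first by move=> _; rewrite lee_fin.
rewrite -EFinM lee_fin; have [_ /andP[h _]] := H n.
apply: (@le_trans _ _ (c^-1 * (cmod z ^+ (2 * n) / peak n))).
  rewrite [leRHS]mulrCA -invfM ler_wpM2l ?exprn_ge0 ?cmod_ge0//.
  by rewrite lef_pV2// posrE ?mono_norm_gt0// mulr_gt0 ?peak_gt0.
rewrite -!mulrA ler_wpM2l ?invr_ge0 ?(ltW c0)//.
apply: le_trans (pow_peak z n) _; rewrite ler_wpM2l//; apply: HD.
have := distn_trunc n (index_ge0 alpha_gt0 z); rewrite -/(kap alpha z).
move: (2 * alpha * logmod z) => x; rewrite -natr1.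
have := ler_normB (n%:R + 1 - x) 1.
have -> : n%:R + 1 - x - 1 = n%:R - x by ring.
by rewrite normr1; lra.
Qed.

Lemma ker_coeff_entire z : entire_coeffs (ker_coeff z).
Proof.
have [c [C [c0 C0 H]]] := mono_norm_bounds.
apply: (@entire_of_decay _ (c^-1 * expR (phi z))) => n.
have [_ /andP[h _]] := H n.
rewrite cmod_ker_coeff; apply: (@le_trans _ _ (c^-1 * (cmod z ^+ n / peak n))).
  rewrite [leRHS]mulrCA -invfM ler_wpM2l ?exprn_ge0 ?cmod_ge0//.
  by rewrite lef_pV2// posrE ?mono_norm_gt0// mulr_gt0 ?peak_gt0.
rewrite -mulrA ler_wpM2l ?invr_ge0 ?(ltW c0)// -expRN -expRD.
apply: le_trans (ler_wpM2r (expR_ge0 _) (cmodX_le _ _)) _.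
rewrite -expRD ler_expR phiE.
have := square_complete alpha_gt0 n%:R (logmod z).
have : 0 <= (4 * alpha)^-1 * (n%:R - 2 * alpha * logmod z) ^+ 2.
  by rewrite mulr_ge0 ?sqr_ge0// invr_ge0 mulr_ge0// ltW.
have E : n%:R ^+ 2 / (2 * alpha) = 2 * (n%:R ^+ 2 / (4 * alpha)) by field; rewrite gt_eqF.
have : n%:R ^+ 2 / (2 * alpha) <= n.+1%:R ^+ 2 / (2 * alpha).
  rewrite ler_pM2r ?invr_gt0 ?mulr_gt0// -natr1.
  by have : 0 <= (n%:R : R) by []; nra.
by rewrite E; lra.
Qed.

Lemma fock_sum_ker_coeff_fin z : (fock_sum (ker_coeff z) < +oo)%E.
Proof.
have [c [C [_ _ /(_ z)/andP[_ h]]]] := ker_diag_bounds.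
by rewrite fock_sum_ker_coeff; apply: le_lt_trans h _; rewrite ltry.
Qed.

Lemma conj_ker_coeff z n : (ker_coeff z n)^* * (mono_norm n)%:C = z ^+ n.
Proof.
have E : (ker_coeff z n)^*%R = z ^+ n / (mono_norm n)%:C.
  rewrite /ker_coeff rmorphM rmorphXn fmorphV; congr (_ ^+ _ / _); first exact: conjCK.
  by apply/eqP; rewrite eq_complex /= oppr0 !eqxx.
rewrite E mulfVK//; apply/eqP => -[/eqP].
by rewrite gt_eqF ?mono_norm_gt0.
Qed.

Lemma ker_coeff_reproducing z a : entire_coeffs a -> (fock_sum a < +oo)%E ->
  pser a z = inner2 phi (pser a) (pser (ker_coeff z)).
Proof.
move=> Ea fa; rewrite inner2_pser//; [|exact: ker_coeff_entire|exact: fock_sum_ker_coeff_fin].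
by apply: eq_csum => n; rewrite -mulrA conj_ker_coeff.
Qed.

(** The explicit series shows that the set from which [xget] chooses is nonempty; testing the chosen
    kernel on monomials determines its coefficients. *)
Lemma repr_kernelE z : repr_kernel phi z = pser (ker_coeff z).
Proof.
have [fk Hk] : fock2 phi (repr_kernel phi z) /\ forall f, fock2 phi f ->
    f z = inner2 phi f (repr_kernel phi z).
  apply: (@xgetPex _ (fun=> 0) [set k | fock2 phi k /\
    forall f, fock2 phi f -> f z = inner2 phi f k]); exists (pser (ker_coeff z)); split.
    apply/fock2P; exists (ker_coeff z); split => //; [exact: ker_coeff_entire|exact: fock_sum_ker_coeff_fin].
  by move=> f /fock2P[a [Ea -> fa]]; exact: ker_coeff_reproducing.
move/fock2P : (fk) => [b [Eb Kb fb]]; rewrite Kb; congr pser; apply/funext => n.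
have : fock2 phi (pser (monomial n)).
  apply/fock2P; exists (monomial n); split => //; [exact: monomial_coeffs|exact: fock_sum_monomial].
move/Hk; rewrite Kb inner2_pser//; [|exact: monomial_coeffs|exact: fock_sum_monomial].
rewrite pser_monomial => Hn.
have {}Hn : z ^+ n = (b n)^* * (mono_norm n)%:C.
  rewrite Hn -[RHS](csum_monomial n (fun k => (b k)^* * (mono_norm k)%:C)).
  by apply: eq_csum => k; rewrite mulrA.
have nn0 : (mono_norm n)%:C != 0 by apply/eqP => -[/eqP]; rewrite gt_eqF ?mono_norm_gt0.
have : (ker_coeff z n)^*%R = (b n)^*%R.
  by apply: (mulIf nn0); rewrite conj_ker_coeff.
by move/(congr1 (@conjc R)); rewrite !conjcK.
Qed.

Lemma Re_repr_kernel z : complex.Re (repr_kernel phi z z) = fine (ker_diag z).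
Proof.
rewrite repr_kernelE -Re_csum_real; last first.
  by move=> n; rewrite divr_ge0 ?mono_norm_ge0// exprn_ge0// cmod_ge0.
congr complex.Re; apply: eq_csum => n.
have -> : (cmod z ^+ (2 * n) / mono_norm n)%:C = (cmod z ^+ 2)%:C ^+ n / (mono_norm n)%:C.
  by rewrite -rmorphXn -fmorphV -rmorphM exprM.
by rewrite -mulc_conj /ker_coeff exprMn mulrAC [z ^+ n * _]mulrC.
Qed.

Theorem kernel_weight : exists c C : R, [/\ 0 < c, 0 < C & forall z,
  c * (wt z * expR (2 * logmod z)) <= (complex.Re (repr_kernel phi z z))^-1 <=
  C * (wt z * expR (2 * logmod z))].
Proof.
have [c [C [c0 C0 H]]] := ker_diag_bounds.
exists C^-1, c^-1; split => [||z]; rewrite ?invr_gt0//.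
rewrite Re_repr_kernel; have /andP[h1 h2] := H z.
have fk : ker_diag z \is a fin_num.
  by rewrite fin_real// (lt_le_trans _ h1) ?ltNyr//= (le_lt_trans h2)// ltry.
rewrite -(fineK fk) !lee_fin in h1 h2.
have -> : wt z * expR (2 * logmod z) = (expR (2 * phi z - 2 * logmod z))^-1.
  by rewrite -expRN /wt -expRD; congr expR; ring.
have e0 := expR_gt0 (2 * phi z - 2 * logmod z).
have k0 : 0 < fine (ker_diag z) by apply: lt_le_trans h1; rewrite mulr_gt0.
by rewrite -!invfM !lef_pV2 ?h1 ?h2// ?posrE// mulr_gt0.
Qed.

End reproducing_kernel.

(** * The two Fock spaces in terms of coefficients *)

Section sup_norm_space.
Context {R : realType}.
Variable alpha : R.
Hypothesis alpha_gt0 : 0 < alpha.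
Notation phi := (logsq_weight alpha).
Notation mu := (@planar_lebesgue R).
Implicit Types (a b c v : nat -> R[i]) (z : R[i]) (f : R[i] -> R[i]) (L : set R[i]).

Definition decay n : R := expR (- (n%:R ^+ 2 / (4 * alpha))).

Lemma decay_gt0 n : 0 < decay n. Proof. exact: expR_gt0. Qed.

Lemma decay_neq0 n : (decay n)%:C != 0 :> R[i].
Proof. by rewrite -cmod_gt0 cmod_real normr_gt0 gt_eqF ?decay_gt0. Qed.

Lemma cmod_decay n : cmod (decay n)%:C = decay n.
Proof. by rewrite cmod_real gtr0_norm ?decay_gt0. Qed.

Definition coef c n : R[i] := (decay n)%:C * c n.

Lemma coef_entire c : bounded_seq c -> entire_coeffs (coef c).
Proof.
move=> [B HB]; apply: (@entire_of_decay _ _ alpha_gt0 _ B) => n.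
by rewrite /coef cmodM cmod_decay mulrC ler_wpM2r// ltW ?decay_gt0.
Qed.

Lemma row_applyE c z : entire_coeffs (coef c) ->
  row_apply (entry alpha) c z = (expR (- phi z))%:C * pser (coef c) z.
Proof.
move=> Ec; rewrite /row_apply /pser -csumZ; last exact: entire_csummable.
by apply: eq_csum => n; rewrite /entry /coef /decay rmorphM/=; ring.
Qed.

Lemma cmod_row_apply c z : entire_coeffs (coef c) ->
  cmod (row_apply (entry alpha) c z) = cmod (pser (coef c) z) * expR (- phi z).
Proof.
by move=> Ec; rewrite row_applyE// cmodM cmod_real ger0_norm ?expR_ge0// mulrC.
Qed.

Lemma coef_exists a : exists c, a = coef c.
Proof.
exists (fun n => a n / (decay n)%:C); apply/funext => n.
by rewrite /coef mulrC divfK// decay_neq0.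
Qed.

Lemma radial_annulus n : radial (fun z => wt alpha z *
  ((expR (n.+1%:R / (2 * alpha)) <= cmod z <= 2 * expR (n.+1%:R / (2 * alpha)))%R)%:R).
Proof.
have [W0 mW Wr] := radial_wt alpha_gt0; split.
- by move=> z; case: (expR _ <= cmod z <= _); rewrite ?mulr1 ?mulr0 ?lexx ?ler01.
- apply: measurable_funM => //.
  rewrite (_ : (fun p => _) = fun p : measurableTypeR R * measurableTypeR R =>
     if (expR (n.+1%:R / (2 * alpha)) <= cmod (to_complex p)) &&
     (cmod (to_complex p) <= 2 * expR (n.+1%:R / (2 * alpha))) then (1 : R) else 0); last first.
    by apply/funext => p; case: ifP.
  have mc := @measurable_cmod_to_complex R.
  apply: measurable_fun_ifT; [|exact: measurable_cst..].
  by apply: measurable_and; apply: measurable_fun_ler => //; exact: measurable_cst.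
- by move=> z; rewrite Wr cmodM cmod_rot_unit mul1r.
Qed.

(* Parseval for the weight restricted to the annulus where |z|^(2n) e^(-2 phi) peaks. *)
Lemma coef_bound : exists2 K : R, 0 < K & forall c (M : R), entire_coeffs (coef c) ->
  (forall z, cmod (pser (coef c) z) * expR (- phi z) <= M) ->
  forall n, cmod (c n) <= K * M.
Proof.
(* The factor 32 is 2 from [moment_lower] times 16 r^2, the area bound for the disc of radius 2 r.
   In r^2 / (decay n ^+ 2 * peak n) the dependence on n cancels and e^(1 / (2 alpha)) remains. The
   estimate is for squares, and K >= 1 allows K^2 in place of K. *)
pose K := 32 * expR (2 * alpha + 2 + (2 * alpha)^-1).
have K1 : 1 <= K.
  rewrite -[leLHS]mulr1; apply: ler_pM; rewrite ?ler1n// -expR0 ler_expR.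
  by rewrite !addr_ge0 ?mulr_ge0 ?invr_ge0 ?mulr_ge0 ?(ltW alpha_gt0).
exists K => [|c M Ec HM n]; first exact: lt_le_trans K1.
have M0 : 0 <= M.
  by apply: le_trans (HM 0); rewrite mulr_ge0 ?expR_ge0 ?cmod_ge0.
have rW := radial_annulus n; set W := fun z => _ in rW.
set r := expR (n.+1%:R / (2 * alpha)) in W rW.
have r0 : 0 < r := expR_gt0 _.
have lo := @moment_lower _ _ alpha_gt0 W n rW.
have {}lo : ((2^-1 * expR (- (2 * alpha + 2)) * peak alpha n)%:E <= moment W n)%E.
  by apply: lo => z zr; rewrite /W zr mulr1.
pose D := [set p : measurableTypeR R * measurableTypeR R | cmod (to_complex p) <= 2 * r].
have mD : measurable D := measurable_disc _.
have Ia : ((cmod (coef c n) ^+ 2)%:E * (2^-1 * expR (- (2 * alpha + 2)) * peak alpha n)%:E <=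
    (M ^+ 2 * (4 * (2 * r) ^+ 2))%:E)%E.
  apply: (@le_trans _ _ ((cmod (coef c n) ^+ 2)%:E * moment W n)%E).
    by rewrite lee_wpmul2l// lee_fin sqr_ge0.
  apply: (@le_trans _ _ (\sum_(0 <= k <oo) (cmod (coef c k) ^+ 2)%:E * moment W k)%E).
    have m0 k : (0 <= (cmod (coef c k) ^+ 2)%:E * moment W k)%E.
      by rewrite mule_ge0 ?lee_fin ?sqr_ge0 ?moment_ge0.
    exact: nneseries_ge_eterm m0.
  rewrite -(parseval rW Ec).
  apply: (@le_trans _ _ (\int[mu]_p ((M ^+ 2)%:E * (\1_D p)%:E))%E).
    have [W0 mW _] := rW.
    apply: ge0_le_integral => //.
    - move=> p _; rewrite lee_fin mulr_ge0 ?sqr_ge0//.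
      by case/andP: (W0 (to_complex p)).
    - apply/measurable_EFinP/measurable_funM => //.
      by apply: measurable_funX; apply: measurable_cmod => //; exact: cmeasurable_pser.
    - by apply: emeasurable_funM => //; apply/measurable_EFinP.
    move=> p _; rewrite -EFinM lee_fin /W; set z := to_complex p.
    have [/andP[_ z2]|_] := boolP (r <= cmod z <= 2 * r)%R; last first.
      by rewrite !mulr0 mulr_ge0 ?sqr_ge0.
    rewrite (_ : \1_D p = 1) ?mulr1; last by rewrite indicE mem_set.
    have -> : wt alpha z = expR (- phi z) ^+ 2.
      by rewrite /wt expr2 -expRD; congr expR; ring.
    by rewrite -exprMn lerXn2r ?nnegrE ?mulr_ge0 ?expR_ge0 ?cmod_ge0.
  rewrite ge0_integralZl_EFin ?sqr_ge0//; last exact/measurable_EFinP.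
  rewrite integral_indic// setIT (EFinM (M ^+ 2)) lee_wpmul2l ?lee_fin ?sqr_ge0//.
  by apply: disc_area; rewrite mulr_ge0// ltW.
rewrite -EFinM lee_fin /coef cmodM cmod_decay in Ia.
have E1 : (2 * r) ^+ 2 = 4 * expR (n.+1%:R / alpha).
  rewrite exprMn /r -expRM_natl (_ : 2 ^+ 2 = 4); last by ring.
  by congr (_ * expR _); field; rewrite gt_eqF.
have E2 : K = 32 * (expR (2 * alpha + 2) * expR (n.+1%:R / alpha)) *
    (decay n ^+ 2 * peak alpha n)^-1.
  rewrite /K /decay /peak -expRM_natl -!expRD -expRN -mulrA -!expRD; congr (_ * expR _).
  by rewrite -natr1; field; rewrite gt_eqF.
have c2 : cmod (c n) ^+ 2 <= (K * M) ^+ 2.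
  apply: (@le_trans _ _ (K * M ^+ 2)); last first.
    rewrite exprMn ler_wpM2r ?sqr_ge0// expr2 ler_peMl//.
    exact: le_trans K1.
  rewrite E2 E1 expRN in Ia *.
  have q0 : 0 < decay n ^+ 2 * peak alpha n.
    by apply: mulr_gt0; [exact/exprn_gt0/decay_gt0|exact: peak_gt0].
  rewrite mulrAC ler_pdivlMr//.
  have e0 := expR_gt0 (2 * alpha + 2).
  have {}Ia : (decay n * cmod (c n)) ^+ 2 * peak alpha n * (2^-1 / expR (2 * alpha + 2)) <=
    M ^+ 2 * (4 * (4 * expR (n.+1%:R / alpha))).
    by apply: le_trans Ia; rewrite le_eqVlt; apply/orP; left; apply/eqP; ring.
  rewrite -ler_pdivlMr ?divr_gt0// in Ia.
  have -> : cmod (c n) ^+ 2 * (decay n ^+ 2 * peak alpha n) =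
    (decay n * cmod (c n)) ^+ 2 * peak alpha n by ring.
  apply: le_trans Ia _; rewrite le_eqVlt; apply/orP; left; apply/eqP.
  by field; rewrite gt_eqF.
rewrite -(@ler_pXn2r _ 2%N)// nnegrE ?cmod_ge0// mulr_ge0//.
exact: le_trans K1.
Qed.

Lemma norm_infty_le f (M : R) :
  (norm_infty phi f <= M%:E)%E <-> forall z, cmod (f z) * expR (- phi z) <= M.
Proof.
split=> [h z|h].
  rewrite -lee_fin; apply: le_trans h.
  by apply: ereal_sup_ubound; exists z.
by apply: ge_ereal_sup => _ [z _ <-]; rewrite lee_fin.
Qed.

Lemma norm_infty_fin f : (norm_infty phi f < +oo)%E ->
  exists2 M : R, 0 <= M & norm_infty phi f = M%:E.
Proof.
move=> h.
have h0 : (0 <= norm_infty phi f)%E.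
  apply: (@le_trans _ _ (cmod (f 0) * expR (- phi 0))%:E).
    by rewrite lee_fin mulr_ge0 ?expR_ge0 ?cmod_ge0.
  by apply: ereal_sup_ubound; exists 0.
exists (fine (norm_infty phi f)); first exact: fine_ge0.
by rewrite fineK// ge0_fin_numE.
Qed.

Lemma seq_norm_infty_le L f (M : R) : 0 <= M ->
  (seq_norm_infty phi L f <= M%:E)%E <->
  forall l, L l -> cmod (f l) * expR (- phi l) <= M.
Proof.
move=> M0; rewrite /seq_norm_infty; split=> [h l Ll|h].
  rewrite -lee_fin; apply: le_trans h; rewrite le_max; apply/orP; right.
  by apply: ereal_sup_ubound; exists l.
rewrite ge_max lee_fin M0/=.
by apply: ge_ereal_sup => _ [z zL <-]; rewrite lee_fin h.
Qed.

Lemma seq_norm_infty_ge0 L f : (0 <= seq_norm_infty phi L f)%E.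
Proof. by rewrite /seq_norm_infty le_max lexx. Qed.

Lemma fock_inftyP f : fock_infty phi f <->
  exists c, bounded_seq c /\ f = pser (coef c).
Proof.
split=> [[/entire_power_series[a Ea fa] fi]|[c [Bc ->]]].
  have {}fa : f = pser a by exact/funext.
  have [c ac] := coef_exists a; exists c; split; last by rewrite fa ac.
  have [M M0 HM] := norm_infty_fin fi.
  have [K K0 HK] := coef_bound; exists (K * M) => n.
  apply: HK; first by rewrite -ac.
  by apply/norm_infty_le; rewrite -ac -fa HM.
have Ec := coef_entire Bc.
split; first exact: pser_entire.
have [C C0 HC] := entry_decay alpha_gt0.
have [B HB] := Bc.
apply: (@le_lt_trans _ _ (C * B * 4)%:E); last by rewrite ltry.
apply/norm_infty_le => z; rewrite -cmod_row_apply//.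
by case: (row_bound C0 HC z HB).
Qed.

Theorem complete_interpolating_inftyP L :
  complete_interpolating_infty phi L <-> cis_sup L (entry alpha).
Proof.
have [K K0 HK] := coef_bound.
have [C C0 HC] := entry_decay alpha_gt0.
have phiK z : expR (- phi z) * expR (phi z) = 1 by rewrite -expRD addNr expR0.
split=> [[[S S0 HS] I]|[[S S0 HS] I]]; split.
- exists (K * S) => [|c M Bc M0 HM n]; first by rewrite mulr_gt0.
  have Ec := coef_entire Bc.
  rewrite -mulrA; apply: HK => //; apply/norm_infty_le.
  apply: le_trans (HS _ _) _; first by apply/fock_inftyP; exists c.
  rewrite EFinM lee_wpmul2l ?lee_fin ?(ltW S0)//.
  by apply/seq_norm_infty_le => // l Ll; rewrite -cmod_row_apply// HM.
- move=> v M HM.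
  have := I (fun l => v l * (expR (phi l))%:C).
  case.
    apply: (@le_lt_trans _ _ (Num.max 0 M)%:E); last by rewrite ltry.
    apply/seq_norm_infty_le => [|l Ll]; first by rewrite le_max lexx.
    rewrite cmodM cmod_real ger0_norm ?expR_ge0// -mulrA [_ * expR _]mulrC phiK mulr1.
    by rewrite le_max HM ?orbT.
  move=> _ /fock_inftyP[c [Bc ->]] H; exists c => // l Ll.
  rewrite row_applyE ?H//; last exact: coef_entire.
  by rewrite mulrCA -rmorphM/= phiK mulr1.
(* The values on L bound the sequence c, and the absolute row sums, at most 4 C, then bound f at
   every point of the plane. *)
- exists (C * 4 * S) => [|_ /fock_inftyP[c [Bc ->]]]; first by rewrite !mulr_gt0.
  have Ec := coef_entire Bc.
  have := seq_norm_infty_ge0 L (pser (coef c)).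
  case E : (seq_norm_infty phi L (pser (coef c))) => [M||] // M0; last first.
    by rewrite gt0_muley ?lte_fin ?mulr_gt0// leey.
  rewrite lee_fin in M0.
  have {}E : forall l, L l -> cmod (row_apply (entry alpha) c l) <= M.
    by move=> l Ll; rewrite cmod_row_apply//; apply/seq_norm_infty_le: l Ll => //; rewrite E.
  rewrite -EFinM; apply/norm_infty_le => z; rewrite -cmod_row_apply//.
  have cS := HS c M Bc M0 E.
  have [_ /le_trans] := row_bound C0 HC z cS; apply.
  by rewrite le_eqVlt; apply/orP; left; apply/eqP; ring.
- move=> v vf.
  have v0 := seq_norm_infty_ge0 L v.
  have vE : seq_norm_infty phi L v = (fine (seq_norm_infty phi L v))%:E.
    by rewrite fineK// ge0_fin_numE.
  have [l Ll|c Bc Hc] := I (fun l => v l * (expR (- phi l))%:C) (fine (seq_norm_infty phi L v)).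
    rewrite cmodM cmod_real ger0_norm ?expR_ge0//.
    by apply/seq_norm_infty_le: l Ll; rewrite ?fine_ge0// -vE.
  exists (pser (coef c)); first by apply/fock_inftyP; exists c.
  move=> l Ll; have := Hc l Ll; rewrite row_applyE; last exact: coef_entire.
  rewrite mulrC; apply: mulIf.
  by rewrite -cmod_gt0 cmod_real normr_gt0 gt_eqF ?expR_gt0.
Qed.

End sup_norm_space.

(** * Weighted square sums of coefficients and of values *)

Section weighted_sums.
Context {R : realType}.
Implicit Types (a b : nat -> R[i]) (z l : R[i]) (f g h : R[i] -> R[i]) (L : set R[i])
  (p q : nat -> R) (w : R[i] -> R).
Local Open Scope ereal_scope.

Lemma le_chain (A B : R) (x y z : \bar R) : (0 <= A)%R ->
  x <= A%:E * y -> y <= B%:E * z -> x <= (A * B)%R%:E * z.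
Proof.
move=> A0 xy yz; apply: le_trans xy _.
by rewrite EFinM -muleA lee_wpmul2l.
Qed.

Lemma sqrte_le_scale (k : R) (x y : \bar R) : (0 < k)%R -> 0 <= x -> 0 <= y ->
  (sqrte x <= k%:E * sqrte y) = (x <= (k ^+ 2)%:E * y).
Proof.
move=> k0 x0 y0.
have -> : k%:E = sqrte (k ^+ 2)%:E.
  by rewrite /= sqrtr_sqr ger0_norm// ltW.
by rewrite -sqrteM ?lee_fin ?sqr_ge0// lee_sqrt// mule_ge0// lee_fin sqr_ge0.
Qed.

Definition wsum p a : \bar R := \sum_(0 <= n <oo) (cmod (a n) ^+ 2 * p n)%:E.

Definition wsq L w f : \bar R := \esum_(l in L) (cmod (f l) ^+ 2 * w l)%:E.

Lemma wsum_ge0 p a : (forall n, 0 <= p n)%R -> 0 <= wsum p a.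
Proof. by move=> p0; apply: nneseries_ge0 => n _ _; rewrite lee_fin mulr_ge0 ?sqr_ge0. Qed.

Lemma wsq_ge0 L w f : (forall l, 0 <= w l)%R -> 0 <= wsq L w f.
Proof. by move=> w0; apply: esum_ge0 => l _; rewrite lee_fin mulr_ge0 ?sqr_ge0. Qed.

Lemma wsum_le p q a b (C : R) : (forall n, 0 <= p n)%R -> (forall n, 0 <= q n)%R -> (0 <= C)%R ->
  (forall n, cmod (a n) ^+ 2 * p n <= C * (cmod (b n) ^+ 2 * q n))%R ->
  wsum p a <= C%:E * wsum q b.
Proof.
move=> p0 q0 C0 H; rewrite -nneseriesZl; last first.
  by move=> n _; rewrite lee_fin mulr_ge0 ?sqr_ge0.
apply: lee_nneseries => n _; first by move=> _; rewrite lee_fin mulr_ge0 ?sqr_ge0.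
by rewrite -EFinM lee_fin.
Qed.

Lemma wsumD p a b : (forall n, 0 <= p n)%R ->
  wsum p (fun n => a n + b n)%R <= 2%:E * (wsum p a + wsum p b).
Proof.
move=> p0; rewrite -nneseriesD; last 2 first.
  by move=> n _; rewrite lee_fin mulr_ge0 ?sqr_ge0.
  by move=> n _; rewrite lee_fin mulr_ge0 ?sqr_ge0.
rewrite -nneseriesZl; last first.
  by move=> n _; rewrite adde_ge0// lee_fin mulr_ge0 ?sqr_ge0.
apply: lee_nneseries => n _; first by move=> _; rewrite lee_fin mulr_ge0 ?sqr_ge0.
rewrite -EFinD -EFinM lee_fin -mulrDl mulrA ler_wpM2r// mulrDr.
exact: cmod_sqD_le.
Qed.

Lemma wsq_le L w w' f g (C : R) : (forall l, 0 <= w' l)%R -> (0 <= C)%R ->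
  (forall l, L l -> cmod (f l) ^+ 2 * w l <= C * (cmod (g l) ^+ 2 * w' l))%R ->
  wsq L w f <= C%:E * wsq L w' g.
Proof.
move=> w0 C0 H; apply: le_trans (esumZl_le C0 _); last first.
  by move=> l _; rewrite lee_fin mulr_ge0 ?sqr_ge0.
by apply: le_esum => l Ll; rewrite -EFinM lee_fin H.
Qed.

Lemma eq_wsq L w f g : (forall l, L l -> f l = g l) -> wsq L w f = wsq L w g.
Proof. by move=> fg; apply: eq_esum => l Ll; rewrite fg. Qed.

Lemma wsqD L w f g : (forall l, 0 <= w l)%R ->
  wsq L w (fun l => f l + g l)%R <= 2%:E * (wsq L w f + wsq L w g).
Proof.
move=> w0; rewrite -esumD; last 2 first.
  by move=> l _; rewrite lee_fin mulr_ge0 ?sqr_ge0.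
  by move=> l _; rewrite lee_fin mulr_ge0 ?sqr_ge0.
apply: le_trans (esumZl_le _ _); rewrite ?ler0n//; last first.
  by move=> l _; rewrite adde_ge0// lee_fin mulr_ge0 ?sqr_ge0.
apply: le_esum => l Ll; rewrite -EFinD -EFinM lee_fin -mulrDl mulrA ler_wpM2r//.
by rewrite mulrDr cmod_sqD_le.
Qed.

Lemma wsqZ L w f (c : R[i]) : (forall l, 0 <= w l)%R ->
  wsq L w (fun l => c * f l)%R <= (cmod c ^+ 2)%:E * wsq L w f.
Proof.
move=> w0; apply: wsq_le; rewrite ?sqr_ge0// => l _.
by rewrite cmodM exprMn mulrA.
Qed.

Lemma wsq_setD1 L w f l : (forall l, 0 <= w l)%R -> L l ->
  wsq L w f = (cmod (f l) ^+ 2 * w l)%:E + wsq (L `\ l) w f.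
Proof.
move=> w0 Ll; rewrite /wsq (esumID [set l]); last first.
  by move=> k _; rewrite lee_fin mulr_ge0 ?sqr_ge0.
congr (_ + _); rewrite (_ : L `&` [set l] = [set l]) ?esum_set1//.
  by rewrite lee_fin mulr_ge0 ?sqr_ge0.
by apply/seteqP; split => [k []//|k /= ->].
Qed.

Lemma wsq_subD1 L w f l : (forall l, 0 <= w l)%R -> wsq (L `\ l) w f <= wsq L w f.
Proof.
move=> w0; rewrite [leRHS](esumID [set l]); last first.
  by move=> k _; rewrite lee_fin mulr_ge0 ?sqr_ge0.
by rewrite leeDr// esum_ge0// => k _; rewrite lee_fin mulr_ge0 ?sqr_ge0.
Qed.

(** Complete interpolation for the Hilbert space in which the z^n are orthogonal with squared norms
    p n, the values on L being weighted by w. The pair ([gauss], [wt]) describes H, the pair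
    ([peak], [wt1]) describes F^2 up to equivalent norms. *)
Definition cis_weighted p w L : Prop :=
  (exists2 K : R, (0 < K)%R & forall a, entire_coeffs a -> wsum p a < +oo ->
     wsum p a <= K%:E * wsq L w (pser a) /\ wsq L w (pser a) <= K%:E * wsum p a) /\
  (forall v, wsq L w v < +oo -> exists a, [/\ entire_coeffs a, wsum p a < +oo &
     forall l, L l -> pser a l = v l]).

End weighted_sums.

Section reductions.
Context {R : realType}.
Variable alpha : R.
Hypothesis alpha_gt0 : 0 < alpha.
Notation phi := (logsq_weight alpha).
Implicit Types (a b c : nat -> R[i]) (z l : R[i]) (f v : R[i] -> R[i]) (L : set R[i]).

(** This is q^(-2 n^2), the squared norm of z^n in H. *)
Definition gauss n : R := expR (n%:R ^+ 2 / (2 * alpha)).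

Lemma gauss_ge0 n : 0 <= gauss n. Proof. exact: expR_ge0. Qed.

Lemma gauss_decay_sq n : gauss n * decay alpha n ^+ 2 = 1.
Proof.
rewrite /gauss /decay -expRM_natl -expRD -[RHS]expR0; congr expR.
by field; rewrite gt_eqF.
Qed.

Lemma wsum_coef c : wsum gauss (coef alpha c) = l2sq c.
Proof.
apply: eq_eseriesr => n _; congr (_%:E).
by rewrite /coef cmodM cmod_decay exprMn mulrAC [_ * gauss n]mulrC gauss_decay_sq mul1r.
Qed.

(** Comparable to 1 / k_z(z), by [kernel_weight]. *)
Definition wt1 z : R := wt alpha z * expR (2 * logmod z).

Lemma wt_ge0 z : 0 <= wt alpha z. Proof. exact: expR_ge0. Qed.

Lemma wt1_ge0 z : 0 <= wt1 z. Proof. by rewrite mulr_ge0 ?expR_ge0. Qed.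

Lemma wtE z : wt alpha z = expR (- phi z) ^+ 2.
Proof. by rewrite /wt expr2 -expRD; congr expR; ring. Qed.

Lemma gauss_sum_entire a (p : nat -> R) : (forall n, gauss n <= p n) ->
  (wsum p a < +oo)%E -> entire_coeffs a.
Proof.
move=> gp fa; have [c ac] := coef_exists alpha a.
rewrite ac; apply: (coef_entire alpha_gt0); apply: l2_bounded; rewrite -wsum_coef -ac.
apply: le_lt_trans fa; rewrite -[leRHS]mul1e.
have p0 n : 0 <= p n := le_trans (gauss_ge0 n) (gp n).
apply: wsum_le => //; first exact: gauss_ge0.
by move=> n; rewrite mul1r ler_wpM2l ?sqr_ge0.
Qed.

Lemma cis_weighted_l2 L : cis_l2 L (entry alpha) <-> cis_weighted gauss (wt alpha) L.
Proof.
have phiK z : expR (- phi z) * expR (phi z) = 1 by rewrite -expRD addNr expR0.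
have rowE c : entire_coeffs (coef alpha c) ->
    l2sq_on L (row_apply (entry alpha) c) = wsq L (wt alpha) (pser (coef alpha c)).
  move=> Ec; apply: eq_esum => l _; congr (_%:E).
  by rewrite cmod_row_apply// exprMn wtE.
have entE c : (l2sq c < +oo)%E -> entire_coeffs (coef alpha c).
  by move=> cf; apply: (coef_entire alpha_gt0); exact: l2_bounded.
split=> [[[K K0 HK] I]|[[K K0 HK] I]]; split.
- exists K => // a Ea fa; have [c ac] := coef_exists alpha a.
  rewrite ac wsum_coef in Ea fa *.
  by have := HK c fa; rewrite rowE.
- move=> v vf; have [|c cf Hc] := I (fun l => (expR (- phi l))%:C * v l).
    apply: le_lt_trans vf; rewrite le_eqVlt; apply/orP; left; apply/eqP.
    apply: eq_esum => l _; congr (_%:E).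
    by rewrite cmodM cmod_real ger0_norm ?expR_ge0// exprMn mulrC wtE.
  exists (coef alpha c); split; rewrite ?wsum_coef//; first exact: entE.
  move=> l Ll; have := Hc l Ll; rewrite row_applyE; last exact: entE.
  by apply: mulfI; rewrite -cmod_gt0 cmod_real normr_gt0 gt_eqF ?expR_gt0.
- exists K => // c cf; have Ec := entE c cf; rewrite -wsum_coef rowE//.
  by apply: HK => //; rewrite wsum_coef.
- move=> v vf; have [|a [Ea fa Ha]] := I (fun l => (expR (phi l))%:C * v l).
    apply: le_lt_trans vf; rewrite le_eqVlt; apply/orP; left; apply/eqP.
    apply: eq_esum => l _; congr (_%:E).
    rewrite cmodM cmod_real ger0_norm ?expR_ge0// exprMn mulrAC wtE -exprMn.
    by rewrite [expR _ * expR _]mulrC phiK expr1n mul1r.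
  have [c ac] := coef_exists alpha a; rewrite ac in Ea fa Ha.
  exists c; first by rewrite -wsum_coef.
  move=> l Ll; rewrite row_applyE// Ha// mulrA -rmorphM/= phiK mul1r//.
Qed.

Lemma cis_weighted_fock2 L : complete_interpolating2 phi L <-> cis_weighted (peak alpha) wt1 L.
Proof.
have [n1 [n2 [n10 n20 Hn]]] := mono_norm_bounds alpha_gt0.
have [k1 [k2 [k10 k20 Hk]]] := kernel_weight alpha_gt0.
have p0 n : 0 <= peak alpha n := expR_ge0 _.
have nn0 := mono_norm_ge0 alpha_gt0.
have fs a : fock_sum alpha a = wsum (mono_norm alpha) a by [].
have fsum_le a : (fock_sum alpha a <= n2%:E * wsum (peak alpha) a)%E.
  rewrite fs; apply: wsum_le => //; first exact: ltW.
  by move=> n; rewrite mulrCA ler_wpM2l ?sqr_ge0//; case: (Hn n) => _ /andP[].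
have fsum_ge a : (wsum (peak alpha) a <= n1^-1%:E * fock_sum alpha a)%E.
  rewrite fs; apply: wsum_le => //; first by rewrite invr_ge0 ltW.
  move=> n; rewrite mulrCA ler_wpM2l ?sqr_ge0// ler_pdivlMl//.
  by case: (Hn n) => _ /andP[].
pose w z := (complex.Re (repr_kernel phi z z))^-1.
have w0 z : 0 <= w z.
  have /andP[h _] := Hk z; apply: le_trans h.
  by rewrite mulr_ge0 ?(ltW k10)// mulr_ge0 ?expR_ge0.
have sE v : seq_norm2 phi L v = sqrte (wsq L w v) by [].
have S_le v : (wsq L w v <= k2%:E * wsq L wt1 v)%E.
  apply: wsq_le; [exact: wt1_ge0|exact: ltW|] => l _.
  by rewrite mulrCA ler_wpM2l ?sqr_ge0//; case/andP: (Hk l).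
have S_ge v : (wsq L wt1 v <= k1^-1%:E * wsq L w v)%E.
  apply: wsq_le => //; first by rewrite invr_ge0 ltW.
  move=> l _; rewrite [leRHS]mulrCA ler_wpM2l ?sqr_ge0// ler_pdivlMl//.
  by case/andP: (Hk l).
have fin_le (x y : \bar R) (k : R) : (x <= k%:E * y)%E -> 0 < k -> (y < +oo)%E -> (x < +oo)%E.
  move=> xy k0 yf; apply: le_lt_trans xy _.
  by apply: lte_mul_pinfty => //; rewrite lee_fin ltW.
have s0 v := wsq_ge0 L v w0.
have entP a : (fock_sum alpha a < +oo)%E -> entire_coeffs a.
  move=> fa; apply: (@gauss_sum_entire a (peak alpha)).
    move=> n; rewrite /peak ler_expR ler_pM2r ?invr_gt0 ?mulr_gt0//.
    by rewrite lerXn2r ?nnegrE// ler_nat.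
  by apply: fin_le (fsum_ge a) _ fa; rewrite invr_gt0.
split=> [[[k k0 Hs] I]|[[K K0 HK] I]]; split.
- exists (Num.max (n1^-1 * k ^+ 2 * k2) (k1^-1 * k ^+ 2 * n2)).
    by rewrite lt_max !mulr_gt0 ?invr_gt0 ?exprn_gt0.
  move=> a Ea fa.
  have ff : (fock_sum alpha a < +oo)%E by apply: fin_le (fsum_le a) _ fa.
  have [|h1 h2] := Hs (pser a); first by apply/(fock2P alpha_gt0); exists a.
  rewrite lee_pdivrMl// norm2_pser// sE sqrte_le_scale ?fock_sum_ge0// in h1.
  rewrite norm2_pser// sE sqrte_le_scale ?fock_sum_ge0// in h2.
  split.
    apply: le_trans (_ : _ <= (n1^-1 * k ^+ 2 * k2)%:E * _)%E _.
      apply: le_chain (S_le _); first by rewrite mulr_ge0 ?invr_ge0 ?sqr_ge0 ?(ltW n10).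
      by apply: le_chain h1; rewrite ?invr_ge0 ?(ltW n10).
    by rewrite lee_wpmul2r ?wsq_ge0 ?lee_fin ?le_max ?lexx//; exact: wt1_ge0.
  apply: le_trans (_ : _ <= (k1^-1 * k ^+ 2 * n2)%:E * _)%E _.
    apply: le_chain (fsum_le _); first by rewrite mulr_ge0 ?invr_ge0 ?sqr_ge0 ?(ltW k10).
    by apply: le_chain h2; rewrite ?invr_ge0 ?(ltW k10).
  by rewrite lee_wpmul2r ?wsum_ge0 ?lee_fin ?le_max ?lexx ?orbT.
- move=> v vf; have [|_ /(fock2P alpha_gt0)[a [Ea -> fa]] Ha] := I v.
    by rewrite sE sqrte_lty//; apply: fin_le (S_le v) _ vf.
  by exists a; split => //; apply: fin_le (fsum_ge a) _ fa; rewrite invr_gt0.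
(* The constants at hand compare squares of norms while [sampling2] compares norms; M >= 1 gives M
   <= M^2. *)
- pose M := Num.max 1 (Num.max (n2 * K * k1^-1) (k2 * K * n1^-1)).
  have M1 : 1 <= M by rewrite le_max lexx.
  have M0 : 0 < M := lt_le_trans ltr01 M1.
  have MM : M <= M ^+ 2 by rewrite expr2 ler_peMl// ltW.
  have MA : n2 * K * k1^-1 <= M ^+ 2 by apply: le_trans MM; rewrite !le_max lexx orbT.
  have MB : k2 * K * n1^-1 <= M ^+ 2 by apply: le_trans MM; rewrite !le_max lexx !orbT.
  exists M => // _ /(fock2P alpha_gt0)[a [Ea -> fa]].
  have ff : (wsum (peak alpha) a < +oo)%E.
    by apply: fin_le (fsum_ge a) _ fa; rewrite invr_gt0.
  have [h1 h2] := HK a Ea ff.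
  rewrite lee_pdivrMl// norm2_pser// sE !sqrte_le_scale ?fock_sum_ge0//; split.
    apply: (@le_trans _ _ ((n2 * K * k1^-1)%:E * wsq L w (pser a))%E).
      apply: le_chain (S_ge _); first by rewrite mulr_ge0 ?(ltW n20) ?(ltW K0).
      by apply: le_chain h1; rewrite ?(ltW n20).
    by rewrite lee_wpmul2r ?lee_fin.
  apply: (@le_trans _ _ ((k2 * K * n1^-1)%:E * fock_sum alpha a)%E).
    apply: le_chain (fsum_ge _); first by rewrite mulr_ge0 ?(ltW k20) ?(ltW K0).
    by apply: le_chain h2; rewrite ?(ltW k20).
  by rewrite lee_wpmul2r ?lee_fin ?fock_sum_ge0.
- move=> v; rewrite sE sqrte_lty// => vf.
  have [|a [Ea fa Ha]] := I v; first by apply: fin_le (S_ge v) _ vf; rewrite invr_gt0.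
  exists (pser a) => //; apply/(fock2P alpha_gt0); exists a; split => //.
  exact: fin_le (fsum_le a) _ fa.
Qed.

End reductions.

(** * Removing a point *)

Section division_norms.
Context {R : realType}.
Implicit Types (a b c g : nat -> R[i]) (z l : R[i]) (f v : R[i] -> R[i]) (L : set R[i]).

(** A quotient by z - l is known only off l. The radius r is chosen so that the punctured disc
    around 0 avoids l, and [series_coeff_eq0] applies there. *)
Lemma pser_eq_off a b l : entire_coeffs a -> entire_coeffs b ->
  (forall z, z != l -> pser a z = pser b z) -> a = b.
Proof.
move=> Ea Eb ab.
have Ed : entire_coeffs (fun n => a n + (-1) * b n) by exact/entire_coeffsD/entire_coeffsZ.
pose r := if l == 0 then 1 else cmod l.
have r0 : 0 < r by rewrite /r; case: eqP => // /eqP l0; rewrite cmod_gt0.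
have [M HM] := Ed r r0.
apply/funext => n; apply/eqP; rewrite -subr_eq0 -mulN1r; apply/eqP.
apply: (@series_coeff_eq0 _ (fun n => a n + (-1) * b n) M r r0) => [k|z z0 zr].
  by rewrite ler_pdivlMr ?exprn_gt0.
rewrite -/(pser (fun n => a n + (-1) * b n) z) pserD ?pserZ//; last exact: entire_coeffsZ.
rewrite ab ?mulN1r ?subrr//.
by apply/eqP => zl; move: zr z0; rewrite zl /r; case: eqP => // _; rewrite ltxx.
Qed.

Lemma pser_inj a b : entire_coeffs a -> entire_coeffs b -> pser a =1 pser b -> a = b.
Proof. by move=> Ea Eb ab; apply: (@pser_eq_off _ _ 0) => // z _; exact: ab. Qed.

Lemma entire_coeffs_shift a m : entire_coeffs a -> entire_coeffs (fun j => a (m + j)%N).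
Proof.
move=> Ea r r0; have [M HM] := Ea r r0; exists (M * r ^- m) => k.
by rewrite ler_pdivlMr ?exprn_gt0// -mulrA -exprD addnC.
Qed.

Lemma nneseries_shift_le (f : nat -> R) k : (forall n, 0 <= f n) ->
  (\sum_(0 <= n <oo) (f (n + k)%N)%:E <= \sum_(0 <= n <oo) (f n)%:E)%E.
Proof.
move=> f0; elim: k => [|k IH].
  by under eq_eseriesr do rewrite addn0.
apply: le_trans IH; rewrite [leRHS](nneseries_recl_shift (f := fun n => f (n + k)%N))//.
under eq_eseriesr do rewrite addnS -addSn.
by rewrite leeDr// lee_fin.
Qed.

Definition mul_root l g n : R[i] := (if n is m.+1 then g m else 0) + (- l) * g n.

Lemma entire_coeffs_cons g : entire_coeffs g ->
  entire_coeffs (fun n => if n is m.+1 then g m else 0).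
Proof.
move=> Eg r r0; have [M HM] := Eg r r0; exists (Num.max 0 (M * r)) => -[|k].
  by rewrite cmod0 mul0r le_max lexx.
by rewrite exprSr mulrA le_max ler_wpM2r ?orbT// ltW.
Qed.

Lemma mul_root_entire l g : entire_coeffs g -> entire_coeffs (mul_root l g).
Proof. by move=> Eg; apply: entire_coeffsD; [exact: entire_coeffs_cons|exact: entire_coeffsZ]. Qed.

Lemma pser_mul_root l g z : entire_coeffs g -> pser (mul_root l g) z = (z - l) * pser g z.
Proof.
move=> Eg; rewrite pserD ?pserZ//; [|exact: entire_coeffs_cons|exact: entire_coeffsZ].
rewrite mulrBl mulNr; congr (_ - _).
rewrite /pser csum_recl; last exact: (entire_csummable z (entire_coeffs_cons Eg)).
rewrite mul0r add0r -csumZ; last exact: entire_csummable.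
by apply: eq_csum => n; rewrite exprS mulrCA.
Qed.

Lemma wsum_monomial (p : nat -> R) n : (forall n, 0 <= p n) -> wsum p (monomial n) = (p n)%:E :> \bar R.
Proof.
move=> p0; rewrite -(nneseries_delta n (p0 n)); apply: eq_eseriesr => k _; congr (_%:E).
by rewrite /monomial; case: eqP => [->|_]; rewrite ?cmod1 ?cmod0 ?expr1n ?expr0n ?mul1r ?mul0r.
Qed.

(** Beyond |z| = 2 |l| + 1 one has |z - l| >= (1 + |z|) / 2 automatically. Inside, w is bounded
    below and has a finite sum, so only finitely many points occur, each at a positive distance from
    l. *)
Lemma isolated_points L (w : R[i] -> R) l : (forall z, 0 <= w z) ->
  (forall r, exists2 e, 0 < e & forall z, cmod z <= r -> e <= w z) ->
  (wsq L w (fun=> 1%R) < +oo)%E -> ~ L l ->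
  exists2 e, 0 < e & forall z, L z -> e * (1 + cmod z) <= cmod (z - l).
Proof.
move=> w0 wloc Lw Ll; pose r := 2 * cmod l + 1.
have l0 := cmod_ge0 l.
have [d d0 Hd] := wloc r.
pose B := [set z | L z /\ cmod z <= r].
have Bfin : finite_set B.
  apply: contrapT => Binf.
  have S0 : (0 <= wsq L w (fun=> 1%R))%E := wsq_ge0 L _ w0.
  have SE : wsq L w (fun=> 1%R) = (fine (wsq L w (fun=> 1%R)))%:E by rewrite fineK// ge0_fin_numE.
  pose S := fine (wsq L w (fun=> 1%R)).
  have S00 : 0 <= S by rewrite fine_ge0.
  pose n := (Num.trunc (S / d)).+1.
  have [F FB nF] := @infinite_set_fset _ B n Binf.
  have : (\sum_(t <- finmap.enum_fset F) (cmod (1 : R[i]) ^+ 2 * w t)%:E <= S%:E)%E.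
    rewrite -SE; apply: esum_ge_seq; first exact: finmap.fset_uniq.
    by move=> t tF; case: (FB t tF).
  rewrite sumEFin lee_fin.
  have : S < d * n%:R.
    rewrite mulrC -ltr_pdivrMr//.
    have S1 : 0 <= S / d by rewrite divr_ge0// ltW.
    by case/andP: (truncn_itv S1).
  have : d * n%:R <= d * (size (finmap.enum_fset F))%:R.
    by rewrite ler_pM2l// ler_nat.
  have : d * (size (finmap.enum_fset F))%:R <=
      \sum_(t <- finmap.enum_fset F) (cmod (1 : R[i]) ^+ 2 * w t).
    rewrite -sum1_size natr_sum mulr_sumr big_seq [leRHS]big_seq; apply: ler_sum => t tF.
    rewrite mulr1 cmod1 expr1n mul1r; apply: Hd.
    by case: (FB t tF).
  move=> h1 h2 h3 h4.
  by have := lt_le_trans h3 (le_trans h2 (le_trans h1 h4)); rewrite ltxx.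
have [e1 e10 He1] : exists2 e, 0 < e & forall z, B z -> e <= cmod (z - l).
  move/finite_seqP : Bfin => [s Bs].
  have sl : l \notin s.
    by apply/negP => ls; have [] : B l by rewrite Bs.
  suff [e e0 He] : exists2 e : R, 0 < e & forall z, z \in s -> e <= cmod (z - l).
    by exists e => // z; rewrite Bs => /He.
  elim: s sl {Bs} => [|y s IH]; first by exists 1.
  rewrite in_cons negb_or => /andP[yl /IH[e e0 He]].
  exists (Num.min e (cmod (y - l))).
    by rewrite lt_min e0 cmod_gt0 subr_eq0 eq_sym.
  by move=> z; rewrite in_cons ge_min => /predU1P[->|/He ->//]; rewrite lexx orbT.
have r1 : 0 < 1 + r by rewrite /r; lra.
exists (Num.min 2^-1 (e1 / (1 + r))) => [|z Lz]; first by rewrite lt_min invr_gt0 ltr0n divr_gt0.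
have z0 := cmod_ge0 z.
have m1 : Num.min 2^-1 (e1 / (1 + r)) <= 2^-1 by rewrite ge_min lexx.
have m2 : Num.min 2^-1 (e1 / (1 + r)) <= e1 / (1 + r) by rewrite ge_min lexx orbT.
have [zr|zr] := leP (cmod z) r.
  apply: le_trans (He1 z (conj Lz zr)).
  apply: le_trans (_ : e1 / (1 + r) * (1 + r) <= _); last by rewrite divfK// gt_eqF.
  apply: ler_pM => //; last by rewrite lerD2l.
    by rewrite le_min invr_ge0 ler0n divr_ge0 ?(ltW e10) ?(ltW r1).
  by rewrite addr_ge0.
apply: le_trans (ler_wpM2r _ m1) _; first by rewrite addr_ge0.
apply: le_trans (cmodB_ge z l); move: zr; rewrite /r; lra.
Qed.

Variable alpha : R.
Hypothesis alpha_gt0 : 0 < alpha.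
Notation phi := (logsq_weight alpha).
Notation gauss := (gauss alpha).
Notation peak := (peak alpha).
Notation wt := (wt alpha).
Notation wt1 := (wt1 alpha).

Lemma gauss_le_peak n : gauss n <= peak n.
Proof.
rewrite /gauss /peak ler_expR ler_pM2r ?invr_gt0 ?mulr_gt0//.
by rewrite lerXn2r ?nnegrE// ler_nat.
Qed.

Lemma peak_ge0 n : 0 <= peak n. Proof. exact: expR_ge0. Qed.

(** The shifted part z g is isometric because [gauss n.+1] is [peak n]; the part l g uses
    [gauss_le_peak]. *)
Lemma mul_root_wsum l g : (wsum gauss (mul_root l g) <=
  (2 * (1 + cmod l ^+ 2))%:E * wsum peak g)%E.
Proof.
have g0 := gauss_ge0 alpha.
apply: le_trans (wsumD _ _ g0) _.
rewrite EFinM -muleA lee_wpmul2l// EFinD ge0_muleDl ?lee_fin ?sqr_ge0//.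
apply: leeD.
  rewrite mul1e /wsum (nneseries_recl_shift (f := fun n => cmod (if n is m.+1 then g m else 0) ^+ 2 * gauss n)).
    by rewrite cmod0 expr0n mul0r add0e.
  by move=> n; rewrite mulr_ge0 ?sqr_ge0.
apply: wsum_le => //; [exact: peak_ge0|exact: sqr_ge0|] => n.
rewrite cmodM cmodN exprMn -mulrA ler_wpM2l ?sqr_ge0//.
by rewrite ler_wpM2l ?sqr_ge0// gauss_le_peak.
Qed.

Section tail.
Variable l : R[i].
Let h j : R := expR (- (j%:R ^+ 2 / (4 * alpha))) * cmod l ^+ j.
Let h_ge0 j : 0 <= h j.
Proof. by rewrite mulr_ge0 ?expR_ge0 ?exprn_ge0 ?cmod_ge0. Qed.

(** Up to the factor e^(phi l), h is the row of the matrix at the point l. *)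
Lemma tail_kernel_sum : exists2 P : R, 0 < P & (\sum_(0 <= j <oo) (h j)%:E <= P%:E)%E.
Proof.
have [C C0 HC] := entry_decay alpha_gt0.
exists (C * expR (phi l) * 4) => [|]; first by rewrite !mulr_gt0 ?expR_gt0.
rewrite EFinM; apply: (@le_trans _ _ ((C * expR (phi l))%:E *
   \sum_(0 <= j <oo) (8^-1 ^+ distn j (kap alpha l) : R)%:E)%E).
  rewrite -nneseriesZl; last by move=> k _; rewrite lee_fin exprn_ge0.
  apply: lee_nneseries => j _; first by move=> _; rewrite lee_fin.
  rewrite -EFinM lee_fin mulrAC -ler_pdivrMr ?expR_gt0//.
  apply: le_trans (HC l j); rewrite cmod_entry /h [X in _ <= X]mulrAC expRN //.
rewrite lee_wpmul2l ?lee_fin ?mulr_ge0 ?expR_ge0 ?(ltW C0)//.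
exact: sum_eighth.
Qed.

(** Since m^2 + j^2 <= (m + j)^2, moving the root e m of the weight from index m to m + j gains the
    factor e^(- j^2 / (4 alpha)), which makes the powers of |l| summable; Cauchy-Schwarz with
    weights h does the rest. *)
Lemma tail_bound (P : R) a m : 0 < P -> (\sum_(0 <= j <oo) (h j)%:E <= P%:E)%E ->
  entire_coeffs a ->
  ((cmod (csum (fun j => a (m + j)%N * l ^+ j)) ^+ 2 * gauss m)%:E <=
  P%:E * \sum_(0 <= j <oo) (h j * (cmod (a (m + j)%N) ^+ 2 * gauss (m + j)))%:E)%E.
Proof.
move=> P0 hP Ea.
pose e (n : nat) : R := expR (n%:R ^+ 2 / (4 * alpha)).
have e2 n : gauss n = e n ^+ 2.
  by rewrite /gauss /e -expRM_natl; congr expR; field; rewrite gt_eqF.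
pose d := csum (fun j => a (m + j)%N * l ^+ j).
have sd := entire_csummable l (entire_coeffs_shift m Ea).
have := @weighted_cauchy_schwarz _ h (fun j => cmod (a (m + j)%N) * e (m + j)%N) P (cmod d * e m).
rewrite exprMn -e2.
have E j : cmod (a (m + j)%N) ^+ 2 * gauss (m + j) = (cmod (a (m + j)%N) * e (m + j)%N) ^+ 2.
  by rewrite exprMn -e2.
under [X in _ -> (_ <= _ * X)%E]eq_eseriesr do rewrite E.
apply => //.
- by move=> n; rewrite mulr_ge0 ?cmod_ge0 ?expR_ge0.
- by rewrite mulr_ge0 ?cmod_ge0 ?expR_ge0.
apply: (@le_trans _ _ ((e m)%:E * \sum_(0 <= j <oo) (cmod (a (m + j)%N * l ^+ j))%:E)%E).
  by rewrite mulrC EFinM lee_wpmul2l ?lee_fin ?expR_ge0//; exact: le_csum.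
rewrite -nneseriesZl; last by move=> j _; rewrite lee_fin cmod_ge0.
apply: lee_nneseries => j _.
  by move=> _; rewrite -EFinM lee_fin mulr_ge0 ?expR_ge0 ?cmod_ge0.
rewrite -EFinM lee_fin cmodM cmodX /h.
have -> : expR (- (j%:R ^+ 2 / (4 * alpha))) * cmod l ^+ j * (cmod (a (m + j)%N) * e (m + j)%N) =
  expR (- (j%:R ^+ 2 / (4 * alpha))) * e (m + j)%N * (cmod (a (m + j)%N) * cmod l ^+ j) by ring.
rewrite ler_wpM2r ?mulr_ge0 ?exprn_ge0 ?cmod_ge0// -expRD ler_expR natrD.
rewrite -mulNr -mulrDl ler_pM2r ?invr_gt0 ?mulr_gt0//.
have : 0 <= (m%:R : R) * j%:R by rewrite mulr_ge0.
by nra.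
Qed.

(** Both claims are instances of [tail_bound]: m = 0 is the value at l, and m = n + 1 is the n-th
    coefficient of the quotient. Each costs P once in [tail_bound] and once in the bound of h or of
    its sum. *)
Lemma division_wsum : exists2 D : R, 0 < D & forall a, entire_coeffs a ->
  ((cmod (pser a l) ^+ 2)%:E <= D%:E * wsum gauss a)%E /\
  exists g, [/\ entire_coeffs g, (wsum peak g <= D%:E * wsum gauss a)%E &
    forall z, pser a z - pser a l = (z - l) * pser g z].
Proof.
have [P P0 hP] := tail_kernel_sum.
have g0 := gauss_ge0 alpha.
exists (P * P) => [|a Ea]; first by rewrite mulr_gt0.
have hle j : h j <= P.
  by rewrite -lee_fin; apply: le_trans hP; exact: nneseries_ge_term.
have ag0 n : 0 <= cmod (a n) ^+ 2 * gauss n by rewrite mulr_ge0 ?sqr_ge0.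
split.
  have := tail_bound 0 P0 hP Ea; rewrite {1}/gauss expr0n mul0r expR0 mulr1.
  move/le_trans; apply; rewrite EFinM -muleA lee_wpmul2l ?lee_fin ?(ltW P0)//.
  rewrite -nneseriesZl; last by move=> n _; rewrite lee_fin.
  apply: lee_nneseries => j _; first by move=> _; rewrite lee_fin mulr_ge0.
  by rewrite -EFinM lee_fin ler_wpM2r.
have [/=] := division l Ea; set g := fun n => csum _ => Eg Hg.
exists g; split; [exact: Eg| |exact: Hg].
pose F (n j : nat) := (h j * (cmod (a (n.+1 + j)%N) ^+ 2 * gauss (n.+1 + j)))%:E.
apply: (@le_trans _ _ (\sum_(0 <= n <oo) (P%:E * \sum_(0 <= j <oo) F n j))%E).
  apply: lee_nneseries => n _; first by move=> _; rewrite lee_fin mulr_ge0 ?sqr_ge0 ?expR_ge0.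
  (* [peak n] and [gauss n.+1] are convertible, which is where the shift of index takes H to F^2. *)
  by have := tail_bound n.+1 P0 hP Ea.
have F0 n j : (0 <= F n j)%E by rewrite lee_fin mulr_ge0.
rewrite nneseriesZl; last by move=> n _; exact: nneseries_ge0.
rewrite EFinM -muleA lee_wpmul2l ?lee_fin ?(ltW P0)//.
rewrite nneseries_interchange//.
apply: (@le_trans _ _ (\sum_(0 <= j <oo) ((h j)%:E * wsum gauss a))%E).
  apply: lee_nneseries => j _; first by move=> _; apply: nneseries_ge0.
  rewrite /F; under eq_eseriesr do rewrite EFinM.
  rewrite nneseriesZl; last by move=> n _; rewrite lee_fin.
  rewrite lee_wpmul2l ?lee_fin//.
  under eq_eseriesr do rewrite addSnnS.
  exact: (nneseries_shift_le (f := fun n => cmod (a n) ^+ 2 * gauss n)).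
under eq_eseriesr do rewrite muleC.
have w0 := wsum_ge0 a g0.
have [wf|] := ltP (wsum gauss a) +oo%E; last first.
  rewrite leye_eq => /eqP ->.
  by rewrite [leRHS]muleC gt0_mulye ?lte_fin// leey.
rewrite -(fineK (_ : wsum gauss a \is a fin_num)) ?ge0_fin_numE//.
rewrite nneseriesZl; last by move=> n _; rewrite lee_fin.
by rewrite muleC lee_wpmul2r// lee_fin fine_ge0.
Qed.

End tail.

End division_norms.

Section remove_point.
Context {R : realType}.
Implicit Types (a b g : nat -> R[i]) (z l : R[i]) (f v : R[i] -> R[i]) (L : set R[i]).
Variable alpha : R.
Hypothesis alpha_gt0 : 0 < alpha.
Notation gauss := (gauss alpha).
Notation peak := (peak alpha).
Notation wt := (wt alpha).
Notation wt1 := (wt1 alpha).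

Lemma ereal_real (x : \bar R) : (0 <= x)%E -> (x < +oo)%E ->
  exists2 r : R, 0 <= r & x = r%:E.
Proof.
move=> x0 xf; exists (fine x); first exact: fine_ge0.
by rewrite fineK// ge0_fin_numE.
Qed.

Lemma explog2 z : expR (2 * logmod z) = expR (logmod z) ^+ 2.
Proof. by rewrite expr2 -expRD; congr expR; ring. Qed.

Lemma explog_ge1 z : 1 <= expR (logmod z).
Proof. by rewrite -expR0 ler_expR logmod_ge0. Qed.

Lemma wt_le_wt1 z : wt z <= wt1 z.
Proof.
rewrite /wt1 ler_peMr ?wt_ge0// explog2 expr_ge1 ?explog_ge1//.
Qed.

Lemma wt_locally_bounded (r : R) :
  exists2 e, 0 < e & forall z, cmod z <= r -> e <= wt z.
Proof.
have [r0|r0] := ltP r 0.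
  exists 1 => // z zr; have := le_lt_trans (le_trans (cmod_ge0 z) zr) r0.
  by rewrite ltxx.
have r1 : 0 < 1 + r by rewrite ltr_pwDl.
exists (expR (- (2 * (alpha * ln (1 + r) ^+ 2)))) => [|z zr]; first exact: expR_gt0.
rewrite ler_expR lerN2 ler_wpM2l// phiE ler_wpM2l ?(ltW alpha_gt0)//.
rewrite lerXn2r ?nnegrE ?logmod_ge0//; first by rewrite ln_ge0// lerDl.
rewrite -ler_expR lnK ?posrE//; apply: le_trans (explog_le z) _.
by rewrite lerD2l.
Qed.

Lemma dist_sq_le z l : cmod (z - l) ^+ 2 * wt z <= (1 + cmod l) ^+ 2 * wt1 z.
Proof.
rewrite /wt1 explog2 [X in _ <= X]mulrCA [X in X <= _]mulrC ler_wpM2l ?wt_ge0//.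
rewrite -exprMn lerXn2r ?nnegrE ?cmod_ge0 ?mulr_ge0 ?addr_ge0 ?cmod_ge0 ?expR_ge0//.
apply: le_trans (cmodB_le z l) _.
have h1 := explog_ge1 z; have h2 := cmod_le_explog z; have h3 := cmod_ge0 l.
by nra.
Qed.

Lemma wt1_le_dist (e : R) z l : 0 < e -> e * (1 + cmod z) <= cmod (z - l) ->
  wt1 z <= e ^- 2 * (cmod (z - l) ^+ 2 * wt z).
Proof.
move=> e0 h; rewrite ler_pdivlMl ?exprn_gt0// /wt1 explog2 mulrCA.
rewrite [X in _ <= X]mulrC ler_wpM2l ?wt_ge0// -exprMn.
rewrite lerXn2r ?nnegrE ?cmod_ge0 ?mulr_ge0 ?(ltW e0) ?expR_ge0//.
by apply: le_trans h; rewrite ler_wpM2l ?explog_le// ltW.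
Qed.

Variables (L : set R[i]) (l : R[i]).
Hypothesis Ll : L l.
Let L' := L `\ l.
Let wt0 := @wt_ge0 R alpha.
Let wt10 := @wt1_ge0 R alpha.
Let L'l : ~ L' l. Proof. by case=> _; apply. Qed.

Let L'E z : L' z -> z - l != 0.
Proof. by case=> _ /eqP; rewrite subr_eq0. Qed.

(** The upper sampling bound for the constant function 1. *)
Lemma weight_sum_fin (p : nat -> R) (w : R[i] -> R) (M : set R[i]) : (forall n, 0 <= p n) -> cis_weighted p w M ->
  (wsq M w (fun=> 1%R) < +oo)%E.
Proof.
move=> p0 [[K K0 HK] _].
have pf : (wsum p (monomial 0) < +oo :> \bar R)%E by rewrite wsum_monomial// ltry.
have [_] := HK _ (@monomial_coeffs R 0) pf.
rewrite (@eq_wsq _ M w _ (fun=> 1%R)); last by move=> z _; rewrite pser_monomial expr0.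
move/le_lt_trans; apply; rewrite wsum_monomial// -EFinM.
exact: ltry.
Qed.

(* A convergent sum of the weights leaves finitely many points in each disc. *)
Lemma separation : (wsq L' wt (fun=> 1%R) < +oo)%E -> exists2 e, 0 < e & forall v,
  (wsq L' wt1 v <= (e ^- 2)%:E * wsq L' wt (fun z => (z - l) * v z)%R)%E.
Proof.
move=> h; have [e e0 He] := isolated_points wt0 wt_locally_bounded h L'l.
exists e => // v; apply: wsq_le => //; first by rewrite invr_ge0 sqr_ge0.
move=> z L'z; rewrite cmodM exprMn.
have := wt1_le_dist e0 (He z L'z); have := sqr_ge0 (cmod (v z)).
move: (cmod (v z) ^+ 2) => x x0 /(ler_wpM2l x0) /le_trans; apply.
by rewrite le_eqVlt; apply/orP; left; apply/eqP; ring.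
Qed.

Lemma wsq_mul_le v : (wsq L' wt (fun z => (z - l) * v z)%R <=
  ((1 + cmod l) ^+ 2)%:E * wsq L' wt1 v)%E.
Proof.
apply: wsq_le => //; first exact: sqr_ge0.
move=> z L'z; rewrite cmodM exprMn.
have := dist_sq_le z l; have := sqr_ge0 (cmod (v z)).
move: (cmod (v z) ^+ 2) => x x0 /(ler_wpM2l x0) h.
by rewrite mulrAC mulrC [X in _ <= X]mulrCA.
Qed.

(** A function g is replaced by (z - l) g, and data u by (z - l) u with the value 0 at l. For the
    functions the norms are compared by [division_wsum] and [mul_root_wsum], for the values by
    [wsq_mul_le] and [separation]. *)
Lemma cis_weighted_remove : cis_weighted gauss wt L -> cis_weighted peak wt1 L'.
Proof.
move=> H; have one := weight_sum_fin (gauss_ge0 alpha) H.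
have [[K K0 HK] I] := H.
have [e e0 He] := separation (le_lt_trans (wsq_subD1 _ _ _ wt0) one).
have [D D0 HD] := division_wsum alpha_gt0 l.
have peak0 := @peak_ge0 R alpha.
have Mc0 : 0 < 2 * (1 + cmod l ^+ 2) by rewrite mulr_gt0// ltr_pwDl ?sqr_ge0.
have l10 : 0 < (1 + cmod l) ^+ 2 by rewrite exprn_gt0// ltr_pwDl ?cmod_ge0.
have wsqL v : v l = 0 -> wsq L wt v = wsq L' wt v.
  by move=> v0; rewrite (wsq_setD1 _ wt0 Ll) v0 cmod0 expr0n mul0r add0e.
split.
- exists (Num.max (D * K * (1 + cmod l) ^+ 2) (e ^- 2 * K * (2 * (1 + cmod l ^+ 2)))).
    rewrite lt_max; apply/orP; left; apply: mulr_gt0 => //; exact: mulr_gt0.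
  move=> g Eg gf; pose a := mul_root l g.
  have Ea : entire_coeffs a := mul_root_entire l Eg.
  have aw := mul_root_wsum alpha_gt0 l g.
  have af : (wsum gauss a < +oo)%E.
    apply: le_lt_trans aw _; apply: lte_mul_pinfty => //.
    by rewrite lee_fin ltW.
  have Ga z : pser a z = (z - l) * pser g z := pser_mul_root l z Eg.
  have Gl : pser a l = 0 by rewrite Ga subrr mul0r.
  have [lo up] := HK a Ea af.
  have [_ [g' [Eg' g'D Hg']]] := HD a Ea.
  (* The quotient produced by [division_wsum] is g itself, so its estimate bounds g by (z - l) g. *)
  have gg' : g' = g.
    apply: (pser_eq_off (l := l)) => // z zl.
    have zl0 : z - l != 0 by rewrite subr_eq0.
    by apply: (mulfI zl0); rewrite -Hg' Gl subr0 Ga.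
  have WG : wsq L' wt (pser a) = wsq L' wt (fun z => (z - l) * pser g z).
    by apply: eq_wsq => z _.
  rewrite gg' in g'D; rewrite wsqL// WG in lo up; split.
    apply: (@le_trans _ _ ((D * K * (1 + cmod l) ^+ 2)%:E * wsq L' wt1 (pser g))%E).
      apply: le_chain (wsq_mul_le _); first by rewrite mulr_ge0 ?ltW.
      exact: (le_chain (ltW D0) g'D lo).
    by rewrite lee_wpmul2r ?wsq_ge0 ?lee_fin ?le_max ?lexx.
  apply: (@le_trans _ _ ((e ^- 2 * K * (2 * (1 + cmod l ^+ 2)))%:E * wsum peak g)%E).
    apply: le_chain aw; first by rewrite mulr_ge0 ?invr_ge0 ?sqr_ge0 ?ltW.
    by apply: le_chain up; rewrite ?invr_ge0 ?sqr_ge0.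
  by rewrite lee_wpmul2r ?wsum_ge0 ?lee_fin ?le_max ?lexx ?orbT.
- move=> u uf; pose v z := (z - l) * u z.
  have vl : v l = 0 by rewrite /v subrr mul0r.
  have [|a [Ea af Ha]] := I v.
    rewrite wsqL//; apply: le_lt_trans (wsq_mul_le u) _.
    by apply: lte_mul_pinfty => //; rewrite lee_fin ltW.
  have [_ [g [Eg gD Hg]]] := HD a Ea.
  exists g; split => //.
    by apply: le_lt_trans gD _; apply: lte_mul_pinfty => //; rewrite lee_fin ltW.
  move=> z L'z; apply: (mulfI (L'E L'z)).
  by rewrite -Hg (Ha l)// vl subr0 Ha//; case: L'z.
Qed.

Lemma wsum_rebuild g (x : R[i]) : (wsum gauss (fun n => mul_root l g n + x * monomial 0 n)%R <=
  2%:E * ((2 * (1 + cmod l ^+ 2))%:E * wsum peak g + (cmod x ^+ 2)%:E))%E.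
Proof.
have g0 := gauss_ge0 alpha.
apply: le_trans (wsumD _ _ g0) _; rewrite lee_wpmul2l//.
apply: leeD; first exact: mul_root_wsum.
apply: (@le_trans _ _ ((cmod x ^+ 2)%:E * wsum gauss (monomial 0))%E).
  apply: wsum_le; rewrite ?sqr_ge0// => n.
  by rewrite cmodM exprMn mulrA.
by rewrite wsum_monomial// /gauss expr0n mul0r expR0 mule1.
Qed.

Lemma rebuild_entire g (x : R[i]) : entire_coeffs g ->
  entire_coeffs (fun n => mul_root l g n + x * monomial 0 n)%R.
Proof.
by move=> Eg; apply: entire_coeffsD; [exact: mul_root_entire|apply: entire_coeffsZ; exact: monomial_coeffs].
Qed.

Lemma pser_rebuild g (x z : R[i]) : entire_coeffs g ->
  pser (fun n => mul_root l g n + x * monomial 0 n)%R z = (z - l) * pser g z + x.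
Proof.
move=> Eg; have E0 := @monomial_coeffs R 0.
rewrite pserD ?pserZ ?pser_mul_root ?pser_monomial ?expr0 ?mulr1//; first exact: mul_root_entire.
exact: entire_coeffsZ.
Qed.

(** Every f in H is f l + (z - l) g with g in F^2, so the value at l is one additional free datum.
    Constants have finite norm on L' because the weights have the finite sum T. *)
Lemma cis_weighted_insert : cis_weighted peak wt1 L' -> cis_weighted gauss wt L.
Proof.
move=> H; have peak0 := @peak_ge0 R alpha.
have g0 := gauss_ge0 alpha.
have one1 := weight_sum_fin peak0 H.
have one : (wsq L' wt (fun=> 1%R) < +oo)%E.
  apply: le_lt_trans one1; rewrite -[leRHS]mul1e; apply: wsq_le => // z _.
  by rewrite mul1r ler_wpM2l ?sqr_ge0// wt_le_wt1.
have [[K K0 HK] I] := H.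
have [e e0 He] := separation one.
have [D D0 HD] := division_wsum alpha_gt0 l.
have [T T0 TE] := ereal_real (wsq_ge0 L' (fun=> 1%R) wt0) one.
have wl : 0 < wt l := expR_gt0 _.
set B := (1 + cmod l) ^+ 2; have B0 : 0 <= B := sqr_ge0 _.
set Q := 2 * (1 + cmod l ^+ 2).
have Q0 : 0 <= Q by rewrite mulr_ge0// addr_ge0 ?sqr_ge0.
have e20 : 0 <= e ^- 2 by rewrite invr_ge0 sqr_ge0.
have cstT (x : R[i]) : (wsq L' wt (fun=> x) <= (cmod x ^+ 2 * T)%:E)%E.
  rewrite EFinM -TE; apply: le_trans (wsqZ _ _ x wt0).
  by rewrite (@eq_wsq _ L' wt (fun=> x) (fun l => x * 1))// => z _; rewrite mulr1.
have quot v (x : R[i]) (n : R) (u : R[i] -> R[i]) :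
    (forall z, L' z -> (z - l) * u z = v z - x) -> (wsq L' wt v <= n%:E)%E ->
    (wsq L' wt1 u <= (e ^- 2 * (2 * (n + cmod x ^+ 2 * T)))%:E)%E.
  move=> uv vn; apply: le_trans (He u) _.
  rewrite (@eq_wsq _ L' wt _ (fun z => v z + - x)); last by move=> z /uv.
  rewrite EFinM lee_wpmul2l ?lee_fin//; apply: le_trans (wsqD _ _ _ wt0) _.
  rewrite EFinM lee_wpmul2l// EFinD; apply: leeD => //.
  by apply: le_trans (cstT _) _; rewrite cmodN.
split; last first.
  move=> v vf; have [n n0 nE] := ereal_real (wsq_ge0 L v wt0) vf.
  have vn : (wsq L' wt v <= n%:E)%E by rewrite -nE; exact: wsq_subD1.
  have [|g [Eg gf Hg]] := I (fun z => (v z - v l) / (z - l)).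
    apply: le_lt_trans (quot v (v l) n _ _ vn) (ltry _).
    by move=> z L'z; rewrite mulrC divfK// L'E.
  exists (fun n => mul_root l g n + v l * monomial 0 n); split.
  - exact: rebuild_entire.
  - have [y y0 yE] := ereal_real (wsum_ge0 g peak0) gf.
    apply: le_lt_trans (wsum_rebuild g (v l)) _.
    by rewrite yE; exact: ltry.
  - move=> z Lz; rewrite pser_rebuild//.
    have [->|zl] := eqVneq z l; first by rewrite subrr mul0r add0r.
    have L'z : L' z by split => // /eqP; rewrite (negbTE zl).
    by rewrite Hg// mulrC divfK ?L'E// subrK.
pose K1 := D * wt l + 2 * (D * T + B * (K * D)).
(* K1 bounds the values by f: D bounds both f l and g. K2 bounds f by its values: f is rebuilt from
   g and f l, g is sampled on L', its values are those of (f - f l) / (z - l), and |f l|^2 is at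
   most N / wt l. *)
pose K2 := 2 * (Q * (K * (e ^- 2 * (2 * (1 + (wt l)^-1 * T)))) + (wt l)^-1).
exists (Num.max 1 (Num.max K1 K2)) => [|a Ea af]; first by rewrite lt_max ltr01.
have [[x x0 xE] [G2 [g [Eg gD Hg]]]] := (ereal_real (wsum_ge0 a g0) af, HD a Ea).
set G := pser a in G2 Hg *.
rewrite xE -EFinM lee_fin in G2.
rewrite xE -EFinM in gD.
have gf := le_lt_trans gD (ltry _).
have [y y0 yE] := ereal_real (wsum_ge0 g peak0) gf.
rewrite yE lee_fin in gD.
have [lo up] := HK g Eg gf; rewrite yE in lo up.
have sf : (wsq L' wt1 (pser g) < +oo)%E by apply: le_lt_trans up _; rewrite -EFinM ltry.
have [s s0 sE] := ereal_real (wsq_ge0 L' (pser g) wt10) sf.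
rewrite sE -EFinM !lee_fin in lo up.
have GL' : (wsq L' wt G <= (2 * (cmod (G l) ^+ 2 * T + B * s))%:E)%E.
  rewrite (@eq_wsq _ L' wt _ (fun z => G l + (z - l) * pser g z)); last first.
    by move=> z _; rewrite -Hg addrC subrK.
  apply: le_trans (wsqD _ _ _ wt0) _; rewrite EFinM lee_wpmul2l// EFinD.
  by apply: leeD => //; rewrite EFinM -sE; exact: wsq_mul_le.
have Gf : (wsq L' wt G < +oo)%E by apply: le_lt_trans GL' (ltry _).
have [n n0 nE] := ereal_real (wsq_ge0 L' G wt0) Gf.
rewrite nE lee_fin in GL'.
rewrite xE (wsq_setD1 _ wt0 Ll) nE -EFinD -!EFinM !lee_fin -/G.
set N := cmod (G l) ^+ 2 * wt l + n.
have Gl0 := sqr_ge0 (cmod (G l)).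
have N0 : 0 <= N by rewrite addr_ge0// mulr_ge0// ltW.
split; last first.
  apply: (@le_trans _ _ (K1 * x)); last by rewrite ler_wpM2r// !le_max lexx orbT.
  rewrite /K1 mulrDl; apply: lerD.
    by rewrite [leRHS]mulrAC ler_wpM2r// ltW.
  apply: le_trans GL' _; rewrite -mulrA ler_wpM2l// mulrDl; apply: lerD.
    by rewrite [leRHS]mulrAC ler_wpM2r.
  rewrite -mulrA ler_wpM2l//; apply: le_trans up _.
  by rewrite -mulrA ler_wpM2l// ltW.
apply: (@le_trans _ _ (K2 * N)); last by rewrite ler_wpM2r// !le_max lexx !orbT.
have aE : a = (fun n => mul_root l g n + G l * monomial 0 n).
  apply: pser_inj => //; first exact: rebuild_entire.
  by move=> z; rewrite pser_rebuild// -Hg subrK.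
have h : x <= 2 * (Q * y + cmod (G l) ^+ 2).
  by rewrite -lee_fin; have := wsum_rebuild g (G l); rewrite -aE xE yE.
apply: le_trans h _; rewrite /K2 -mulrA ler_wpM2l// mulrDl.
have GN : cmod (G l) ^+ 2 <= (wt l)^-1 * N.
  by rewrite ler_pdivlMl// mulrC lerDl.
apply: lerD => //; rewrite -/Q -mulrA ler_wpM2l//.
apply: le_trans lo _; rewrite -mulrA ler_wpM2l ?(ltW K0)//.
rewrite -lee_fin -sE.
have := quot G (G l) n (pser g) (fun z _ => esym (Hg z)); rewrite nE lexx => /(_ isT).
move=> /le_trans; apply; rewrite lee_fin -!mulrA ler_wpM2l// ler_wpM2l// mulrDl mul1r.
apply: lerD; first by rewrite lerDr mulr_ge0// ltW.
by have := ler_wpM2r T0 GN; rewrite expr2 -[leLHS]mulrA [leRHS]mulrAC.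
Qed.

Theorem cis_weighted_setD1 : cis_weighted gauss wt L <-> cis_weighted peak wt1 L'.
Proof. by split; [exact: cis_weighted_remove|exact: cis_weighted_insert]. Qed.

End remove_point.

(** * The equivalences *)

Section main.
Context {R : realType}.
Variable alpha : R.
Hypothesis alpha_gt0 : 0 < alpha.
Notation phi := (logsq_weight alpha).
Implicit Types L : set R[i].

Lemma complete_interpolating_infty_weighted L :
  complete_interpolating_infty phi L <-> cis_weighted (gauss alpha) (wt alpha) L.
Proof.
have [C C0 HC] := entry_decay alpha_gt0.
have diag z : L z -> expR (- (4 * alpha)^-1) <= cmod (entry alpha z (kap alpha z)).
  by move=> _; exact: entry_diag.
have E1 := complete_interpolating_inftyP alpha_gt0 L.
have E2 := cis_sup_iff_l2 C0 (expR_gt0 _) HC diag.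
have E3 := cis_weighted_l2 alpha_gt0 L.
tauto.
Qed.

Lemma complete_interpolating_setD1 L l : L l ->
  complete_interpolating_infty phi L <-> complete_interpolating2 phi (L `\ l).
Proof.
move=> Ll; have E1 := complete_interpolating_infty_weighted L.
have E2 := cis_weighted_setD1 alpha_gt0 Ll.
have E3 := cis_weighted_fock2 alpha_gt0 (L `\ l).
tauto.
Qed.

(** For empty L the lower bound at the constant function 1, of norm 1 in H, would read 1 <= 0. *)
Lemma complete_interpolating_infty_nonempty L :
  complete_interpolating_infty phi L -> L !=set0.
Proof.
move=> /complete_interpolating_infty_weighted[[K K0 HK] _].
have [//|/set0P/negP] := pselect (L !=set0); rewrite negbK => /eqP L0.
have g0 := gauss_ge0 alpha.
have [|h _] := HK _ (@monomial_coeffs R 0); first by rewrite wsum_monomial// ltry.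
move: h; rewrite L0 /wsq esum_set0 mule0 wsum_monomial// lee_fin /gauss.
by rewrite expr0n mul0r expR0 ler10.
Qed.

End main.

Theorem theorem1p2 (R : realType) (alpha : R) (alpha_gt0 : 0 < alpha)
    (Lambda : set R[i]) (Lambda_countable : countable Lambda) :
  let phi := logsq_weight alpha in
  (complete_interpolating_infty phi Lambda <->
   exists2 l, Lambda l & complete_interpolating2 phi (Lambda `\ l)) /\
  (complete_interpolating_infty phi Lambda <->
   Lambda !=set0 /\
   forall l, Lambda l -> complete_interpolating2 phi (Lambda `\ l)).
Proof.
move=> phi.
have E l : Lambda l -> complete_interpolating_infty phi Lambda <->
    complete_interpolating2 phi (Lambda `\ l) :=
  @complete_interpolating_setD1 _ _ alpha_gt0 Lambda l.
have N := @complete_interpolating_infty_nonempty _ _ alpha_gt0 Lambda.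
split; split.
- by move=> H; have [l Ll] := N H; exists l => //; apply/(E l Ll).
- by move=> [l Ll H]; apply/(E l Ll).
- by move=> H; split; [exact: N|move=> l Ll; apply/(E l Ll)].
- by move=> [[l Ll] H]; apply/(E l Ll); exact: H.
Qed.
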